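(* Let $\ell$ be a prime and $m\ge1$. There is a constant $r\ge1$ depending only on $\ell$ and $m$ such that for every $\epsilon>0$ there exists a constant $c(m,\ell,\epsilon)$ with the following property: for all number fields $k$ of degree $[k:\mathbb{Q}]=m$, all finite subsets $S\subset\mathbb{P}(k)$ and all $\mathfrak{q}\in\mathbb{P}(k)$, $$Y^S(k,C_\ell;x)\le c(m,\ell,\epsilon)\,|\mathrm{Cl}(\tilde k)_\ell|\,D^{r\epsilon}\,x^{\frac{1}{\ell-1}+\epsilon}\quad\text{for all }x>0,$$ where $D=\prod_{\mathfrak{p}\in S,\ \mathfrak{p}\ne\mathfrak{q},\ \mathfrak{p}\nmid(\ell)}\mathcal{N}(\mathfrak{p})$. In particular (case $S=\emptyset$), $$Z(k,C_\ell;x)\le c(m,\ell,\epsilon)\,|\mathrm{Cl}(\tilde k)_\ell|\,x^{\frac{1}{\ell-1}+\epsilon}\quad\text{for all }x>0.$$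
   Context: All number fields lie in a fixed algebraic closure of $\mathbb{Q}$; $\mathbb{P}(k)$ is the set of prime ideals of $k$ and $\mathcal N$ the absolute norm. $\tilde k=k(\zeta)$ where $\zeta$ is a primitive $\ell$-th root of unity, and $\mathrm{Cl}(\tilde k)_\ell$ denotes the largest elementary abelian $\ell$-quotient of the ideal class group of $\tilde k$. For a positive integer $b$, $b^S$ denotes the largest divisor of $b$ coprime to the norms $\mathcal{N}(\mathfrak p)$, $\mathfrak p\in S$. $Y^S(k,C_\ell;x)$ is the number of cyclic Galois extensions $K/k$ of degree $\ell$ (inside $\bar{\mathbb Q}$) with $\mathcal{N}(d_{K/k})^S\le x$, and $Z(k,C_\ell;x)$ the number of those with $\mathcal N(d_{K/k})\le x$. (Note $a(C_\ell)=1/(\ell-1)$.) *)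

(* Defs.v *)
From HB Require Import structures.
From mathcomp Require Import all_boot all_order all_algebra all_field.
From mathcomp Require Import finmap.
From mathcomp Require Import all_classical all_reals all_analysis.

Set Implicit Arguments.
Unset Strict Implicit.
Unset Printing Implicit Defensive.

Import Order.TTheory GRing.Theory Num.Theory.

Local Open Scope classical_set_scope.
Local Open Scope ring_scope.

(* A (commutative) group is given by a set [G] of elements of an ambient type,
   an operation [op] and a neutral element [one].  The quotient of [G] by a
   subgroup [H] is the set [quotient op G H] of cosets, with the operation
   [setop op] and the neutral element [H]. *)
Section SetGroups.
Variable T : Type.
Implicit Types (op : T -> T -> T) (one : T) (G H A B : set T).

Definition setop op A B : set T := [set op a b | a in A & b in B].

Definition coset op H (x : T) : set T := [set op x h | h in H].

Definition quotient op G H : set (set T) := [set coset op H x | x in G].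

Definition is_subgroup op one G H : Prop :=
  [/\ H `<=` G, H one, (forall x y, H x -> H y -> H (op x y))
    & (forall x, H x -> exists2 y, H y & op x y = one)].

Definition elementary_abelian (l : nat) op one G : Prop :=
  (forall x y, G x -> G y -> op x y = op y x) /\
  (forall x, G x -> iterop l op x one = one).

End SetGroups.

(* The quotient of [G] by the smallest subgroup for which it is elementary
   abelian, that is, the largest elementary abelian [l]-quotient of [G]. *)
Definition elementary_quotient (T : Type) (l : nat) (op : T -> T -> T)
    (one : T) (G : set T) : set (set T) :=
  quotient op G
    (smallest [set H | is_subgroup op one G H /\
                 elementary_abelian l (setop op) H (quotient op G H)] set0).

(* All fields are subfields of [algC], which is an algebraic closure of the
   field of rational numbers [Crat]. *)
Section NumberFields.
Implicit Types (k K I J p : set algC) (n : nat).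

Definition is_subfield k : Prop := divring_closed (mem k).

Definition is_basis k K n (e : 'I_n -> algC) : Prop :=
  (forall i, K (e i)) /\
  (forall x, K x -> exists! c : {ffun 'I_n -> algC},
     (forall i, k (c i)) /\ x = \sum_i c i * e i).

Definition has_degree k K n : Prop := exists e : 'I_n -> algC, is_basis k K e.

Definition is_number_field n k : Prop :=
  is_subfield k /\ has_degree [set` Crat] k n.

Definition adjoin k (z : algC) : set algC :=
  smallest is_subfield (k `|` [set z]).

(* [s] is a function on [algC] of which only the restriction to [K] matters. *)
Definition is_automorphism k K (s : algC -> algC) : Prop :=
  [/\ set_bij K K s,
      (forall x y, K x -> K y -> s (x + y) = s x + s y),
      (forall x y, K x -> K y -> s (x * y) = s x * s y)
    & (forall x, k x -> s x = x)].

Definition is_galois k K : Prop :=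
  (exists n, has_degree k K n) /\
  [set x | K x /\ forall s, is_automorphism k K s -> s x = x] = k.

Definition is_cyclic k K : Prop :=
  exists2 s, is_automorphism k K s
    & forall t, is_automorphism k K t ->
        exists n, forall x, K x -> t x = iter n s x.

Definition is_cyclic_extension k n K : Prop :=
  [/\ is_subfield K, k `<=` K, has_degree k K n, is_galois k K
    & is_cyclic k K].

(* The trace of the matrix of the multiplication by [x] on [K] in a [k]-basis
   of [K]; it does not depend on the basis. *)
Definition rel_trace k K (x : algC) : algC :=
  xget 0 [set t | exists n (e : 'I_n -> algC) (M : 'M[algC]_n),
    [/\ is_basis k K e, (forall i j, k (M i j)),
        (forall i, x * e i = \sum_j M i j * e j) & t = \tr M]].

Definition integers k : set algC := [set x | k x /\ x \in Aint].

Definition is_submodule k I : Prop :=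
  [/\ I 0, (forall x y, I x -> I y -> I (x + y))
    & (forall a x, integers k a -> I x -> I (a * x))].

Definition module_span k (A : set algC) : set algC :=
  smallest (is_submodule k) A.

Definition is_ideal k I : Prop := is_submodule k I /\ I `<=` integers k.

(* The zero ideal is excluded. *)
Definition is_prime k p : Prop :=
  [/\ is_ideal k p, p <> [set 0], p <> integers k
    & forall x y, integers k x -> integers k y -> p (x * y) -> p x \/ p y].

Definition ideal_mul k I J : set algC :=
  module_span k [set x * y | x in I & y in J].

Definition ideal_dvd k I J : Prop :=
  exists2 M, is_ideal k M & J = ideal_mul k I M.

(* The cardinality of the quotient of the ring of integers by [I], which is
   finite if [I] is not the zero ideal ([fset_set] is empty on infinite sets). *)
Definition ideal_norm k I : nat :=
  #|` fset_set (quotient +%R (integers k) I)|.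

Definition is_fractional k I : Prop :=
  [/\ is_submodule k I, I `<=` k, I <> [set 0]
    & exists d, [/\ integers k d, d != 0
                  & forall x, I x -> integers k (d * x)]].

Definition principal k : set (set algC) :=
  [set module_span k [set a] | a in [set a | k a /\ a != 0]].

Definition class_group k : set (set (set algC)) :=
  quotient (ideal_mul k) [set I | is_fractional k I] (principal k).

(* A quotient of the class group, hence a finite set. *)
Definition class_group_ell_order (l : nat) k : nat :=
  #|` fset_set (elementary_quotient l (setop (ideal_mul k)) (principal k)
                  (class_group k))|.

(* The ideal generated by the discriminants of all [k]-bases of [K] which
   consist of integers of [K]. *)
Definition discriminant k K : set algC :=
  module_span k [set d | exists n (e : 'I_n -> algC),
    [/\ is_basis k K e, (forall i, integers K (e i))
      & d = \det (\matrix_(i, j) rel_trace k K (e i * e j))]].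

Definition prime_to_part k (S : {fset set algC}) (b : nat) : nat :=
  \max_(d <- divisors b | all (fun p => coprime d (ideal_norm k p)) S) d.

Definition tame_product k (l : nat) (S : {fset set algC}) q : nat :=
  \prod_(p <- S | (p != q) &&
      ~~ `[< ideal_dvd k p (module_span k [set l%:R]) >])
     ideal_norm k p.

(* The counting functions take the value [+oo] on infinite sets. *)
Definition count_Z (R : realType) k (l : nat) (x : R) : \bar R :=
  counting [set K | is_cyclic_extension k l K /\
    (ideal_norm k (discriminant k K))%:R <= x].

Definition count_Y (R : realType) k (S : {fset set algC}) (l : nat) (x : R)
    : \bar R :=
  counting [set K | is_cyclic_extension k l K /\
    (prime_to_part k S (ideal_norm k (discriminant k K)))%:R <= x].

End NumberFields.

(* Main.v *)
Require Import Defs.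
From HB Require Import structures.
From mathcomp Require Import all_boot all_order all_algebra all_field.
From mathcomp Require Import finmap zify ring lra.
From mathcomp Require Import all_classical all_reals all_analysis.

Set Implicit Arguments.
Unset Strict Implicit.
Unset Printing Implicit Defensive.

Import Order.TTheory GRing.Theory Num.Theory.

Local Open Scope classical_set_scope.
Local Open Scope ring_scope.

(* By Kummer theory, K(zeta) = F(alpha^(1/l)) with F = k(zeta), and the class of
   alpha modulo l-th powers in F determines K, the unique subfield of degree l
   over k.  If P is a prime of F, prime to l, at which the valuation of alpha is
   not divisible by l, then the prime p of k below P satisfies p^(l - 1) | d(K/k):
   this is read off the matrix of the Lagrange resolvents of an integral basis.
   Let T(K) be the finite set of the primes of k below a prime of F at which the
   valuation of alpha is not divisible by l.  The elements of F modulo l-th powers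
   of valuation divisible by l outside a finite set T' number at most
   l^(|T'| + rank of the units + 1) |Cl(F)_l|, so that at most C0 C^|T| |Cl(F)_l|
   fields K have T(K) = T, with C and C0 depending on l and m.

   Call a prime of k bad if its residue characteristic is l or that of an element
   of S.  The norms of the other primes p in T(K) are prime to those of S, whence
   prod N(p)^(l - 1) <= x.  With w(p) = 1 at the bad primes and N(p)^-s elsewhere,
   s = 1 + (l - 1) eps, this gives 1 <= x^(1/(l - 1) + eps) prod_(p in T(K)) w(p),
   and summing over T bounds the number of fields by
   C0 |Cl(F)_l| x^(1/(l - 1) + eps) prod_p (1 + C w(p)).
   The good primes contribute at most (prod_c (1 + C c^-s))^m.  The bad ones
   contribute at most Q^(2 + #{p | D}), Q = (1 + C)^m, as at most m primes share a
   residue characteristic, which is l, that of q, or that of a p | D; and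
   Q^#{p | D} = O(D^eps), because Q <= N(p)^eps for all but a bounded number of
   primes p.  Thus r = 1. *)

(** * Subfields and their integers *)

(** All constants may depend on [l] and the degree only, so exact structure theorems give way to
    upper bounds that see nothing but the degree: spanning families for bases, at most [F:Q]
    independent units, at most [F:Q] primes over a rational prime. The exponent l - 1 in the
    discriminant arises without completions. Row j of the resolvent matrix lies in b^j F, where b^l
    = alpha, and the factor b^((l - j) mod l) brings it into F. If v is the valuation of alpha at P,
    the entries of row j then have valuation at least ((l - j) mod l) v / l; as l does not divide v,
    rounding up gains 1 for each pair j, l - j. So the square of the determinant has valuation at
    least (l - 1)(v + 1), of which alpha^(l - 1) accounts for (l - 1) v; the rest belongs to the
    discriminant. It passes from P to p because k(zeta)/k is unramified outside l. The weights are a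
    form of Rankin's method: with e = 1/(l - 1) + eps, the exponent s = (l - 1) e exceeds 1, so that
    the product over the good primes converges, while each bad prime, of weight 1, costs a constant
    factor. *)

Definition subfield_pred (k : set algC) of is_subfield k : {pred algC} := mem k.

HB.instance Definition _ (k : set algC) (kF : is_subfield k) :=
  GRing.isDivringClosed.Build algC (subfield_pred kF) kF.

Section Subfield.
Variables (k : set algC) (kF : is_subfield k).

Lemma subfieldP x : reflect (k x) (x \in subfield_pred kF).
Proof. exact: asboolP. Qed.

Lemma sf0 : k 0. Proof. exact/subfieldP/rpred0. Qed.
Lemma sf1 : k 1. Proof. exact/subfieldP/rpred1. Qed.
Lemma sfD x y : k x -> k y -> k (x + y).
Proof. by move=> /subfieldP kx /subfieldP ky; apply/subfieldP/rpredD. Qed.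
Lemma sfN x : k x -> k (- x).
Proof. by move=> /subfieldP kx; apply/subfieldP; rewrite rpredN. Qed.
Lemma sfB x y : k x -> k y -> k (x - y).
Proof. by move=> kx ky; apply: sfD => //; apply: sfN. Qed.
Lemma sfM x y : k x -> k y -> k (x * y).
Proof. by move=> /subfieldP kx /subfieldP ky; apply/subfieldP/rpredM. Qed.
Lemma sfV x : k x -> k x^-1.
Proof. by move=> /subfieldP kx; apply/subfieldP; rewrite rpredV. Qed.
Lemma sfdiv x y : k x -> k y -> k (x / y).
Proof. by move=> kx ky; apply: sfM => //; apply: sfV. Qed.
Lemma sfX x n : k x -> k (x ^+ n).
Proof. by move=> /subfieldP kx; apply/subfieldP/rpredX. Qed.
Lemma sfnat n : k n%:R.
Proof. exact/subfieldP/rpred_nat. Qed.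
Lemma sfint (n : int) : k n%:~R.
Proof. exact/subfieldP/rpred_int. Qed.
Lemma sfrat x : x \in Crat -> k x.
Proof. by move=> /(rpred_Crat (subfield_pred kF)) /subfieldP. Qed.
Lemma sfratr (x : rat) : k (ratr x).
Proof. exact/sfrat/Crat_rat. Qed.
Lemma sfsum I (r : seq I) (P : pred I) (F : I -> algC) :
  (forall i, P i -> k (F i)) -> k (\sum_(i <- r | P i) F i).
Proof. by move=> kFi; apply/subfieldP/rpred_sum => i /kFi /subfieldP. Qed.
Lemma sfprod I (r : seq I) (P : pred I) (F : I -> algC) :
  (forall i, P i -> k (F i)) -> k (\prod_(i <- r | P i) F i).
Proof. by move=> kFi; apply/subfieldP/rpred_prod => i /kFi /subfieldP. Qed.
Lemma sfdet n (A : 'M[algC]_n) : (forall i j, k (A i j)) -> k (\det A).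
Proof.
move=> kA; apply: sfsum => s _; apply: sfM; last exact: sfprod.
by apply: sfX; apply: sfN; apply: sf1.
Qed.

Definition integers_pred : {pred algC} := mem (integers k).

Lemma integersP x : reflect (integers k x) (x \in integers_pred).
Proof. exact: asboolP. Qed.

Fact integers_subring : subring_closed integers_pred.
Proof.
split=> [|x y|x y]; first by apply/integersP; split; [exact: sf1 | exact: rpred1].
  move=> /integersP[kx Ax] /integersP[ky Ay]; apply/integersP.
  by split; [exact: sfB | exact: rpredB].
move=> /integersP[kx Ax] /integersP[ky Ay]; apply/integersP.
by split; [exact: sfM | exact: rpredM].
Qed.

HB.instance Definition _ :=
  GRing.isSubringClosed.Build algC integers_pred integers_subring.

Lemma oi0 : integers k 0. Proof. exact/integersP/rpred0. Qed.
Lemma oi1 : integers k 1. Proof. exact/integersP/rpred1. Qed.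
Lemma oiD x y : integers k x -> integers k y -> integers k (x + y).
Proof. by move=> /integersP kx /integersP ky; apply/integersP/rpredD. Qed.
Lemma oiN x : integers k x -> integers k (- x).
Proof. by move=> /integersP kx; apply/integersP; rewrite rpredN. Qed.
Lemma oiB x y : integers k x -> integers k y -> integers k (x - y).
Proof. by move=> kx ky; apply: oiD => //; apply: oiN. Qed.
Lemma oiM x y : integers k x -> integers k y -> integers k (x * y).
Proof. by move=> /integersP kx /integersP ky; apply/integersP/rpredM. Qed.
Lemma oiX x n : integers k x -> integers k (x ^+ n).
Proof. by move=> /integersP kx; apply/integersP/rpredX. Qed.
Lemma oinat n : integers k n%:R.
Proof. exact/integersP/rpred_nat. Qed.
Lemma oiint (n : int) : integers k n%:~R.
Proof. exact/integersP/rpred_int. Qed.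
Lemma oisum I (r : seq I) (P : pred I) (F : I -> algC) :
  (forall i, P i -> integers k (F i)) -> integers k (\sum_(i <- r | P i) F i).
Proof. by move=> kFi; apply/integersP/rpred_sum => i /kFi /integersP. Qed.
Lemma oiprod I (r : seq I) (P : pred I) (F : I -> algC) :
  (forall i, P i -> integers k (F i)) -> integers k (\prod_(i <- r | P i) F i).
Proof. by move=> kFi; apply/integersP/rpred_prod => i /kFi /integersP. Qed.

(** Packing [k] as a field type gives access to kernels and ranks of matrices with entries in
    [k]. *)
Record subfield := Subfield { subfield_val : algC; _ : subfield_val \in subfield_pred kF }.
HB.instance Definition _ := [isSub for subfield_val].
HB.instance Definition _ := [Choice of subfield by <:].
HB.instance Definition _ := [SubChoice_isSubIntegralDomain of subfield by <:].
HB.instance Definition _ := [SubIntegralDomain_isSubField of subfield by <:].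

Lemma subfield_valP (x : subfield) : k (val x).
Proof. exact/subfieldP/valP. Qed.

Lemma subfield_ker m n (A : 'I_m -> 'I_n -> algC) :
  (n < m)%N -> (forall i j, k (A i j)) ->
  exists c : 'I_m -> algC,
    [/\ forall i, k (c i), exists i, c i != 0
      & forall j, \sum_i c i * A i j = 0].
Proof.
move=> nm kA.
pose B : 'M[subfield]_(m, n) := \matrix_(i, j) insubd 0 (A i j).
have BA i j : val (B i j) = A i j.
  by rewrite mxE val_insubd; move/subfieldP: (kA i j) => ->.
have : kermx B != 0.
  by rewrite kermx_eq0 /row_free neq_ltn (leq_ltn_trans (rank_leq_col _)).
case/rowV0Pn=> v /sub_kermxP vB v0.
exists (fun i => val (v 0 i)); split=> [i||j]; first exact: subfield_valP.
  by case/rV0Pn: v0 => i vi; exists i; rewrite -(inj_eq val_inj) in vi.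
have vBj : \sum_i v 0 i * B i j = 0.
  by have := congr1 (fun M : 'rV[subfield]_n => M 0 j) vB; rewrite !mxE.
have := congr1 val vBj; rewrite rmorph_sum /= => vBj'.
rewrite -[RHS]vBj'; apply: eq_bigr => i _.
by rewrite -BA.
Qed.

Lemma subfield_dep m n (x : 'I_m -> algC) (e : 'I_n -> algC) :
  (n < m)%N ->
  (forall i, exists2 c : 'I_n -> algC,
     (forall j, k (c j)) & x i = \sum_j c j * e j) ->
  exists c : 'I_m -> algC,
    [/\ forall i, k (c i), exists i, c i != 0 & \sum_i c i * x i = 0].
Proof.
move=> nm xe.
have /choice[A kA] : forall i, exists c : 'I_n -> algC,
    (forall j, k (c j)) /\ x i = \sum_j c j * e j.
  by move=> i; have [c kc xc] := xe i; exists c.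
have [c [kc c0 cA]] := subfield_ker nm (fun i => (kA i).1).
exists c; split=> //.
transitivity (\sum_j (\sum_i c i * A i j) * e j); last first.
  by rewrite big1 // => j _; rewrite cA mul0r.
under [RHS]eq_bigr do rewrite mulr_suml.
rewrite exchange_big; apply: eq_bigr => i _.
by rewrite (kA i).2 mulr_sumr; apply: eq_bigr => j _; rewrite mulrA.
Qed.

End Subfield.

Definition spans (k K : set algC) n (e : 'I_n -> algC) : Prop :=
  (forall i, K (e i)) /\
  (forall x, K x -> exists2 c : 'I_n -> algC,
     (forall i, k (c i)) & x = \sum_i c i * e i).

(** A spanning family suffices: [n] is only an upper bound for the degree, which makes towers and
    adjunctions immediate. *)
Definition is_nf n (F : set algC) : Prop :=
  is_subfield F /\ exists e : 'I_n -> algC, spans [set` Crat] F e.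

Lemma is_nf_number_field n F : is_number_field n F -> is_nf n F.
Proof.
move=> [FF [e [Fe eP]]]; split=> //; exists e; split=> // x /eP[c [[kc ->] _]].
by exists c.
Qed.

Lemma is_subfield_Crat : is_subfield [set` Crat].
Proof.
by have [h1 h2 h3] := Crat_divring_closed; split=> [|x y|x y]; rewrite ?mem_setE;
  [exact: h1 | exact: h2 | exact: h3].
Qed.

(* Clearing denominators and dividing by the greatest power of [p]. *)
Lemma int_relation n F p (x : 'I_n.+1 -> algC) :
  is_nf n F -> prime p -> (forall i, F (x i)) ->
  exists c : 'I_n.+1 -> int,
    \sum_i (c i)%:~R * x i = 0 /\ exists i, ~~ (p %| c i)%Z.
Proof.
move=> [FF [e [Fe eP]]] pp Fx.
have [c [kc [i0 ci0] cx]] := subfield_dep is_subfield_Crat (ltnSn n) (fun i => eP _ (Fx i)).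
have /choice[q qc] : forall i, exists q : rat, c i = ratr q.
  by move=> i; apply/CratP/kc.
pose d := \prod_i denq (q i).
have d0 : d != 0 by apply/prodf_neq0 => i _; rewrite denq_eq0.
pose a i := numq (q i) * \prod_(j | j != i) denq (q j).
have aE i : (a i)%:~R = d%:~R * c i :> algC.
  have -> : d = denq (q i) * \prod_(j | j != i) denq (q j) by rewrite /d (bigD1 i).
  rewrite !intrM qc; have := divq_num_den (q i).
  move=> /(congr1 (ratr : rat -> algC)); rewrite fmorph_div /= !ratr_int => <-.
  have : (denq (q i))%:~R != 0 :> algC by rewrite intr_eq0 denq_eq0.
  by move=> h; field.
have a0 : exists i, a i != 0.
  by exists i0; rewrite -(intr_eq0 algC) aE mulf_neq0 // intr_eq0.
have ax : \sum_i (a i)%:~R * x i = 0.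
  under eq_bigr do rewrite aE -mulrA.
  by rewrite -mulr_sumr cx mulr0.
clear -a0 ax pp.
have [N] : exists N, (\sum_i `|a i| <= N)%N by exists (\sum_i `|a i|)%N.
elim: N a a0 ax => [|N IH] a [i ai] ax aN.
  by move: aN; rewrite (bigD1 i) //= leqn0 addn_eq0 absz_eq0 (negPf ai).
have [/existsP[j pj]|] := boolP [exists i, ~~ (p %| a i)%Z].
  by exists a; split=> //; exists j.
rewrite negb_exists => /forallP pa.
pose b j := (a j %/ p)%Z.
have bE j : a j = b j * p%:Z by rewrite divzK //; have:= pa j; rewrite negbK.
have p1 : (1 < p)%N := prime_gt1 pp.
apply: (IH b).
- by exists i; apply: contra_neq ai => bi; rewrite bE bi mul0r.
- have: p%:R * (\sum_i (b i)%:~R * x i) = 0.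
    rewrite mulr_sumr -[RHS]ax; apply: eq_bigr => j _.
    by rewrite bE intrM mulrA [_%:~R * _%:~R]mulrC.
  by move/eqP; rewrite mulf_eq0 pnatr_eq0 eqn0Ngt prime_gt0 //= => /eqP.
- rewrite -ltnS; apply: leq_trans aN.
  rewrite (bigD1 i) //= [X in (_ < X)%N](bigD1 i) //=.
  have bj j : (`|b j| <= `|a j|)%N.
    by rewrite bE abszM leq_pmulr // absz_nat prime_gt0.
  rewrite -addSn leq_add ?leq_sum // [a i]bE abszM absz_nat.
  by rewrite ltn_Pmulr // absz_gt0; apply: contra_neq ai => bi; rewrite bE bi mul0r.
Qed.

(** These conditions force [d] to be the degree of [theta] over [k]: distinct conjugates make the
    first [d] powers of [theta] independent, and the last condition makes them span. The embeddings
    act on all of [algC], so that they can be iterated. *)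
Definition has_conjugates (k : set algC) d (theta : algC)
    (nu : 'I_d -> {rmorphism algC -> algC}) : Prop :=
  [/\ (0 < d)%N, injective (fun j => nu j theta),
      (forall j x, k x -> nu j x = x)
    & forall x, adjoin k theta x -> exists2 c : 'I_d -> algC,
        (forall i, k (c i)) & x = \sum_i c i * theta ^+ i].

(* Inside the splitting field [L] of the minimal polynomial of a primitive
   element [z], the conjugations come from the elements of the Galois group of
   [L] over [k], extended to [algC]. *)
Lemma exists_conjugates n k theta : is_nf n k ->
  exists d (nu : 'I_d -> {rmorphism algC -> algC}), has_conjugates k theta nu.
Proof.
move=> [kF [e [ke eP]]].
have [z _ [ps Dps]] := algC_PET (theta :: [seq e i | i <- enum 'I_n]).
have [q [Dq qmon] qz] := minCpolyP z.
have [r Dr] := closed_field_poly_normal (minCpoly z).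
have {}Dr : minCpoly z = \prod_(a <- r) ('X - a%:P).
  by rewrite Dr (monicP _) ?scale1r // Dq monic_map.
have [Qs [QsC [r1 Dr1 gen]]] := num_field_exists r.
pose p1 := \prod_(a <- r1) ('X - a%:P).
have Dp1 : p1 = map_poly (in_alg Qs) q.
  apply: (map_poly_inj QsC); rewrite -map_poly_comp.
  rewrite rmorph_prod /=.
  under eq_bigr do rewrite map_polyXsubC.
  rewrite -(big_map QsC xpredT (fun a => 'X - a%:P)) Dr1 -Dr Dq.
  by apply: eq_map_poly => a /=; rewrite alg_num_field fmorph_rat.
have ax : SplittingField.axiom Qs.
  exists p1; last by exists r1; rewrite ?eqpxx.
  by rewrite Dp1; apply/polyOver1P; exists q.
pose L : splittingFieldType rat :=
  HB.pack Qs (FieldExt_isSplittingField.Build rat Qs ax).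
pose QC : {rmorphism L -> algC} := QsC.
have [z1 Dz1] : exists z1 : L, QC z1 = z.
  have : z \in r.
    rewrite -root_prod_XsubC -Dr Dq; apply/(etrans (qz q)).
    exact: dvdpp.
  by rewrite -Dr1 => /mapP[z1 _ ->]; exists z1.
have sub x : x \in theta :: [seq e i | i <- enum 'I_n] -> exists y : L, x = QC y.
  rewrite Dps => /mapP[p _ ->]; exists (map_poly (in_alg L) p).[z1].
  rewrite -Dz1 -horner_map /= -map_poly_comp; congr (_.[_]).
  by apply: eq_map_poly => a /=; rewrite alg_num_field fmorph_rat.
have [t Dt] := sub theta (mem_head _ _).
have /choice[e1 De1] : forall i, exists y : L, e i = QC y.
  move=> i; apply: sub; rewrite in_cons; apply/orP; right.
  by apply/mapP; exists i; rewrite ?mem_enum.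
pose X := [seq e1 i | i <- enum 'I_n].
have XP y : (y \in <<X>>%VS) = `[< k (QC y) >].
  apply/idP/asboolP.
    move=> /coord_span ->; rewrite rmorph_sum /=; apply: sfsum => // i _.
    rewrite rmorphZ_num; apply: sfM => //; first exact: sfratr.
    have /mapP[j _ ->] : X`_i \in X.
      by apply: mem_nth; case: (i) => a; rewrite ?size_tuple.
    by rewrite -De1; apply: ke.
  move=> /eP[c kc Dy].
  have /choice[a Da] : forall i, exists a : rat, c i = ratr a.
    by move=> i; apply/CratP/kc.
  have -> : y = \sum_i a i *: e1 i.
    apply: (fmorph_inj QC); rewrite Dy rmorph_sum /=; apply: eq_bigr => i _.
    by rewrite rmorphZ_num De1 Da.
  apply: memv_suml => i _; apply/memvZ/memv_span.
  by apply/mapP; exists i; rewrite ?mem_enum.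
have Xasp : is_aspace <<X>>%VS.
  rewrite /is_aspace has_algid1 /=; last first.
    by rewrite XP; apply/asboolP; rewrite rmorph1; apply: sf1.
  apply/prodvP => u v; rewrite !XP => /asboolP ku /asboolP kv.
  by apply/asboolP; rewrite rmorphM; apply: sfM.
pose K : {subfield L} := ASpace Xasp.
have KP y : (y \in K) = `[< k (QC y) >] by exact: XP.
pose d := adjoin_degree K t.
have [s /eqP Ds] := splitting_field_normal K t.
have sz_s : size s = d.
  by apply: succn_inj; rewrite -(size_prod_XsubC s id) -Ds size_minPoly.
have Us : uniq s.
  rewrite -separable_prod_XsubC -Ds.
  have := @pcharf0_separable rat L K _ t; rewrite /separable_element; apply.
  move=> x; rewrite (pchar_lalg L); exact: pchar_num.
have /choice[nu nuP] : forall j : 'I_d, exists nu : {rmorphism algC -> algC},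
    nu theta = QC s`_j /\ forall x, k x -> nu x = x.
  move=> j.
  have rt : root (minPoly K t) s`_j.
    by rewrite Ds root_prod_XsubC mem_nth // sz_s.
  have [g gK gt] := normalField_root_minPoly (subvf K) (normalFieldf K) (memvf t) rt.
  have [nu Dnu] := extend_algC_subfield_aut QC (gal_repr g : 'AEnd(L)).
  exists nu; split; first by rewrite Dt -Dnu /= gt.
  move=> x kx; have [c kc ->] := eP _ kx.
  rewrite rmorph_sum; apply: eq_bigr => i _; rewrite rmorphM /=.
  rewrite (aut_Crat nu) ?kc // De1 -Dnu /= (fixed_gal (subvf K) gK) //.
  by rewrite KP; apply/asboolP; rewrite -De1; apply: ke.
exists d, nu; split.
- by [].
- move=> i j; rewrite (nuP i).1 (nuP j).1 => /fmorph_inj /eqP.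
  by rewrite nth_uniq ?sz_s // => /eqP /val_inj.
- by move=> j x /(nuP j).2.
- pose S : set algC := [set x | exists2 y : L, y \in <<K; t>>%VS & x = QC y].
  move=> x /(_ S).
  have SF : is_subfield S.
    split=> [|u v|u v]; rewrite ?mem_setE.
    - by rewrite inE; exists 1; rewrite ?rmorph1 ?rpred1.
    - rewrite !inE => -[a Ka ->] [b Kb ->]; exists (a - b); last by rewrite rmorphB.
      by rewrite rpredB.
    - rewrite !inE => -[a Ka ->] [b Kb ->]; exists (a / b); last by rewrite fmorph_div.
      by rewrite rpred_div.
  case.
    split=> // y [ky|->]; last by exists t; rewrite ?memv_adjoin.
    have [c kc Dy] := eP _ ky.
    have /choice[a Da] : forall i, exists a : rat, c i = ratr a.
      by move=> i; apply/CratP/kc.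
    have Dy' : y = QC (\sum_i a i *: e1 i).
      rewrite Dy rmorph_sum /=; apply: eq_bigr => i _.
      by rewrite rmorphZ_num De1 Da.
    exists (\sum_i a i *: e1 i) => //; apply: (subvP (subv_adjoin K t)).
    by rewrite KP; apply/asboolP; rewrite -Dy'.
  move=> y /Fadjoin_polyP[p Kp ->] ->.
  pose f := Fadjoin_poly K t p.[t].
  exists (fun i : 'I_d => QC f`_i).
    move=> i; have /polyOverP/(_ i) := Fadjoin_polyOver K t p.[t].
    by rewrite KP => /asboolP.
  have pt : p.[t] \in <<K; t>>%VS by apply/Fadjoin_polyP; exists p.
  rewrite -(Fadjoin_poly_eq pt) -/f (horner_coef_wide _ (size_Fadjoin_poly K t _)).
  rewrite rmorph_sum; apply: eq_bigr => i _.
  by rewrite rmorphM rmorphXn /= Dt.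
Qed.

Lemma ord_pigeonhole (T : finType) m (f : 'I_m -> T) :
  (#|T| < m)%N -> exists i j : 'I_m, (i < j)%N /\ f i = f j.
Proof.
move=> Tm; have /injectivePn[i [j ij fij]] : ~~ injectiveb f.
  by apply/negP => /injectiveP/leq_card; rewrite card_ord leqNgt Tm.
have [ltij|ltji|/val_inj eqij] := ltngtP i j; first by exists i, j.
  by exists j, i.
by rewrite eqij eqxx in ij.
Qed.

Lemma is_subfield_adjoin k z : is_subfield (adjoin k z).
Proof.
split=> [|u v|u v]; rewrite ?mem_setE ?inE.
- by move=> S [SF _]; apply: sf1.
- by move=> ku kv S [SF Sz]; apply: sfB => //; [apply: ku | apply: kv].
- by move=> ku kv S [SF Sz]; apply: sfdiv => //; [apply: ku | apply: kv].
Qed.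

Lemma sub_adjoin k z : k `<=` adjoin k z.
Proof. by move=> x kx S [_ kS]; apply: kS; left. Qed.

Lemma adjoin_gen k z : adjoin k z z.
Proof. by move=> S [_ kS]; apply: kS; right. Qed.

Lemma adjoin_min k z (S : set algC) :
  is_subfield S -> k `<=` S -> S z -> adjoin k z `<=` S.
Proof. by move=> SF kS Sz; apply: smallest_sub => // x [/kS|->]. Qed.

(** If q is the monic minimal polynomial over the rationals, of degree n, and N a common denominator
    of its coefficients, then N x is a root of the polynomial with coefficients q_i N^(n - i), which
    is monic and integral. *)
Lemma Aint_multiple (x : algC) : exists2 N : nat, (0 < N)%N & N%:R * x \in Aint.
Proof.
have [q [Dq qmon] _] := minCpolyP x.
pose N := \prod_(i < size q) `|denq q`_i|%N.
have N0 : (0 < N)%N by rewrite prodn_gt0 // => i; rewrite absz_gt0 denq_eq0.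
have qint i : exists a : int, N%:R * q`_i = a%:~R.
  have [szi|szi] := ltnP i (size q); last by exists 0; rewrite nth_default ?mulr0.
  exists (numq q`_i * (\prod_(j < size q | j != Ordinal szi) `|denq q`_j|)%N).
  rewrite /N (bigD1 (Ordinal szi)) //= natrM intrM numqE.
  by rewrite !pmulrn gez0_abs ?denq_ge0 //; ring.
exists N => //.
have [n szq] : exists n, size q = n.+1.
  by exists (size q).-1; rewrite prednK // lt0n size_poly_eq0 monic_neq0.
pose p : {poly algC} := \poly_(i < n.+1) (ratr q`_i * N%:R ^+ (n - i)).
have pn : p`_n = 1.
  rewrite coef_poly ltnSn subnn mulr1; move/monicP: qmon.
  by rewrite /lead_coef szq => ->; rewrite rmorph1.
have szp : size p = n.+1.
  by apply: size_poly_eq; rewrite subnn mulr1; move/monicP: qmon;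
     rewrite /lead_coef szq => ->; rewrite rmorph1 oner_eq0.
apply: (@root_monic_Aint p).
- rewrite /root horner_poly.
  have : root (minCpoly x) x by apply: root_minCpoly.
  rewrite Dq /root horner_coef size_map_poly szq => /eqP qx.
  apply/eqP; transitivity (N%:R ^+ n * \sum_(i < n.+1) (map_poly ratr q)`_i * x ^+ i);
    last by rewrite qx mulr0.
  rewrite mulr_sumr; apply: eq_bigr => i _; rewrite coef_map exprMn /=.
  have -> : N%:R ^+ n = N%:R ^+ (n - i) * N%:R ^+ i :> algC.
    by rewrite -exprD subnK // -ltnS.
  by ring.
- by apply/monicP; rewrite /lead_coef szp pn.
- apply/polyOverP => i; rewrite coef_poly; case: ifP => [|_]; last exact: rpred0.
  rewrite ltnS leq_eqVlt => /orP[/eqP ->|lt_in].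
    by rewrite -/p in pn *; move: pn; rewrite coef_poly ltnSn => ->; apply: rpred1.
  have [a aE] := qint i.
  rewrite -(subnK (_ : 1 <= n - i)%N) ?subn_gt0 // exprD expr1 mulrCA.
  have -> : ratr q`_i * N%:R = a%:~R :> algC.
    by rewrite -(ratr_int _ a) -aE rmorphM /= ratr_nat mulrC.
  by rewrite rpredM ?rpredX ?rpred_nat ?rpred_int.
Qed.

(** The constant coefficient of the minimal polynomial of [y] is a multiple of [y]. It is not 0,
    since otherwise a factor X could be removed, leaving a smaller polynomial with root [y]. *)
Lemma Aint_dvd_int (y : algC) : y \in Aint -> y != 0 ->
  exists2 N : nat, (0 < N)%N & exists2 z, z \in Aint & y * z = N%:R.
Proof.
move=> Ay y0; have [q [Dq qmon] qP] := minCpolyP y.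
have pint i : (minCpoly y)`_i \is a Num.int by apply/polyOverP.
pose p := minCpoly y.
have ry : root p y := root_minCpoly y.
have p00 : p`_0 != 0.
  apply/eqP => p00; have : root q 0.
    rewrite /root horner_coef0 -(fmorph_eq0 (ratr : rat -> algC)) -coef_map.
    by rewrite -[map_poly _ _]Dq -/p p00.
  case/factor_theorem => r; rewrite subr0 => qr.
  have : root (map_poly ratr r) y.
    move: ry; rewrite /p Dq qr rmorphM /= map_polyX rootM.
    by rewrite /root hornerX (negPf y0) orbF.
  have r0 : r != 0.
    by apply/eqP => r0; move: (monic_neq0 qmon); rewrite qr r0 mul0r eqxx.
  rewrite qP => /dvdp_leq; rewrite qr size_mulX // => /(_ r0).
  by rewrite ltnn.
have [a Da] : exists a : int, p`_0 = a%:~R by apply/intrP/pint.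
exists `|a|%N.
  by rewrite absz_gt0 -(intr_eq0 algC) -Da.
have : exists2 z, z \in Aint & y * z = a%:~R.
  exists (- \sum_(i < (size p).-1) p`_i.+1 * y ^+ i).
    by rewrite rpredN rpred_sum // => i _; rewrite rpredM ?rpredX // Aint_Cint.
  have [n szp] : exists n, size p = n.+1.
    by exists (size p).-1; rewrite prednK // lt0n size_poly_eq0 -lead_coef_eq0;
       apply: contra_neq p00 => /eqP; rewrite lead_coef_eq0 => /eqP ->; rewrite coef0.
  move: ry; rewrite /root horner_coef szp /= big_ord_recl /= expr0 mulr1 -Da.
  rewrite addr_eq0 => /eqP ->; rewrite mulrN; congr (- _).
  by rewrite mulr_sumr; apply: eq_bigr => i _; rewrite exprS; ring.
case=> z Az yz; case: a Da yz => a _ yz; first by exists z.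
by exists (- z); rewrite ?rpredN // mulrN yz NegzE rmorphN opprK.
Qed.

(** * Conjugates and norms *)

Section Conjugates.
Variables (k : set algC) (kF : is_subfield k) (d : nat) (theta : algC).
Variables (nu : 'I_d -> {rmorphism algC -> algC}).
Hypothesis conj : has_conjugates k theta nu.

Definition conj_mx : 'M[algC]_d := \matrix_(j, i) nu j theta ^+ i.

Lemma det_conj_mx : \det conj_mx != 0.
Proof.
have [_ inj _ _] := conj.
rewrite -det_tr (_ : conj_mx^T = Vandermonde d (\row_j nu j theta)); last first.
  by apply/matrixP => i j; rewrite !mxE.
rewrite det_Vandermonde; apply/prodf_neq0 => i _; apply/prodf_neq0 => j ij.
by rewrite !mxE subr_eq0; apply: contraTneq ij => /inj ->; rewrite ltnn.
Qed.

Lemma conj_sum (c : 'I_d -> algC) j : (forall i, k (c i)) ->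
  nu j (\sum_i c i * theta ^+ i) = \sum_i c i * nu j theta ^+ i.
Proof.
have [_ _ fix_nu _] := conj.
move=> kc; rewrite rmorph_sum; apply: eq_bigr => i _.
by rewrite rmorphM rmorphXn /= fix_nu.
Qed.

(** Cramer's rule for the linear system formed by the conjugates; the Vandermonde determinant is
    thus a common denominator of the coordinates of integers. *)
Lemma conj_coord (c : 'I_d -> algC) i : (forall i, k (c i)) ->
  \det conj_mx * c i =
  \sum_j \adj conj_mx i j * nu j (\sum_i c i * theta ^+ i).
Proof.
move=> kc; transitivity ((\adj conj_mx *m (conj_mx *m \col_j c j)) i 0); last first.
  rewrite mxE; apply: eq_bigr => j _; congr (_ * _).
  by rewrite conj_sum // mxE; apply: eq_bigr => h _; rewrite !mxE mulrC.
by rewrite mulmxA mul_adj_mx mul_scalar_mx !mxE.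
Qed.

Lemma conj_indep (c : 'I_d -> algC) : (forall i, k (c i)) ->
  \sum_i c i * theta ^+ i = 0 -> forall i, c i = 0.
Proof.
move=> kc c0 i; have := conj_coord i kc; rewrite c0 big1 => [|j _]; last first.
  by rewrite rmorph0 mulr0.
by move/eqP; rewrite mulf_eq0 (negPf det_conj_mx) => /eqP.
Qed.

Hypothesis Atheta : theta \in Aint.

Lemma Aint_conj_mx i j : conj_mx i j \in Aint.
Proof. by rewrite mxE rpredX // Aint_aut. Qed.

Lemma Aint_det n (A : 'M[algC]_n) : (forall i j, A i j \in Aint) -> \det A \in Aint.
Proof.
move=> AA; apply: rpred_sum => s _.
by rewrite rpredM ?rpred_prod // rpredX ?rpredN ?rpred1.
Qed.

Lemma Aint_adj_conj_mx i j : \adj conj_mx i j \in Aint.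
Proof.
rewrite mxE rpredM ?rpredX ?rpredN ?rpred1 //.
by apply: Aint_det => a b; rewrite !mxE rpredX // Aint_aut.
Qed.

Lemma Aint_conj_coord (c : 'I_d -> algC) i : (forall i, k (c i)) ->
  \sum_i c i * theta ^+ i \in Aint -> \det conj_mx * c i \in Aint.
Proof.
move=> kc Ac; rewrite conj_coord // rpred_sum // => j _.
by rewrite rpredM ?Aint_adj_conj_mx // Aint_aut.
Qed.

End Conjugates.

Definition nf_gen (F : set algC) d (theta : algC)
    (nu : 'I_d -> {rmorphism algC -> algC}) : Prop :=
  [/\ is_subfield F, F theta, theta \in Aint, has_conjugates [set` Crat] theta nu
    & F `<=` adjoin [set` Crat] theta].

Lemma is_nf_Crat : is_nf 1 [set` Crat].
Proof.
split; first exact: is_subfield_Crat.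
exists (fun=> 1); split=> [_|x Qx]; first exact: rpred1.
by exists (fun=> x) => //; rewrite big_ord1 mulr1.
Qed.

Lemma exists_nf_gen n F : is_nf n F ->
  exists d theta (nu : 'I_d -> {rmorphism algC -> algC}),
    (d <= n)%N /\ nf_gen F theta nu.
Proof.
move=> [FF [e [Fe eP]]].
have [z [a Da] [ps Dps]] := algC_PET [seq e i | i <- enum 'I_n].
have Fz : F z.
  rewrite Da; apply: (sfsum FF) => i _; rewrite -mulr_natr.
  apply: (sfM FF); last exact: (sfnat FF).
  by have /mapP[j _ ->] := mem_nth 0 (ltn_ord i); apply: Fe.
have [N N0 ANz] := Aint_multiple z.
pose theta := N%:R * z.
have [d [nu conj]] := exists_conjugates theta is_nf_Crat.
exists d, theta, nu; split; last first.
  split=> //; first by apply: (sfM FF) => //; exact: (sfnat FF).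
  move=> x /eP[c kc ->]; pose S := adjoin [set` Crat] theta.
  have SF : is_subfield S := is_subfield_adjoin _ _.
  have Sz : S z.
    have zE : z = theta / N%:R.
      by rewrite /theta mulrC mulKf // pnatr_eq0 -lt0n.
    rewrite zE.
    by apply: (sfdiv SF); [exact: adjoin_gen | exact: (sfnat SF)].
  apply: (sfsum SF) => i _; apply: (sfM SF); first exact: sub_adjoin.
  have : e i \in [seq e i | i <- enum 'I_n] by apply/mapP; exists i; rewrite ?mem_enum.
  rewrite Dps => /mapP[p _ ->]; rewrite horner_coef; apply: (sfsum SF) => j _.
  by apply: (sfM SF); [rewrite coef_map; exact: (sfratr SF) | exact: (sfX SF)].
rewrite leqNgt; apply/negP => nd.
have [c [kc [i ci] c0]] : exists c : 'I_d -> algC,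
    [/\ forall i, [set` Crat] (c i), exists i, c i != 0 & \sum_i c i * theta ^+ i = 0].
  apply: (subfield_dep is_subfield_Crat nd (e := e)) => i; apply: eP.
  by apply: (sfX FF); apply: (sfM FF) => //; exact: (sfnat FF).
by rewrite (conj_indep conj kc c0) eqxx in ci.
Qed.

Section NumberField.
Variables (F : set algC) (d : nat) (theta : algC).
Variables (nu : 'I_d -> {rmorphism algC -> algC}).
Hypothesis G : nf_gen F theta nu.

Let FF : is_subfield F. Proof. by case: G. Qed.
Let conj : has_conjugates [set` Crat] theta nu. Proof. by case: G. Qed.
Let d_gt0 : (0 < d)%N. Proof. by case: conj. Qed.
Let Atheta : theta \in Aint. Proof. by case: G. Qed.
Let Ftheta : F theta. Proof. by case: G. Qed.

Lemma nf_coord x : F x -> exists c : 'I_d -> rat, x = \sum_i ratr (c i) * theta ^+ i.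
Proof.
have [_ _ _ _ sub] := G; have [_ _ _ span] := conj.
move=> /sub /span[c kc ->].
have /choice[a Da] : forall i, exists a : rat, c i = ratr a.
  by move=> i; apply/CratP/kc.
by exists a; apply: eq_bigr => i _; rewrite Da.
Qed.

Lemma nf_conj_sum (c : 'I_d -> rat) j :
  nu j (\sum_i ratr (c i) * theta ^+ i) = \sum_i ratr (c i) * nu j theta ^+ i.
Proof. by apply: (conj_sum conj) => i; apply: Crat_rat. Qed.

(** The number N is a multiple of the Vandermonde determinant by an algebraic integer, so N times a
    coordinate of an integer is both rational and integral. *)
Lemma integers_coord : exists2 N : nat, (0 < N)%N &
  forall x, integers F x -> exists c : 'I_d -> int,
    N%:R * x = \sum_i (c i)%:~R * theta ^+ i.
Proof.
have AV := Aint_det (Aint_conj_mx nu Atheta).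
have [N N0 [z Az detz]] := Aint_dvd_int AV (det_conj_mx conj).
exists N => // x [Fx Ax]; have [q Dx] := nf_coord Fx.
have kq i : [set` Crat] (ratr (q i) : algC) by apply: Crat_rat.
have /choice[c Dc] : forall i, exists c : int, N%:R * ratr (q i) = c%:~R :> algC.
  move=> i; apply/intrP/Cint_rat_Aint.
    by rewrite rpredM ?rpred_nat ?Crat_rat.
  rewrite -detz mulrAC rpredM //; apply: (Aint_conj_coord conj Atheta i kq).
  by rewrite -Dx.
exists c; rewrite Dx mulr_sumr; apply: eq_bigr => i _.
by rewrite mulrA Dc.
Qed.

(** Finiteness of the integers modulo [n], in the form of a pigeonhole principle. Coordinates are
    compared modulo n N and not n, since they are those of N times the element. *)
Lemma integers_mod_finite n : (0 < n)%N -> exists M : nat,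
  forall f : 'I_M.+1 -> algC, (forall i, integers F (f i)) ->
    exists i j : 'I_M.+1, (i < j)%N /\
      exists2 w, integers F w & f i - f j = n%:R * w.
Proof.
move=> n0; have [N N0 coord] := integers_coord.
have nN : (0 < n * N)%N by rewrite muln_gt0 n0.
exists #|{ffun 'I_d -> 'I_(n * N).-1.+1}|.
move=> f Of; have /choice[c Dc] := fun i => coord _ (Of i).
have modP (a : int) : exists b : 'I_(n * N).-1.+1, (a %% (n * N)%:Z)%Z = b.
  have := modz_ge0 a (_ : (n * N)%:Z != 0); rewrite eqz_nat -lt0n => /(_ nN).
  have := ltz_pmod a (_ : 0 < (n * N)%:Z); rewrite ltz_nat => /(_ nN).
  case: (a %% _)%Z => // b; rewrite ltz_nat => bn _.
  by rewrite -(prednK nN) in bn; exists (Ordinal bn).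
have /choice[b Db] := modP.
have [i [j [ij fij]]] :=
  ord_pigeonhole (fun i : 'I_(#|{ffun 'I_d -> 'I_(n * N).-1.+1}|.+1) =>
    [ffun h => b (c i h)]) (ltnSn _).
exists i, j; split=> //.
have cij h : exists q : int, c i h - c j h = (n * N)%:Z * q.
  have := congr1 (fun g : {ffun 'I_d -> 'I_(n * N).-1.+1} => (g h : nat)%:Z) fij; rewrite !ffunE -!Db.
  move/eqP; rewrite eqz_mod_dvd => /dvdzP[q ->].
  by exists q; rewrite mulrC.
have {cij} /choice[q Dq] := cij.
exists (\sum_h (q h)%:~R * theta ^+ h).
  apply: (oisum FF) => h _; apply: (oiM FF); first exact: oiint.
  by apply: (oiX FF).
have N0' : N%:R != 0 :> algC by rewrite pnatr_eq0 -lt0n.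
apply: (mulfI N0'); rewrite mulrBr !Dc -sumrB !mulr_sumr.
apply: eq_bigr => h _; rewrite -mulrBl -rmorphB Dq PoszM !rmorphM /= -!pmulrn.
by ring.
Qed.

(** Bounded conjugates bound the integer coordinates, again by Cramer's rule. *)
Lemma bounded_finite (B : nat) : exists s : seq algC,
  forall x, integers F x -> (forall j, `|nu j x| <= B%:R) -> x \in s.
Proof.
have [N N0 coord] := integers_coord.
have V0 := det_conj_mx conj.
pose w i j := (\det (conj_mx theta nu))^-1 * \adj (conj_mx theta nu) i j * N%:R.
have [C HC] : exists C : nat, forall i, \sum_j `|w i j| * B%:R <= C%:R.
  exists (Num.bound (\sum_i \sum_j `|w i j| * B%:R)).
  move=> i; apply/ltW/(le_lt_trans _ (archi_boundP _)).
    rewrite [leRHS](bigD1 i) //= lerDl sumr_ge0 // => h _.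
    by rewrite sumr_ge0 // => j _; rewrite mulr_ge0.
  by rewrite sumr_ge0 // => h _; rewrite sumr_ge0 // => j _; rewrite mulr_ge0.
(* Coordinates in [-C, C], shifted by C to become ordinals below 2 C + 1. *)
pose val (g : {ffun 'I_d -> 'I_(2 * C).+1}) : algC :=
  N%:R^-1 * \sum_i (((g i : nat)%:Z - C%:Z)%:~R * theta ^+ i).
exists [seq val g | g <- enum {ffun 'I_d -> 'I_(2 * C).+1}] => x Ox xB.
have [c Dc] := coord _ Ox.
have cC i : `|c i| <= C%:Z.
  rewrite -(ler_int algC) intr_norm; apply: le_trans (HC i).
  have kc h : [set` Crat] ((c h)%:~R : algC) by apply: rpred_int.
  have := conj_coord conj i kc; rewrite -Dc => e.
  have -> : (c i)%:~R = \sum_j w i j * nu j x.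
    apply: (mulfI V0); rewrite e mulr_sumr; apply: eq_bigr => j _.
    by rewrite rmorphM rmorph_nat /w; field.
  apply: le_trans (ler_norm_sum _ _ _) _; apply: ler_sum => j _.
  by rewrite normrM ler_wpM2l.
have /choice[g Dg] : forall i, exists g : 'I_(2 * C).+1, (g : nat)%:Z - C%:Z = c i.
  move=> i; have := cC i; rewrite ler_norml => /andP[h1 h2].
  have h3 : (absz (c i + C%:Z)%R < (2 * C).+1)%N by lia.
  by exists (Ordinal h3) => /=; lia.
apply/mapP; exists (finfun g); rewrite ?mem_enum // /val.
under eq_bigr do rewrite ffunE Dg.
by rewrite -Dc mulKf // pnatr_eq0 -lt0n.
Qed.

Definition nf_norm x := \prod_j nu j x.

Lemma nf_normM x y : nf_norm (x * y) = nf_norm x * nf_norm y.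
Proof. by rewrite -big_split; apply: eq_bigr => j _; rewrite rmorphM. Qed.

Lemma nf_norm_neq0 x : x != 0 -> nf_norm x != 0.
Proof. by move=> x0; apply/prodf_neq0 => j _; rewrite fmorph_eq0. Qed.

(* The norm is the determinant of a rational matrix, similar over [algC] to the
   diagonal matrix of the conjugates. *)
Lemma nf_norm_Crat x : F x -> nf_norm x \in Crat.
Proof.
move=> Fx; have Fxt i : F (x * theta ^+ i) by apply: (sfM FF) => //; apply: (sfX FF).
have /choice[M DM] := fun i : 'I_d => nf_coord (Fxt i).
pose A : 'M[algC]_d := \matrix_(i, h) ratr (M i h).
pose V := conj_mx theta nu.
have : diag_mx (\row_j nu j x) *m V = V *m A^T.
  apply/matrixP => j i; rewrite mul_diag_mx !mxE.
  have := congr1 (nu j) (DM i); rewrite nf_conj_sum rmorphM rmorphXn /= => ->.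
  by apply: eq_bigr => h _; rewrite !mxE mulrC.
move=> /(congr1 (fun B => \det B)); rewrite !det_mulmx det_diag det_tr.
rewrite mulrC => /(mulfI (det_conj_mx conj)) e.
rewrite /nf_norm (_ : \prod_j nu j x = \det A); last first.
  by rewrite -e; apply: eq_bigr => j _; rewrite mxE.
by apply: (sfdet is_subfield_Crat) => i j; rewrite mxE; apply: Crat_rat.
Qed.

Lemma nf_norm_int x : integers F x -> nf_norm x \is a Num.int.
Proof.
move=> [Fx Ax]; apply: Cint_rat_Aint; first exact: nf_norm_Crat.
by apply: rpred_prod => j _; rewrite Aint_aut.
Qed.

(** Dirichlet's box principle for the fractional parts of the coordinates of t x, with boxes of side
    1/s. As s = C + 1 and C bounds the sum of the |nu_j(theta)|^i for each j, all conjugates of the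
    difference are at most C/s < 1. *)
Lemma nf_approx : exists M : nat, forall x, F x ->
  exists t : nat, [/\ (0 < t)%N, (t <= M)%N
    & exists2 w, integers F w & `|nf_norm (t%:R * x - w)| < 1].
Proof.
have [C HC] : exists C : nat, forall j, \sum_(i < d) `|nu j theta| ^+ i <= C%:R.
  exists (Num.bound (\sum_j \sum_(i < d) `|nu j theta| ^+ i)).
  have ge0 j : 0 <= \sum_(i < d) `|nu j theta| ^+ i.
    by rewrite sumr_ge0 // => i _; rewrite exprn_ge0.
  move=> j; apply/ltW/(le_lt_trans _ (archi_boundP _)); last exact: sumr_ge0.
  by rewrite [leRHS](bigD1 j) //= lerDl sumr_ge0.
pose s := C.+1; exists #|{ffun 'I_d -> 'I_s}| => x Fx.
have [q Dx] := nf_coord Fx.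
pose r (t : nat) i : rat := t%:R * q i - (Num.floor (t%:R * q i))%:~R.
have rP t i : 0 <= r t i < 1.
  by have := floor_itv (t%:R * q i); rewrite /r intrD; lra.
have bP t i : exists b : 'I_s, Num.floor (s%:R * r t i) = b.
  have /andP[r0 r1] := rP t i.
  have h0 : 0 <= Num.floor (s%:R * r t i) by rewrite floor_ge0 mulr_ge0.
  have hs : Num.floor (s%:R * r t i) < s%:Z.
    by rewrite floor_lt_int gtr_pMr // ltr0n.
  case: (Num.floor _) h0 hs => // b _; rewrite ltz_nat => bs.
  by exists (Ordinal bs).
have /choice[b Db] : forall t : nat, exists b : {ffun 'I_d -> 'I_s},
    forall i, Num.floor (s%:R * r t i) = b i.
  move=> t; have /choice[b Db] := bP t; exists (finfun b) => i.
  by rewrite ffunE.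
have [t [t' [tt' bE]]] :=
  ord_pigeonhole (fun t : 'I_(#|{ffun 'I_d -> 'I_s}|.+1) => b t) (ltnSn _).
exists (t' - t)%N; split; first by rewrite subn_gt0.
  by rewrite -ltnS (leq_ltn_trans (leq_subr _ _)).
pose a i : int := Num.floor (t'%:R * q i) - Num.floor (t%:R * q i).
exists (\sum_i (a i)%:~R * theta ^+ i).
  apply: (oisum FF) => h _; apply: (oiM FF); first exact: oiint.
  by apply: (oiX FF).
pose e i := r t' i - r t i.
have De : (t' - t)%:R * x - \sum_i (a i)%:~R * theta ^+ i =
    \sum_i ratr (e i) * theta ^+ i.
  rewrite Dx mulr_sumr -sumrB; apply: eq_bigr => i _.
  rewrite mulrA -mulrBl; congr (_ * _).
  rewrite -[(t' - t)%:R](ratr_nat algC) -rmorphM -(ratr_int algC (a i)) -rmorphB.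
  congr (ratr _); rewrite /e /r /a natrB 1?ltnW // intrB; ring.
have ie i : `|s%:R * e i| < 1.
  have := floor_itv (s%:R * r t i); have := floor_itv (s%:R * r t' i).
  rewrite !Db bE /e intrD ltr_norml => /andP[h1 h2] /andP[h3 h4].
  by apply/andP; split; lra.
rewrite De /nf_norm normr_prod.
have s0 : 0 < s%:R :> algC by rewrite ltr0n.
apply: (@le_lt_trans _ _ (\prod_(j < d) (C%:R / s%:R : algC))); last first.
  rewrite prodr_const card_ord exprn_ilt1 ?divr_ge0 ?ler0n // -?lt0n //.
  by rewrite ltr_pdivrMr // mul1r ltr_nat.
apply: ler_prod => j _; rewrite normr_ge0 /= nf_conj_sum.
apply: le_trans (ler_norm_sum _ _ _) _.
rewrite ler_pdivlMr //; apply: le_trans (HC j).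
rewrite mulr_suml; apply: ler_sum => i _.
rewrite normrM normrX mulrAC ler_piMl ?exprn_ge0 //.
have <- : `|ratr (s%:R * e i)| = `|ratr (e i)| * s%:R :> algC.
  by rewrite rmorphM /= normrM ratr_nat normr_nat mulrC.
by rewrite -ratr_norm -(rmorph1 (ratr : rat -> algC)) ler_rat ltW.
Qed.

End NumberField.

(** * Ideals *)

Section Submodules.
Variables (k : set algC) (kF : is_subfield k).
Local Notation O := (integers k).
Local Notation "I ** J" := (ideal_mul k I J) (at level 40, left associativity).
Implicit Types (I J K A B : set algC).

Definition scale (a : algC) I : set algC := [set a * x | x in I].

Lemma sub0 I : is_submodule k I -> I 0. Proof. by case. Qed.
Lemma subD I x y : is_submodule k I -> I x -> I y -> I (x + y).
Proof. by case=> _ + _ => /[apply]/[apply]. Qed.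
Lemma subM I a x : is_submodule k I -> O a -> I x -> I (a * x).
Proof. by case=> _ _ => /[apply]/[apply]. Qed.
Lemma subN I x : is_submodule k I -> I x -> I (- x).
Proof. by move=> sI Ix; rewrite -mulN1r; apply: subM => //; apply/oiN/oi1. Qed.
Lemma subB I x y : is_submodule k I -> I x -> I y -> I (x - y).
Proof. by move=> sI Ix Iy; apply: subD => //; apply: subN. Qed.

Lemma module_span_submodule A : is_submodule k (module_span k A).
Proof.
split=> [|x y Ax Ay|a x Oa Ax] S [sS AS]; first exact: sub0.
  by apply: subD => //; [apply: Ax | apply: Ay].
by apply: subM => //; apply: Ax.
Qed.

Lemma module_span_gen A : A `<=` module_span k A.
Proof. exact: sub_gen_smallest. Qed.

Lemma module_span_min A I : is_submodule k I -> A `<=` I -> module_span k A `<=` I.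
Proof. by move=> sI AI; apply: smallest_sub. Qed.

Lemma ideal_mul_submodule I J : is_submodule k (I ** J).
Proof. exact: module_span_submodule. Qed.
Hint Resolve ideal_mul_submodule : core.

Lemma mem_ideal_mul I J x y : I x -> J y -> (I ** J) (x * y).
Proof. by move=> Ix Jy; apply: module_span_gen; exists x => //; exists y. Qed.

Lemma ideal_mul_min I J K : is_submodule k K ->
  (forall x y, I x -> J y -> K (x * y)) -> I ** J `<=` K.
Proof.
move=> sK IJK; apply: module_span_min => // _ [x Ix [y Jy <-]]; exact: IJK.
Qed.

Lemma ideal_mulS I J I' J' : I `<=` I' -> J `<=` J' -> I ** J `<=` I' ** J'.
Proof.
move=> II' JJ'; apply: ideal_mul_min => // x y Ix Jy.
by apply: mem_ideal_mul; [apply: II' | apply: JJ'].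
Qed.

Lemma ideal_mulC I J : I ** J = J ** I.
Proof.
by rewrite eqEsubset; split; apply: ideal_mul_min => // x y *;
   rewrite mulrC; apply: mem_ideal_mul.
Qed.

Lemma ideal_mulA I J K : I ** (J ** K) = I ** J ** K.
Proof.
have sub A B C : A ** (B ** C) `<=` A ** B ** C.
  apply: ideal_mul_min => // x z Ax.
  pose S := [set z | (A ** B ** C) (x * z)].
  suff : B ** C `<=` S by apply.
  apply: ideal_mul_min; last first.
    by move=> u v Bu Cv; rewrite /S /= mulrA; apply: mem_ideal_mul => //; apply: mem_ideal_mul.
  split=> [|u v Su Sv|a u Oa Su]; rewrite /S /=.
  - by rewrite mulr0; apply: (sub0 (ideal_mul_submodule _ _)).
  - by rewrite mulrDr; apply: (subD (ideal_mul_submodule _ _)).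
  - by rewrite mulrCA; apply: (subM (ideal_mul_submodule _ _)).
rewrite eqEsubset; split; first exact: sub.
by rewrite ideal_mulC (ideal_mulC I J) (ideal_mulC I) (ideal_mulC J K); apply: sub.
Qed.

Lemma ideal_mulCA I J K : I ** (J ** K) = J ** (I ** K).
Proof. by rewrite !ideal_mulA (ideal_mulC I J). Qed.

Lemma integers_submodule : is_submodule k O.
Proof.
by split=> [|x y|a x]; [exact: (oi0 kF) | exact: (oiD kF) | exact: (oiM kF)].
Qed.
Hint Resolve integers_submodule : core.

Lemma integers_ideal : is_ideal k O. Proof. by split. Qed.

Lemma mul1_ideal I : is_submodule k I -> O ** I = I.
Proof.
move=> sI; rewrite eqEsubset; split.
  by apply: ideal_mul_min => // x y; apply: subM.
by move=> x Ix; rewrite -[x]mul1r; apply: mem_ideal_mul => //; exact: (oi1 kF).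
Qed.

Lemma mul_ideal1 I : is_submodule k I -> I ** O = I.
Proof. by move=> sI; rewrite ideal_mulC mul1_ideal. Qed.

Lemma scale_submodule a I : is_submodule k I -> is_submodule k (scale a I).
Proof.
move=> sI; split=> [|_ _ [x Ix <-] [y Iy <-]|b _ Ob [x Ix <-]].
- by exists 0; rewrite ?mulr0 //; apply: sub0.
- by exists (x + y); rewrite ?mulrDr //; apply: subD.
- by exists (b * x); rewrite 1?mulrCA //; apply: subM.
Qed.

Lemma scaleS a I J : I `<=` J -> scale a I `<=` scale a J.
Proof. by move=> IJ _ [x Ix <-]; exists x => //; apply: IJ. Qed.

Lemma scaleS_inj a I J : a != 0 -> scale a I `<=` scale a J -> I `<=` J.
Proof. by move=> a0 IJ x Ix; have [|y Jy /(mulfI a0) <-] := IJ (a * x); first by exists x. Qed.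

Lemma scale_inj a I J : a != 0 -> scale a I = scale a J -> I = J.
Proof.
by move=> a0 /seteqP[IJ JI]; rewrite eqEsubset; split; apply: (scaleS_inj a0).
Qed.

Lemma scaleA a b I : scale a (scale b I) = scale (a * b) I.
Proof.
rewrite eqEsubset; split=> [_ [_ [x Ix <-] <-]|_ [x Ix <-]].
  by exists x; rewrite ?mulrA.
by exists (b * x); rewrite ?mulrA //; exists x.
Qed.

Lemma scale1 I : scale 1 I = I.
Proof.
rewrite eqEsubset; split=> [_ [x Ix <-]|x Ix]; first by rewrite mul1r.
by exists x; rewrite ?mul1r.
Qed.

Lemma mul_scale a I J : scale a I ** J = scale a (I ** J).
Proof.
rewrite eqEsubset; split.
  apply: ideal_mul_min; first exact: scale_submodule.
  by move=> _ y [x Ix <-] Jy; exists (x * y); rewrite ?mulrA //; apply: mem_ideal_mul.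
have [->|a0] := eqVneq a 0.
  move=> _ [x _ <-]; rewrite mul0r; exact: (sub0 (ideal_mul_submodule _ _)).
rewrite -[X in _ `<=` X]scale1 -(mulfV a0) -scaleA; apply: scaleS.
apply: ideal_mul_min; first exact: scale_submodule.
move=> x y Ix Jy; exists (a * x * y); last by rewrite -mulrA mulKf.
by apply: mem_ideal_mul => //; exists x.
Qed.

Lemma scale_mul a I J : I ** scale a J = scale a (I ** J).
Proof. by rewrite ideal_mulC mul_scale ideal_mulC. Qed.

Lemma module_span1 a : module_span k [set a] = scale a O.
Proof.
rewrite eqEsubset; split.
  apply: module_span_min; first exact: scale_submodule.
  by move=> _ ->; exists 1; rewrite ?mulr1 //; exact: (oi1 kF).
move=> _ [x Ox <-]; rewrite mulrC; apply: (subM (module_span_submodule _)) => //.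
exact: module_span_gen.
Qed.

Definition nz_ideal I : Prop := is_ideal k I /\ exists2 x, I x & x != 0.

Lemma nz_idealP I : nz_ideal I <-> is_ideal k I /\ I <> [set 0].
Proof.
split=> [[iI [x Ix x0]]|[iI I0]]; split=> //.
  by move=> I0; move: Ix; rewrite I0 /= => x00; rewrite x00 eqxx in x0.
apply: contrapT => H; apply: I0; rewrite eqEsubset; split=> [x Ix|_ ->]; last by apply: sub0; case: iI.
by apply: contrapT => x0; apply: H; exists x => //; apply/eqP.
Qed.

Lemma nz_ideal_submodule I : nz_ideal I -> is_submodule k I.
Proof. by case=> [[]]. Qed.

Lemma nz_ideal_sub I : nz_ideal I -> I `<=` O.
Proof. by case=> [[]]. Qed.

Lemma nz_ideal_integers : nz_ideal O.
Proof.
split; first exact: integers_ideal.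
by exists 1; rewrite ?oner_eq0 //; exact: (oi1 kF).
Qed.

Lemma is_ideal_mul I J : is_ideal k I -> is_ideal k J -> is_ideal k (I ** J).
Proof.
move=> [sI IO] [sJ JO]; split=> //; apply: ideal_mul_min => // x y Ix Jy.
by apply: (oiM kF); [apply: IO | apply: JO].
Qed.

Lemma nz_ideal_mul I J : nz_ideal I -> nz_ideal J -> nz_ideal (I ** J).
Proof.
move=> [iI [x Ix x0]] [iJ [y Jy y0]]; split; first exact: is_ideal_mul.
by exists (x * y); [apply: mem_ideal_mul | rewrite mulf_neq0].
Qed.

Lemma nz_ideal_scale a I : O a -> a != 0 -> nz_ideal I -> nz_ideal (scale a I).
Proof.
move=> Oa a0 [[sI IO] [x Ix x0]]; split.
  split; first exact: scale_submodule.
  by move=> _ [y Iy <-]; apply: (oiM kF) => //; apply: IO.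
by exists (a * x); [exists x | rewrite mulf_neq0].
Qed.

Lemma ideal_mul_subl I J : is_submodule k I -> J `<=` O -> I ** J `<=` I.
Proof.
move=> sI JO; apply: ideal_mul_min => // x y Ix /JO Oy.
by rewrite mulrC; apply: subM.
Qed.

Lemma ideal1_eq I : is_ideal k I -> I 1 -> I = O.
Proof.
move=> [sI IO] I1; rewrite eqEsubset; split=> // x Ox.
by rewrite -[x]mulr1; apply: subM.
Qed.

Definition ideal_prod (s : seq (set algC)) := foldr (ideal_mul k) O s.

Lemma ideal_prod_submodule s : is_submodule k (ideal_prod s).
Proof. by case: s => [|A s]; [exact: integers_submodule | exact: ideal_mul_submodule]. Qed.

Lemma ideal_prod_cat s t : ideal_prod (s ++ t) = ideal_prod s ** ideal_prod t.
Proof.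
elim: s => [|A s IH] /=; first by rewrite mul1_ideal //; apply: ideal_prod_submodule.
by rewrite IH ideal_mulA.
Qed.

Lemma nz_ideal_prod s : {in s, forall A, nz_ideal A} -> nz_ideal (ideal_prod s).
Proof.
elim: s => [|A s IH] nz /=; first exact: nz_ideal_integers.
apply: nz_ideal_mul; first by apply: nz; rewrite mem_head.
by apply: IH => B sB; apply: nz; rewrite in_cons sB orbT.
Qed.

Lemma ideal_prod_rem A s : A \in s -> ideal_prod s = A ** ideal_prod (rem A s).
Proof.
elim: s => [|B s IH] //=; rewrite in_cons eq_sym; case: eqVneq => [->|_] //= sA.
by rewrite IH // ideal_mulCA.
Qed.

Lemma perm_ideal_prod s t : perm_eq s t -> ideal_prod s = ideal_prod t.
Proof.
elim: s t => [|A s IH] t; first by move=> /perm_size/esym/size0nil ->.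
move=> st; have tA : A \in t by rewrite -(perm_mem st) mem_head.
rewrite (ideal_prod_rem tA) /= (IH (rem A t)) // -(perm_cons A).
exact: (perm_trans st (perm_to_rem tA)).
Qed.

Definition ideal_exp A n := ideal_prod (nseq n A).

Lemma ideal_expS A n : ideal_exp A n.+1 = A ** ideal_exp A n.
Proof. by []. Qed.

Lemma ideal_expD A m n : ideal_exp A (m + n) = ideal_exp A m ** ideal_exp A n.
Proof. by rewrite /ideal_exp nseqD ideal_prod_cat. Qed.

Lemma nz_ideal_exp A n : nz_ideal A -> nz_ideal (ideal_exp A n).
Proof. by move=> nz; apply: nz_ideal_prod => B /nseqP[-> _]. Qed.

Lemma ideal_exp1 A : is_submodule k A -> ideal_exp A 1 = A.
Proof. exact: mul_ideal1. Qed.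

Lemma mem_ideal_exp A n (f : 'I_n -> algC) :
  (forall i, A (f i)) -> ideal_exp A n (\prod_i f i).
Proof.
elim: n f => [|n IH] f Af; first by rewrite big_ord0; exact: (oi1 kF).
by rewrite big_ord_recl ideal_expS; apply: mem_ideal_mul => //; apply: IH.
Qed.

Lemma ideal_exp_sub A m n : is_ideal k A -> (m <= n)%N -> ideal_exp A n `<=` ideal_exp A m.
Proof.
move=> [sA AO] mn; rewrite -(subnKC mn) ideal_expD; apply: ideal_mul_subl.
  exact: ideal_prod_submodule.
elim: (n - m)%N => [|h IH] //; rewrite ideal_expS.
by apply: subset_trans AO; apply: ideal_mul_subl.
Qed.

Lemma mem_expX A x n : A x -> ideal_exp A n (x ^+ n).
Proof.
move=> Ax; have := @mem_ideal_exp A n (fun=> x) (fun=> Ax).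
by rewrite prodr_const card_ord.
Qed.

End Submodules.

Definition is_subgroup_add (H : set algC) : Prop :=
  H 0 /\ forall x y, H x -> H y -> H (x - y).

Lemma add_subgroup_opp H x : is_subgroup_add H -> H x -> H (- x).
Proof. by move=> [H0 HB] Hx; rewrite -sub0r; apply: HB. Qed.

Lemma add_subgroup_add H x y : is_subgroup_add H -> H x -> H y -> H (x + y).
Proof.
move=> sH Hx Hy; rewrite -[y]opprK; case: (sH) => _; apply=> //.
exact: add_subgroup_opp.
Qed.

Lemma add_subgroup_submodule k (I : set algC) : is_subfield k -> is_submodule k I ->
  is_subgroup_add I.
Proof. by move=> kF sI; split; [exact: sub0 sI | move=> x y; exact: (subB kF sI)]. Qed.

(** Indices are computed as lengths of lists of representatives, which multiply along a chain of
    subgroups. *)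
Definition is_transversal_add (G H : set algC) (r : seq algC) : Prop :=
  [/\ uniq r, {in r, forall x, G x}, forall x, G x -> exists2 y, y \in r & H (x - y)
    & {in r &, forall x y, H (x - y) -> x = y}].

(* An algebraic integer relation over algebraic integers is witnessed by a
   finitely generated module. *)
Lemma Aint_root_monic_Aint n (g : 'I_n -> algC) x : (forall i, g i \in Aint) ->
  x ^+ n = \sum_(i < n) g i * x ^+ i -> x \in Aint.
Proof.
case: n g => [|n] g Ag xn.
  by move/eqP: xn; rewrite expr0 big_ord0 oner_eq0.
pose p : {poly algC} := 'X^(n.+1) - \sum_(i < n.+1) g i *: 'X^i.
have szs : (size (\sum_(i < n.+1) g i *: 'X^i : {poly algC})%R <= n.+1)%N.
  apply: (leq_trans (size_sum _ _ _)); apply/bigmax_leqP => i _.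
  by rewrite (leq_trans (size_scale_leq _ _)) // size_polyXn.
have mon : p \is monic.
  rewrite monicE lead_coefDl ?lead_coefXn // size_polyN size_polyXn.
  by rewrite ltnS.
have px : root p x.
  rewrite /root /p hornerD hornerN hornerXn horner_sum xn subr_eq0; apply/eqP.
  by apply: eq_bigr => i _; rewrite hornerZ hornerXn.
have int_Aint y : y \in Aint -> integralOver (intr : int -> algC) y.
  move=> Ay; have /polyOverP Ap := Ay.
  pose q : {poly int} := map_poly Num.floor (minCpoly y).
  have Dq : map_poly intr q = minCpoly y.
    by apply/polyP=> i; rewrite coef_map coef_map_id0 ?floor0 //= floorK.
  exists q; last by rewrite Dq root_minCpoly.
  rewrite monicE; apply/eqP/(@intr_inj algC).
  rewrite -lead_coef_map_inj ?Dq //; last exact: intr_inj.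
  by have [q' [-> qm] _] := minCpolyP y; rewrite lead_coef_map (monicP qm) rmorph1.
have [|q qmon qx] := @integral_root_monic int algC intr x p mon px.
  move=> c /(nthP 0)[i ip <-]; apply/int_Aint.
  rewrite /p coefB coefXn coef_sum rpredB ?rpred_nat // rpred_sum // => h _.
  by rewrite coefZ coefXn rpredM ?rpred_nat.
apply: (root_monic_Aint qx); first exact: monic_map.
by apply/polyOverP => i; rewrite coef_map /= intr_int.
Qed.

(** * Integrality and the determinant trick *)

Section Dedekind.
Variables (k : set algC) (n : nat).
Hypothesis kN : is_nf n k.
Let kF : is_subfield k. Proof. by case: kN. Qed.
Local Notation O := (integers k).
Local Notation "I ** J" := (ideal_mul k I J) (at level 40, left associativity).
Implicit Types (I J A B : set algC).

Lemma mod_finite N : (0 < N)%N -> exists M : nat,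
  forall f : 'I_M.+1 -> algC, (forall i, O (f i)) ->
    exists i j : 'I_M.+1, (i < j)%N /\ exists2 w, O w & f i - f j = N%:R * w.
Proof.
have [d [theta [nu [_ G]]]] := exists_nf_gen kN.
exact: (integers_mod_finite G).
Qed.

(** A list of pairwise incongruent elements that misses a class can be prolonged, while the
    pigeonhole principle modulo N bounds its length. *)
Lemma exists_transversal N (P H : set algC) : (0 < N)%N -> P `<=` O ->
  is_subgroup_add H -> scale N%:R O `<=` H -> exists r, is_transversal_add P H r.
Proof.
move=> N0 PO sH NH; have [M HM] := mod_finite N0.
apply: contrapT => nex.
suff /(_ M.+1)[r [szr Ur rP rH]] : forall m, exists r : seq algC,
    [/\ size r = m, uniq r, {in r, forall x, P x} & {in r &, forall x y, H (x - y) -> x = y}].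
  have [|i [j [ij [w Ow e]]]] := HM (fun i => r`_i).
    by move=> i; apply/PO/rP/mem_nth; rewrite szr.
  have : r`_i == r`_j.
    apply/eqP/rH; rewrite ?mem_nth ?szr //.
    by rewrite e; apply: NH; exists w.
  by rewrite nth_uniq ?szr // => /eqP eij; move: ij; rewrite eij ltnn.
elim=> [|m [r [szr Ur rP rH]]]; first by exists [::].
have [x [Px xr]] : exists x, P x /\ forall y, y \in r -> ~ H (x - y).
  apply: contrapT => H1; apply: nex; exists r; split=> // x Px.
  apply: contrapT => H2; apply: H1; exists x; split=> // y yr Hxy.
  by apply: H2; exists y.
exists (x :: r); split; rewrite /= ?szr ?Ur ?andbT //.
- by apply/negP => xr'; apply: (xr _ xr'); rewrite subrr; case: sH.
- by move=> y; rewrite in_cons => /orP[/eqP ->|/rP].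
- move=> y z; rewrite !in_cons => /orP[/eqP ->|ry] /orP[/eqP ->|rz] //.
  + by move=> /(xr _ rz).
  + by move=> /(add_subgroup_opp sH); rewrite opprB => /(xr _ ry).
  + exact: rH.
Qed.

Lemma integers_dvd_int x : O x -> x != 0 ->
  exists2 N : nat, (0 < N)%N & exists2 y, O y & x * y = N%:R.
Proof.
move=> [kx Ax] x0; have [N N0 [y Ay xy]] := Aint_dvd_int Ax x0.
exists N => //; exists y => //; split=> //.
rewrite -(mulKf x0 y) xy; apply: (sfM kF); [exact: (sfV kF) | exact: (sfnat kF)].
Qed.

Lemma nz_ideal_int I : nz_ideal k I -> exists2 N : nat, (0 < N)%N & I N%:R.
Proof.
move=> [[sI IO] [x Ix x0]]; have [N N0 [y Oy xy]] := integers_dvd_int (IO _ Ix) x0.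
by exists N => //; rewrite -xy mulrC; apply: (subM sI).
Qed.

Lemma scale_sub_ideal a I : is_submodule k I -> I a -> scale a O `<=` I.
Proof. by move=> sI Ia _ [x Ox <-]; rewrite mulrC; apply: (subM sI). Qed.

(* Comparing subset sums of the numbers [N * x ^+ i.+1] modulo [N] yields a
   relation with coefficients in {-1, 0, 1}, hence a monic one. *)
Lemma almost_integral x (N : nat) : k x -> (0 < N)%N ->
  (forall i, O (N%:R * x ^+ i)) -> O x.
Proof.
move=> kx N0 ON; split=> //; have [M HM] := mod_finite N0.
have Mc : (M.+1 <= #|{set 'I_M}|)%N.
  by rewrite -cardsT -powersetT card_powerset cardsT card_ord ltn_expl.
(* The exponents start at 1, so that [w] becomes the constant coefficient of a relation of positive
   degree. *)
pose f (t : 'I_M.+1) := \sum_(i in enum_val (widen_ord Mc t)) N%:R * x ^+ i.+1.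
have Of t : O (f t) by apply: (oisum kF) => i _; exact: ON.
have [s [t [st [w Ow e]]]] := HM f Of.
pose A := enum_val (widen_ord Mc s); pose B := enum_val (widen_ord Mc t).
have AB : A != B.
  apply/eqP => /enum_val_inj /(congr1 val) /= est.
  by move: st; rewrite est ltnn.
pose eps (i : 'I_M) : algC := (i \in A)%:R - (i \in B)%:R.
have sum_eps : \sum_i eps i * x ^+ i.+1 = w.
  have N0' : N%:R != 0 :> algC by rewrite pnatr_eq0 -lt0n.
  apply: (mulfI N0'); rewrite -e /f -/A -/B !mulr_sumr.
  rewrite [\sum_(i in A) _]big_mkcond [\sum_(i in B) _]big_mkcond -sumrB.
  apply: eq_bigr => i _; rewrite /eps.
  by case: (i \in A); case: (i \in B) => /=; ring.
have [i0 i0P] : exists i0, eps i0 != 0.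
  apply: contra_notP (elimN eqP AB) => H; apply/setP => i.
  have : eps i = 0 by apply: contrapT => /eqP ?; apply: H; exists i.
  move/eqP; rewrite subr_eq0 eqr_nat.
  by case: (i \in A); case: (i \in B).
(* At the largest index of the relation the coefficient is 1 or -1, hence its own inverse. *)
case: (@arg_maxnP _ i0 (fun i => eps i != 0) val i0P) => m em mmax.
have e2 : eps m * eps m = 1.
  move: em; rewrite /eps; case: (m \in A); case: (m \in B) => /=.
  - by rewrite subrr eqxx.
  - by rewrite subr0 mulr1.
  - by rewrite sub0r mulrNN mulr1.
  - by rewrite subrr eqxx.
have Aeps i : eps i \in Aint by rewrite rpredB ?rpred_nat.
pose g (i : 'I_m.+1) : algC :=
  if i == 0 :> nat then eps m * w else
    - eps m * (if insub i.-1 is Some h then eps h else 0).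
apply: (@Aint_root_monic_Aint m.+1 g).
  move=> i; rewrite /g; case: ifP => _.
    by rewrite rpredM //; case: Ow.
  rewrite rpredM ?rpredN //; case: insub => [h|]; [exact: Aeps | exact: rpred0].
have -> : x ^+ m.+1 = eps m * w - \sum_(i < M | (i < m)%N) eps m * eps i * x ^+ i.+1.
  rewrite -sum_eps mulr_sumr [X in X - _](bigID (fun i : 'I_M => (i < m)%N)) /=.
  rewrite addrAC (eq_bigr (fun i => eps m * eps i * x ^+ i.+1)) => [|i _]; last first.
    by rewrite mulrA.
  rewrite subrr add0r (bigD1 m) ?ltnn //= big1 ?addr0 ?mulrA ?e2 ?mul1r //.
  move=> i /andP[im ne]; have [->|ei] := eqVneq (eps i) 0; first by ring.
  have : (i <= m)%N := mmax i ei; rewrite leq_eqVlt (negPf im) orbF => /eqP/val_inj eim.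
  by rewrite eim eqxx in ne.
rewrite big_ord_recl /g /= expr0 mulr1; congr (_ + _).
rewrite -sumrN (big_ord_widen_cond M xpredT (fun i => - eps m *
   (if insub i is Some h then eps h else 0) * x ^+ i.+1)); last exact: ltnW.
rewrite [RHS](eq_bigl (fun i : 'I_M => (i < m)%N)) //.
by apply: eq_bigr => i _; rewrite valK; ring.
Qed.

(** A nonzero [a] in [A] bounds the denominators of all powers of [x]: each x^i a stays in [A], and
    some positive integer is a multiple of [a]. *)
Lemma stable_integral A x : nz_ideal k A -> k x ->
  (forall a, A a -> A (x * a)) -> O x.
Proof.
move=> [[sA AO] [a Aa a0]] kx xA.
have [N N0 [b Ob ab]] := integers_dvd_int (AO _ Aa) a0.
apply: (almost_integral kx N0) => i; rewrite -ab -mulrA mulrC -mulrA mulrC.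
apply: (oiM kF) => //; apply: AO; elim: i => [|i IH]; first by rewrite expr0 mul1r.
by rewrite exprS -mulrA; apply: xA.
Qed.

Lemma prod_mod_ideal I T (r : seq T) (f g : T -> algC) : is_ideal k I ->
  (forall i, O (f i)) -> (forall i, O (g i)) -> (forall i, I (f i - g i)) ->
  I (\prod_(i <- r) f i - \prod_(i <- r) g i).
Proof.
move=> [sI IO] Of Og fg; elim: r => [|x r IH]; first by rewrite !big_nil subrr; apply: sub0 sI.
rewrite !big_cons; set a := \prod_(i <- r) f i; set b := \prod_(i <- r) g i.
rewrite (_ : _ - _ = f x * (a - b) + b * (f x - g x)); last by ring.
by apply: (subD sI) => //; apply: (subM sI) => //; apply: (oiprod kF).
Qed.

Lemma det_mod_ideal I m (A B : 'M[algC]_m) : is_ideal k I ->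
  (forall i j, O (A i j)) -> (forall i j, O (B i j)) -> (forall i j, I (A i j - B i j)) ->
  I (\det A - \det B).
Proof.
move=> [sI IO] OA OB AB; rewrite /determinant -sumrB; apply: (big_ind I) => [|x y|s _]; [exact: sub0 sI | exact: (subD sI) |].
rewrite -mulrBr; apply: (subM sI) => //.
  by apply: (oiX kF); apply: (oiN kF); apply: (oi1 kF).
by apply: prod_mod_ideal.
Qed.

(** Determinant trick. [A] is generated by N and by representatives of [A] modulo N, and the
    inclusion writes these generators as combinations of themselves with a matrix [B] of
    coefficients in [C]. The determinant of 1 - B annihilates N, hence is 0, while it is congruent
    to 1 modulo [C]. *)
Lemma nakayama A C : nz_ideal k A -> is_ideal k C -> A `<=` A ** C -> C 1.
Proof.
move=> nA iC AC; have [N N0 AN] := nz_ideal_int nA.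
have [sA AO] := nA.1; have [sC CO] := iC.
have sNO : is_subgroup_add (scale N%:R O).
  by apply: (add_subgroup_submodule kF); apply/scale_submodule/(integers_submodule kF).
have [r [_ rA rP _]] := exists_transversal N0 AO sNO (@subset_refl _ _).
pose m := (size r).+1; pose g (i : 'I_m) := (N%:R :: r)`_i.
have Ag i : A (g i).
  rewrite /g; case: i => -[|i] im //=; apply/rA/mem_nth; exact: im.
pose S := [set x | exists2 b : 'I_m -> algC, (forall i, C (b i)) & x = \sum_i b i * g i].
have sS : is_submodule k S.
  split=> [|_ _ [b Cb ->] [c Cc ->]|a _ Oa [b Cb ->]].
  - by exists (fun=> 0) => [i|]; [apply: sub0 sC | rewrite big1 // => i _; rewrite mul0r].
  - exists (fun i => b i + c i) => [i|]; first exact: (subD sC).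
    by rewrite -big_split; apply: eq_bigr => i _; rewrite mulrDl.
  - exists (fun i => a * b i) => [i|]; first exact: (subM sC).
    by rewrite mulr_sumr; apply: eq_bigr => i _; rewrite mulrA.
have AS : A ** C `<=` S.
  apply: ideal_mul_min => // x c Ax Cc.
  have [y ry [w Ow xy]] := rP x Ax.
  have iy : ((index y r).+1 < m)%N by rewrite ltnS index_mem.
  pose b (i : 'I_m) := (if i == Ordinal iy then c else 0) + (if i == ord0 then w * c else 0).
  exists b => [i|].
    by apply: (subD sC) => //; case: ifP => _ //; try exact: (sub0 sC); exact: (subM sC).
  rewrite /b; under eq_bigr do rewrite mulrDl.
  rewrite big_split /= (bigD1 (Ordinal iy)) //= eqxx big1; last first.
    by move=> i /negPf ->; rewrite mul0r.
  rewrite (bigD1 ord0) //= big1; last by move=> i /negPf ->; rewrite mul0r.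
  rewrite /g /= nth_index // !addr0 -[x in LHS](subrK y) -xy; ring.
have /choice[B DB] : forall i, exists b : 'I_m -> algC,
    (forall j, C (b j)) /\ g i = \sum_j b j * g j.
  by move=> i; have [b Cb e] := AS _ (AC _ (Ag i)); exists b.
pose D : 'M[algC]_m := 1%:M - \matrix_(i, j) B i j.
have Dg : D *m (\col_j g j) = 0.
  rewrite mulmxBl mul1mx; apply/colP => i; rewrite !mxE.
  rewrite [in X in X - _](DB i).2; apply/eqP; rewrite subr_eq0; apply/eqP.
  by apply: eq_bigr => j _; rewrite !mxE.
have det0 : \det D = 0.
  have := congr1 (fun v : 'cV[algC]_m => (\adj D *m v) ord0 ord0) Dg.
  rewrite mulmxA mul_adj_mx mul_scalar_mx mulmx0 !mxE => /eqP.
  by rewrite mulf_eq0 pnatr_eq0 (gtn_eqF N0) orbF => /eqP.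
have : C (\det (1%:M : 'M[algC]_m) - \det D).
  have O1 i j : O ((1%:M : 'M[algC]_m) i j) by rewrite mxE; apply: (oinat kF).
  have CB i j : C (B i j) by have [] := DB i.
  apply: det_mod_ideal => // i j; rewrite !mxE.
    by apply: (oiB kF); [exact: (oinat kF) | apply: CO].
  by rewrite opprB addrCA subrr addr0.
by rewrite det0 det1 subr0.
Qed.

End Dedekind.

(** * Invertibility of ideals *)

Section Invertibility.
Variables (k : set algC) (n : nat).
Hypothesis kN : is_nf n k.
Let kF : is_subfield k. Proof. by case: kN. Qed.
Local Notation O := (integers k).
Local Notation "I ** J" := (ideal_mul k I J) (at level 40, left associativity).
Implicit Types (I J A B P : set algC).

(* [b] is an element of least nonzero norm. *)
Lemma ideal_class_rep : exists2 M : nat, (0 < M)%N &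
  forall A, nz_ideal k A -> exists b B,
    [/\ O b, b != 0, nz_ideal k B, B M%:R & scale M%:R A = scale b B].
Proof.
have [d [theta [nu [_ G]]]] := exists_nf_gen kN.
have [M0 HM] := nf_approx G.
exists M0`! => [|A nA]; first exact: fact_gt0.
have [[sA AO] [x0 Ax0 x00]] := nA.
pose Q m := `[< exists x, [/\ A x, x != 0 & `|nf_norm nu x| = m%:R] >].
have exQ : exists m, Q m.
  have /natrP[m Dm] : `|nf_norm nu x0| \is a Num.nat.
    by rewrite natr_norm_int // (nf_norm_int G) //; apply: AO.
  by exists m; apply/asboolP; exists x0.
case: (ex_minnP exQ) => m /asboolP[b [Ab b0 bm]] mmin.
have b0' : nf_norm nu b != 0 by apply: nf_norm_neq0.
have key a : A a -> exists2 w, O w & M0`!%:R * a = b * w.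
  move=> Aa; have [t [t0 tM [w Ow small]]] := HM (a / b) (sfdiv kF (AO _ Aa).1 (AO _ Ab).1).
  have tab : t%:R * a = b * w.
    apply/eqP; rewrite -subr_eq0; apply: contraT => ne0.
    set y := _ - _ in ne0.
    have Ay : A y.
      by apply: (subB kF sA); [apply: (subM sA) => //; exact: (oinat kF) | rewrite mulrC; apply: (subM sA)].
    have yE : y = b * (t%:R * (a / b) - w) by rewrite /y; field.
    have /natrP[m' Dm'] : `|nf_norm nu y| \is a Num.nat.
      by rewrite natr_norm_int // (nf_norm_int G) //; apply: AO.
    have : (m <= m')%N by apply: mmin; apply/asboolP; exists y.
    rewrite -(ler_nat algC) -Dm' -bm yE nf_normM normrM.
    by rewrite ler_pMr ?normr_gt0 // (lt_geF small).
  exists ((M0`! %/ t)%:R * w); first by apply: (oiM kF) => //; exact: (oinat kF).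
  rewrite mulrCA -tab mulrA -natrM divnK //.
  by apply: dvdn_fact; rewrite t0.
pose B := [set w | exists2 a, A a & M0`!%:R * a = b * w].
have BO : B `<=` O.
  move=> w [a Aa e]; have [w' Ow' e'] := key a Aa.
  by rewrite (mulfI b0 (etrans (esym e) e')).
have sB : is_submodule k B.
  split=> [|u v [a Aa ea] [c Ac ec]|u v Ou [a Aa ea]].
  - by exists 0; rewrite ?mulr0 //; exact: (sub0 sA).
  - by exists (a + c); [exact: (subD sA) | rewrite !mulrDr ea ec].
  - by exists (u * a); [exact: (subM sA) | rewrite mulrCA ea mulrCA].
have BM : B M0`!%:R by exists b; rewrite // mulrC.
exists b, B; split=> //; first exact: AO.
  by split=> //; exists M0`!%:R => //; rewrite pnatr_eq0 -lt0n fact_gt0.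
rewrite eqEsubset; split=> [_ [a Aa <-]|_ [w [a Aa e] <-]].
  by have [w Ow e] := key a Aa; exists w => //; exists a.
by exists a.
Qed.

(** An ideal containing N is determined by the representatives modulo N that it contains. *)
Lemma ideal_between_finite N : (0 < N)%N -> exists M : nat,
  forall f : 'I_M.+1 -> set algC, (forall i, nz_ideal k (f i) /\ f i N%:R) ->
    exists i j : 'I_M.+1, (i < j)%N /\ f i = f j.
Proof.
move=> N0; have sN := add_subgroup_submodule kF (scale_submodule N%:R (integers_submodule kF)).
have [r [Ur rO rP _]] := exists_transversal kN N0 (@subset_refl _ O) sN (@subset_refl _ _).
exists #|{set 'I_(size r)}| => f fP.
have [i [j [ij e]]] := ord_pigeonhole (fun i : 'I_(#|{set 'I_(size r)}|.+1) =>
  [set h : 'I_(size r) | `[< f i r`_h >]]%SET) (ltnSn _).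
exists i, j; split=> //.
have sub a b : [set h : 'I_(size r) | `[< f a r`_h >]]%SET =
    [set h : 'I_(size r) | `[< f b r`_h >]]%SET -> f a `<=` f b.
  move=> {}e x fx; have [[[sa aO] _] aN] := fP a; have [[[sb bO] _] bN] := fP b.
  have Ox := aO _ fx; have [y ry [w Ow xy]] := rP x Ox.
  have iy : (index y r < size r)%N by rewrite index_mem.
  have fay : f a y.
    by rewrite -[y](subKr x) -xy; apply: (subB kF sa) => //; rewrite mulrC; apply: (subM sa).
  have := congr1 (fun S : {set 'I_(size r)} => Ordinal iy \in S) e.
  rewrite !inE /= !nth_index // => /esym e'.
  have fby : f b y by apply/asboolP; rewrite e'; apply/asboolP.
  by rewrite -[x](subrK y) -xy; apply: (subD sb) => //; rewrite mulrC; apply: (subM sb).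
by rewrite eqEsubset; split; apply: sub.
Qed.

(** By finiteness, two powers A^i and A^(i + h + 1) have the same representative [B], so that A^i D
    = A^i for a scalar multiple [D] of A^(h + 1). Then [D] is integral because it stabilizes A^i,
    and contains 1 by the determinant trick; it is the unit ideal, and [A] times a multiple of A^h
    is principal. *)
Lemma ideal_inv A : nz_ideal k A ->
  exists a B, [/\ O a, a != 0, nz_ideal k B & A ** B = scale a O].
Proof.
move=> nA; have [M M0 rep] := ideal_class_rep.
have [L fin] := ideal_between_finite M0.
have M0' : M%:R != 0 :> algC by rewrite pnatr_eq0 -lt0n.
have nAi i : nz_ideal k (ideal_exp k A i) by apply: nz_ideal_exp.
have /choice[b /choice[B BP]] := fun i => rep _ (nAi i).
have [i [j [ij Bij]]] : exists i j : 'I_L.+1, (i < j)%N /\ B i = B j.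
  by apply: (fin (fun i : 'I_L.+1 => B i)) => i; have [_ _ nB BM _] := BP i.
have [Oi bi0 [[sBi _] _] _ ei] := BP i; have [Oj bj0 _ _ ej] := BP j.
have e : scale (b j) (ideal_exp k A i) = scale (b i) (ideal_exp k A j).
  apply: (scale_inj M0'); rewrite !scaleA !(mulrC M%:R) -!scaleA ei ej Bij.
  by rewrite !scaleA mulrC.
have [h jE] : exists h, j = (i + h.+1)%N :> nat.
  by exists (j - i).-1; rewrite prednK ?subn_gt0 // subnKC // ltnW.
pose D := [set x | k x /\ exists2 a, ideal_exp k A h.+1 a & b j * x = b i * a].
have sAh := ideal_prod_submodule kF (nseq h.+1 A).
have Dsc : scale (b j) D = scale (b i) (ideal_exp k A h.+1).
  rewrite eqEsubset; split=> [_ [x [kx [a Aa ->]] <-]|_ [a Aa <-]]; first by exists a.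
  exists (b i * a / b j); last by field.
  split; last by exists a => //; field.
  have [kbi _] := Oi; have [kbj _] := Oj.
  apply: (sfdiv kF) => //; apply: (sfM kF) => //.
  by have [] := nz_ideal_sub (nAi _) Aa.
have sD : is_submodule k D.
  split=> [|x y [kx [a Aa ea]] [ky [c Ac ec]]|u x Ou [kx [a Aa ea]]].
  - by split; [exact: (sf0 kF) | exists 0; rewrite ?mulr0 //; exact: (sub0 sAh)].
  - split; first exact: (sfD kF).
    by exists (a + c); [exact: (subD sAh) | rewrite !mulrDr ea ec].
  - split; first by apply: (sfM kF) => //; case: Ou.
    by exists (u * a); [exact: (subM sAh) | rewrite mulrCA ea mulrCA].
have AD : ideal_exp k A i ** D = ideal_exp k A i.
  apply: (scale_inj bj0); rewrite -scale_mul Dsc scale_mul //.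
  by rewrite -(ideal_expD kF) -jE e.
have DO : D `<=` O.
  move=> x Dx; have [kx _] := Dx; apply: (stable_integral kN (nAi i) kx) => a Aa.
  by rewrite -AD mulrC; apply: mem_ideal_mul.
have iD : is_ideal k D by split.
have D1 : D 1 by apply: (nakayama kN (nAi i) iD); rewrite AD.
have DE : D = O := ideal1_eq iD D1.
exists (b j), (scale (b i) (ideal_exp k A h)); split=> //.
  by apply: nz_ideal_scale.
by rewrite scale_mul -ideal_expS -Dsc DE.
Qed.

Lemma ideal_mul_sub_cancel A I J : nz_ideal k A -> is_submodule k I -> is_submodule k J ->
  A ** I `<=` A ** J -> I `<=` J.
Proof.
move=> nA sI sJ AIJ; have [a [B [Oa a0 nB AB]]] := ideal_inv nA.
apply: (scaleS_inj a0).
rewrite -(mul1_ideal kF sI) -(mul1_ideal kF sJ) -!mul_scale -AB.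
by rewrite !(ideal_mulC k A) -!ideal_mulA; apply: ideal_mulS.
Qed.

Lemma ideal_mul_cancel A I J : nz_ideal k A -> is_submodule k I -> is_submodule k J ->
  A ** I = A ** J -> I = J.
Proof.
move=> nA sI sJ /seteqP[IJ JI]; rewrite eqEsubset.
by split; apply: (@ideal_mul_sub_cancel A).
Qed.

(** The quotient is a^-1 B I, where A B = (a). *)
Lemma ideal_sub_dvd A I : nz_ideal k A -> is_submodule k I -> I `<=` A ->
  exists2 J, is_ideal k J & I = A ** J.
Proof.
move=> nA sI IA; have [a [B [Oa a0 nB AB]]] := ideal_inv nA.
pose J := [set x | (B ** I) (a * x)].
have BIO : B ** I `<=` scale a O.
  by rewrite -AB ideal_mulC; apply: ideal_mulS.
have sBI := ideal_mul_submodule k B I.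
have aJ : scale a J = B ** I.
  rewrite eqEsubset; split=> [_ [x Jx <-] //|x BIx].
  by have [y Oy e] := BIO x BIx; exists y => //; rewrite /J /= e.
exists J.
  split; last by move=> x Jx; have [y Oy /(mulfI a0) <-] := BIO _ Jx.
  split=> [|x y Jx Jy|u x Ou Jx]; rewrite /J /=.
  - by rewrite mulr0; exact: (sub0 sBI).
  - by rewrite mulrDr; exact: (subD sBI).
  - by rewrite mulrCA; exact: (subM sBI).
apply: (scale_inj a0); rewrite -scale_mul aJ ideal_mulA AB mul_scale.
by rewrite (mul1_ideal kF).
Qed.

Lemma prime_nz P : is_prime k P -> nz_ideal k P.
Proof. by move=> [iP P0 _ _]; apply/nz_idealP. Qed.

Lemma prime_mul_sub P I J : is_prime k P -> I `<=` O -> J `<=` O ->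
  I ** J `<=` P -> I `<=` P \/ J `<=` P.
Proof.
move=> [_ _ _ pP] IO JO IJP; have [|H] := pselect (I `<=` P); [by left | right].
move=> y Jy; apply: contrapT => nPy; apply: H => x Ix.
have [||/nPy] //= := pP x y (IO _ Ix) (JO _ Jy).
by apply: IJP; apply: mem_ideal_mul.
Qed.

Lemma prime_not1 P : is_prime k P -> ~ P 1.
Proof. by move=> [iP _ PO _] P1; apply: PO; apply: (ideal1_eq). Qed.

(** Containing is dividing, so P = I J. If [J] is contained in [P], then [P] is contained in P I,
    and the determinant trick puts 1 in [I]. *)
Lemma prime_maximal P I : is_prime k P -> is_ideal k I -> P `<=` I -> I = P \/ I = O.
Proof.
move=> pP iI PI; have nP := prime_nz pP; have sP := nz_ideal_submodule nP.
have nI : nz_ideal k I.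
  by split=> //; have [_ [x Px x0]] := nP; exists x => //; apply: PI.
have [J iJ e] := ideal_sub_dvd nI sP PI.
have [|IP|JP] := prime_mul_sub pP (nz_ideal_sub nI) iJ.2; rewrite -?e //.
  by left; rewrite eqEsubset.
right; apply: (ideal1_eq iI); apply: (nakayama kN nP iI).
by rewrite {1}e ideal_mulC; apply: ideal_mulS.
Qed.

Lemma is_ideal_prod s : {in s, forall A, is_ideal k A} -> is_ideal k (ideal_prod k s).
Proof.
elim: s => [|B t IHt] tP /=; first exact: (integers_ideal kF).
apply: (is_ideal_mul kF); first by apply: tP; rewrite mem_head.
by apply: IHt => C tC; apply: tP; rewrite in_cons tC orbT.
Qed.

Lemma ideal_prod_sub_prime P s : is_prime k P -> {in s, forall A, is_ideal k A} ->
  ideal_prod k s `<=` P -> exists2 A, A \in s & A `<=` P.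
Proof.
move=> pP; elim: s => [|A s IH] sP /=; first by move=> /(_ 1 (oi1 kF)) /(prime_not1 pP).
have iA : is_ideal k A by apply: sP; rewrite mem_head.
have sP' : {in s, forall A, is_ideal k A}.
  by move=> B sB; apply: sP; rewrite in_cons sB orbT.
have isP := is_ideal_prod sP'.
move=> /(prime_mul_sub pP iA.2 isP.2)[AP|/(IH sP')[B sB BP]].
  by exists A; rewrite ?mem_head.
by exists B; rewrite ?in_cons ?sB ?orbT.
Qed.

End Invertibility.

Lemma count_ltn T (a b : pred T) s : subpred a b -> has (predD b a) s ->
  (count a s < count b s)%N.
Proof.
move=> ab; elim: s => [|x s IH] //=; rewrite -addnS.
case/orP => [/andP[/negPf -> ->]|/IH lt].
  by rewrite add0n add1n ltnS sub_count.
by rewrite leq_add //; case: (a x) (ab x) => // ->.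
Qed.

(** * Factorization into primes and valuations *)

Section Factorization.
Variables (k : set algC) (n : nat).
Hypothesis kN : is_nf n k.
Let kF : is_subfield k. Proof. by case: kN. Qed.
Local Notation O := (integers k).
Local Notation "I ** J" := (ideal_mul k I J) (at level 40, left associativity).
Implicit Types (I J A B P Q : set algC).

(** Noetherian induction, measured by the number of representatives modulo N in the ideal. If x y
    lies in [I] but neither factor does, [I] is divisible by A = I + (x), which is proper because
    [y] is not in [I]. The cofactor [J] is strictly larger than [I] too, since I = A I would put 1
    in [A]. *)
Lemma exists_factorization I : nz_ideal k I ->
  exists2 s, {in s, forall P, is_prime k P} & I = ideal_prod k s.
Proof.
move=> nI; have [N N0 IN] := nz_ideal_int kN nI.
have sN := add_subgroup_submodule kF (scale_submodule N%:R (integers_submodule kF)).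
have [r [Ur rO rP _]] := exists_transversal kN N0 (@subset_refl _ O) sN (@subset_refl _ _).
pose c A := count (fun x => `[< A x >]) r.
have lt_c A B x : is_ideal k A -> is_ideal k B -> A N%:R -> A `<=` B -> B x -> ~ A x ->
    (c A < c B)%N.
  move=> [sA AO] [sB BO] AN AB Bx nAx; apply: count_ltn.
    by move=> y /asboolP Ay; apply/asboolP/AB.
  have [y ry [w Ow xy]] := rP x (BO _ Bx).
  have Axy : A (x - y) by rewrite -xy mulrC; apply: (subM sA).
  apply/hasP; exists y => //=; apply/andP; split.
    by apply/asboolPn => Ay; apply: nAx; rewrite -(subrK y x); apply: (subD sA).
  by apply/asboolP; rewrite -(subKr x y); apply: (subB kF sB) => //; apply: AB.
have cO A : (c A <= size r)%N by apply: count_size.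
have [m] : exists m, (size r - c I < m)%N by exists (size r - c I).+1.
elim: m I nI IN => [|m IH] I nI IN // lt_m.
have iI := nI.1; have [sI IO] := iI.
have [IeO|IneO] := pselect (I = O).
  by exists [::].
have [pI|npI] := pselect (is_prime k I).
  exists [:: I]; last by rewrite /= (mul_ideal1 kF).
  by move=> P; rewrite inE => /eqP ->.
have [x [y [Ox Oy Ixy [nIx nIy]]]] : exists x y, [/\ O x, O y, I (x * y) & ~ I x /\ ~ I y].
  apply: contrapT => H; apply: npI; split=> //; first by case/nz_idealP: nI.
  move=> x y Ox Oy Ixy; apply: contrapT => H2; apply: H; exists x, y.
  by split=> //; split=> ?; apply: H2; [left | right].
pose A := module_span k (I `|` [set x]).
have sA : is_submodule k A := module_span_submodule _ _.
have IA : I `<=` A by move=> z Iz; apply: module_span_gen; left.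
have Ax : A x by apply: module_span_gen; right.
have iA : is_ideal k A.
  split=> //; apply: module_span_min; first exact: (integers_submodule kF).
  by move=> z [/IO|->].
have nA : nz_ideal k A.
  by split=> //; have [_ [z Iz z0]] := nI; exists z => //; apply: IA.
have [J iJ e] := ideal_sub_dvd kN nA sI IA.
have nA1 : ~ A 1.
  move=> A1; apply: nIy; rewrite -[y]mul1r.
  suff : A `<=` [set z | I (z * y)] by apply.
  apply: module_span_min.
    split=> [|u v Iu Iv|u v Ou Iv] /=; first by rewrite mul0r; exact: (sub0 sI).
      by rewrite mulrDl; exact: (subD sI).
    by rewrite -mulrA; exact: (subM sI).
  by move=> z [Iz|->] //=; rewrite mulrC; apply: (subM sI).
have IJ : I `<=` J by rewrite e ideal_mulC; apply: ideal_mul_subl iJ.1 iA.2.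
have [z Jz nIz] : exists2 z, J z & ~ I z.
  apply: contrapT => H; apply: nA1; apply: (nakayama kN nI iA).
  have {1}-> : I = J.
    rewrite eqEsubset; split=> // z Jz; apply: contrapT => nIz.
    by apply: H; exists z.
  have -> : I = J.
    rewrite eqEsubset; split=> // z Jz; apply: contrapT => nIz.
    by apply: H; exists z.
  have JI : I = J.
    rewrite eqEsubset; split=> // z Jz; apply: contrapT => nIz.
    by apply: H; exists z.
  by rewrite ideal_mulC -e JI.
have nJ : nz_ideal k J.
  by split=> //; have [_ [u Iu u0]] := nI; exists u => //; apply: IJ.
have lt_A : (size r - c A < m)%N.
  by have := lt_c I A x iI iA IN IA Ax nIx; have := cO A; lia.
have lt_J : (size r - c J < m)%N.
  by have := lt_c I J z iI iJ IN IJ Jz nIz; have := cO J; lia.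
have [s sP es] := IH A nA (IA _ IN) lt_A.
have [t tP et] := IH J nJ (IJ _ IN) lt_J.
exists (s ++ t); last by rewrite (ideal_prod_cat kF) -es -et.
by move=> P; rewrite mem_cat => /orP[/sP|/tP].
Qed.

(** After cancelling the factors equal to [P], an excess in [m] would put the product of the
    remaining primes inside [P], and by maximality one of these would be [P]. *)
Lemma prime_ideal_prod (s : seq (set algC)) P m : {in s, forall Q, is_prime k Q} -> is_prime k P ->
  ideal_prod k s `<=` ideal_exp k P m <-> (m <= count_mem P s)%N.
Proof.
move=> sP pP; have nP := prime_nz pP; have iP := nP.1.
pose t := seq.filter (predC (pred1 P)) s.
have e : ideal_prod k s = ideal_exp k P (count_mem P s) ** ideal_prod k t.
  rewrite -(ideal_prod_cat kF); apply: perm_ideal_prod.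
  have -> : nseq (count_mem P s) P = seq.filter (pred1 P) s.
    by rewrite -size_filter; apply/esym/all_pred1P/filter_all.
  by rewrite perm_sym (perm_filterC (pred1 P) s).
have tP : {in t, forall Q, is_prime k Q}.
  by move=> Q; rewrite mem_filter => /andP[_ /sP].
have nt : nz_ideal k (ideal_prod k t).
  by apply: (nz_ideal_prod kF) => Q /tP /prime_nz.
have nPm i : nz_ideal k (ideal_exp k P i) by apply: (nz_ideal_exp kF).
rewrite e; split=> [|le_m]; last first.
  apply: subset_trans (ideal_exp_sub kF iP le_m).
  by apply: ideal_mul_subl (nz_ideal_submodule (nPm _)) (nz_ideal_sub nt).
move=> sub; rewrite leqNgt; apply/negP => lt_m; move: sub.
have -> : m = (count_mem P s + (m - count_mem P s))%N by rewrite subnKC // ltnW.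
rewrite (ideal_expD kF).
move=> /(ideal_mul_sub_cancel kN (nPm _) (nz_ideal_submodule nt)
          (nz_ideal_submodule (nPm _))).
move: (m - _)%N (subn_gt0 (count_mem P s) m); rewrite lt_m => -[//|i _] sub.
have [|Q tQ QP] := ideal_prod_sub_prime kN pP (fun Q tQ => (prime_nz (tP Q tQ)).1).
  apply: subset_trans sub _; rewrite ideal_expS.
  by apply: ideal_mul_subl (nz_ideal_submodule nP) (nz_ideal_sub (nPm _)).
have [/esym eQ|eQ] := prime_maximal kN (tP _ tQ) iP QP.
  by move: tQ; rewrite mem_filter /= eQ eqxx.
by have [_ _ /(_ eQ)] := pP.
Qed.

(** A chosen factorization, empty by default. Multiplicities do not depend on the choice, as they
    are read off the powers of [P] that contain the ideal. *)
Definition factors I : seq (set algC) :=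
  xget [::] [set s : seq (set algC) | {in s, forall P, is_prime k P} /\ I = ideal_prod k s].

Lemma factorsP I : nz_ideal k I ->
  {in factors I, forall P, is_prime k P} /\ I = ideal_prod k (factors I).
Proof.
move=> /exists_factorization[s sP e]; rewrite /factors.
by case: xgetP => [t -> //|/(_ s)]; case.
Qed.

Definition ideal_val P I : nat := count_mem P (factors I).

Lemma ideal_valP P I m : is_prime k P -> nz_ideal k I ->
  I `<=` ideal_exp k P m <-> (m <= ideal_val P I)%N.
Proof.
by move=> pP nI; have [fP e] := factorsP nI; rewrite {1}e; apply: prime_ideal_prod.
Qed.

Lemma ideal_val_prod P (s : seq (set algC)) : is_prime k P -> {in s, forall Q, is_prime k Q} ->
  ideal_val P (ideal_prod k s) = count_mem P s.
Proof.
move=> pP sP; have ns : nz_ideal k (ideal_prod k s).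
  by apply: (nz_ideal_prod kF) => Q /sP /prime_nz.
apply/eqP; rewrite eqn_leq; apply/andP; split.
  by apply/(prime_ideal_prod _ sP pP)/ideal_valP.
by apply/ideal_valP => //; apply/prime_ideal_prod.
Qed.

Lemma ideal_valM P I J : is_prime k P -> nz_ideal k I -> nz_ideal k J ->
  ideal_val P (I ** J) = (ideal_val P I + ideal_val P J)%N.
Proof.
move=> pP nI nJ; have [sP eI] := factorsP nI; have [tP eJ] := factorsP nJ.
rewrite {1}eI {1}eJ -(ideal_prod_cat kF) ideal_val_prod ?count_cat // => Q.
by rewrite mem_cat => /orP[/sP|/tP].
Qed.

Definition elt_val P x := ideal_val P (scale x O).

Lemma nz_principal x : O x -> x != 0 -> nz_ideal k (scale x O).
Proof. by move=> Ox x0; apply: (nz_ideal_scale kF) => //; apply: (nz_ideal_integers kF). Qed.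

Lemma elt_valP P x m : is_prime k P -> O x -> x != 0 ->
  ideal_exp k P m x <-> (m <= elt_val P x)%N.
Proof.
move=> pP Ox x0; have sPm := ideal_prod_submodule kF (nseq m P).
split=> [Px|/(ideal_valP _ pP (nz_principal Ox x0)) sub].
  by apply/(ideal_valP _ pP (nz_principal Ox x0))/(scale_sub_ideal sPm).
by apply: sub; exists 1; rewrite ?mulr1 //; apply: (oi1 kF).
Qed.

Lemma elt_valM P x y : is_prime k P -> O x -> x != 0 -> O y -> y != 0 ->
  elt_val P (x * y) = (elt_val P x + elt_val P y)%N.
Proof.
move=> pP Ox x0 Oy y0; rewrite -ideal_valM; try exact: nz_principal; last by [].
by rewrite mul_scale (mul1_ideal kF) ?scaleA //; apply/scale_submodule/(integers_submodule kF).
Qed.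

Lemma elt_valX P x i : is_prime k P -> O x -> x != 0 ->
  elt_val P (x ^+ i) = (i * elt_val P x)%N.
Proof.
move=> pP Ox x0; elim: i => [|i IH].
  rewrite expr0 mul0n /elt_val scale1 -[integers k]/(ideal_prod k [::]).
  by rewrite ideal_val_prod.
by rewrite exprS elt_valM ?expf_neq0 ?IH // ; apply: (oiX kF).
Qed.

Lemma elt_val_eq0 P x : is_prime k P -> O x -> x != 0 ->
  elt_val P x = 0%N <-> ~ P x.
Proof.
move=> pP Ox x0; have := @elt_valP P x 1 pP Ox x0.
rewrite (ideal_exp1 kF (nz_ideal_submodule (prime_nz pP))).
case: elt_val => [|v] H; split=> //; first by move=> _ /H.
by case; apply/H.
Qed.

Lemma prime_exists_char P : is_prime k P -> exists2 p, prime p & P p%:R.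
Proof.
move=> pP; have [N N0 PN] := nz_ideal_int kN (prime_nz pP).
have [m] : exists m, (N < m)%N by exists N.+1.
elim: m N N0 PN => [|m IH] N N0 PN // ltN.
have [N1|N1] := leqP N 1.
  by case: (prime_not1 pP); move: PN; rewrite (_ : N = 1%N) //; lia.
have pN := pdiv_prime N1.
have [_ _ _ primeP] := pP.
have := primeP (pdiv N)%:R (N %/ pdiv N)%:R (oinat kF _) (oinat kF _).
rewrite -natrM mulnC divnK ?pdiv_dvd // => /(_ PN)[PpN|PN']; first by exists (pdiv N).
apply: (IH (N %/ pdiv N)%N) => //; first by rewrite divn_gt0 ?prime_gt0 // dvdn_leq // pdiv_dvd.
by rewrite -ltnS; apply: leq_ltn_trans ltN; rewrite ltn_Pdiv // prime_gt1.
Qed.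

Lemma prime_char_dvd P p (c : int) : is_prime k P -> prime p -> P p%:R -> P c%:~R ->
  (p %| c)%Z.
Proof.
move=> pP pp Pp Pc; have sP := nz_ideal_submodule (prime_nz pP).
apply: contraT => npc; case: (prime_not1 pP).
have : coprimez p c by rewrite /coprimez /gcdz /= eqz_nat -/(coprime _ _) prime_coprime.
case/coprimezP => -[u v] /= e.
have := congr1 (fun z : int => z%:~R : algC) e.
rewrite rmorphD !rmorphM /= mulr1z => <-.
by apply: (subD sP); apply: (subM sP) => //; apply: (oiint kF).
Qed.

(* [0] if no rational prime belongs to [P]. *)
Definition residue_char P : nat := xget 0%N [set p | prime p /\ P p%:R].

Lemma residue_charP P : is_prime k P -> prime (residue_char P) /\ P (residue_char P)%:R.
Proof.
move=> /prime_exists_char[p pp Pp]; rewrite /residue_char.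
by case: xgetP => [q -> //|/(_ p)]; case.
Qed.

Lemma residue_char_unique P p : is_prime k P -> prime p -> P p%:R -> residue_char P = p.
Proof.
move=> pP pp Pp; have [pq Pq] := residue_charP pP.
have := @prime_char_dvd P p (residue_char P) pP pp Pp Pq.
by rewrite dvdzE /= dvdn_prime2 // => /eqP.
Qed.

(** Given n + 1 primes P_i, choose x_i outside P_i but in all the others. In an integer relation
    between the x_i with some coefficient c_i prime to p, all terms but c_i x_i lie in P_i; so P_i
    contains c_i or x_i, which is impossible. *)
Lemma primes_over_count p (s : seq (set algC)) : prime p -> uniq s ->
  {in s, forall P, is_prime k P /\ P p%:R} -> (size s <= n)%N.
Proof.
move=> pp Us sP; rewrite leqNgt; apply/negP => lt_n.
pose P (i : 'I_n.+1) := nth set0 s i.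
have iS (i : 'I_n.+1) : (i < size s)%N by apply: leq_trans (ltn_ord i) lt_n.
have PP i : is_prime k (P i) /\ P i p%:R by apply/sP/mem_nth/iS.
have /choice[y yP] : forall ij : 'I_n.+1 * 'I_n.+1, exists y, O y /\
    (ij.1 != ij.2 -> P ij.2 y /\ ~ P ij.1 y).
  move=> [i j] /=; have [->|ne] := eqVneq i j; first by exists 0; split=> //; apply: (oi0 kF).
  have [y Py nPy] : exists2 y, P j y & ~ P i y.
    apply: contrapT => H; move/eqP: ne; apply; apply/val_inj/eqP.
    rewrite -(nth_uniq set0 (iS i) (iS j) Us); apply/eqP.
    have sub : P j `<=` P i.
      by move=> z Pz; apply: contrapT => nPz; apply: H; exists z.
    have [//|eO] := prime_maximal kN (PP j).1 (prime_nz (PP i).1).1 sub.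
    by have [[_ _ /(_ eO)]] := PP i.
  by exists y; split=> //; apply: nz_ideal_sub (prime_nz (PP j).1) _ Py.
pose x i := \prod_(j | j != i) y (i, j).
have Ox i : O (x i) by apply: (oiprod kF) => j _; have [] := yP (i, j).
have Px i j : i != j -> P j (x i).
  move=> ij; rewrite /x (bigD1 j) 1?eq_sym //= mulrC.
  apply: (subM (nz_ideal_submodule (prime_nz (PP j).1))).
    by apply: (oiprod kF) => h _; have [] := yP (i, h).
  by have [_ /(_ ij)[]] := yP (i, j).
have nPx i : ~ P i (x i).
  suff [] : O (x i) /\ ~ P i (x i) by [].
  apply: (big_ind (fun z => O z /\ ~ P i z)) => [|a b [Oa na] [Ob nb]|j ji].
  - by split; [exact: (oi1 kF) | exact: prime_not1 (PP i).1].
  - split; first exact: (oiM kF).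
    by have [[_ _ _ pr] _] := PP i => /(pr _ _ Oa Ob)[].
  - have [Oy H] := yP (i, j); split=> //.
    by have [|] := H; rewrite // eq_sym.
have [c [c0 [i nci]]] := int_relation kN pp (fun i => (Ox i).1).
have [pPi Pip] := PP i; have sPi := nz_ideal_submodule (prime_nz pPi).
have Pc : P i ((c i)%:~R * x i).
  move: c0; rewrite (bigD1 i) //= => /eqP; rewrite addr_eq0 => /eqP ->.
  apply: (subN kF sPi); apply: (big_ind (P i)) => [|a b|j ji].
  - exact: (sub0 sPi).
  - exact: (subD sPi).
  - by apply: (subM sPi); [exact: (oiint kF) | exact: Px].
have [_ _ _ pr] := pPi.
have [/(prime_char_dvd pPi pp Pip)|/nPx //] := pr _ _ (oiint kF _) (Ox i) Pc.
by apply/negP.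
Qed.

End Factorization.

Lemma add_coset_eq (H : set algC) x y : is_subgroup_add H ->
  Defs.coset +%R H x = Defs.coset +%R H y <-> H (x - y).
Proof.
move=> sH; split=> [e|Hxy].
  have : Defs.coset +%R H x x by exists 0; rewrite ?addr0 //; case: sH.
  by rewrite e => -[h Hh <-]; rewrite addrC addKr.
have sub u v : H (u - v) -> Defs.coset +%R H u `<=` Defs.coset +%R H v.
  move=> Huv _ [h Hh <-]; exists (u - v + h); first exact: add_subgroup_add.
  by rewrite addrA addrCA subrr addr0.
rewrite eqEsubset; split; apply: sub => //.
by rewrite -opprB; apply: add_subgroup_opp.
Qed.

Lemma card_add_quotient (G H : set algC) r : is_subgroup_add H ->
  is_transversal_add G H r -> #|` fset_set (quotient +%R G H)| = size r.
Proof.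
move=> sH [Ur rG rP rH].
have -> : quotient +%R G H =
    [set` [fset Defs.coset +%R H x | x in [fset y | y in r]]%fset].
  rewrite eqEsubset; split=> [_ [x Gx <-]|A].
    have [y ry Hxy] := rP x Gx; apply/imfsetP; exists y; first by rewrite !inE.
    exact/add_coset_eq.
  by move=> /imfsetP[y]; rewrite !inE => ry ->; exists y => //; apply: rG.
rewrite set_fsetK card_in_imfset.
  by rewrite card_fseq undup_id.
move=> x y; rewrite !inE => rx ry /(add_coset_eq _ _ sH); exact: rH.
Qed.

Lemma transversal_mul (G H K : set algC) r s : is_subgroup_add G ->
  is_subgroup_add H -> is_subgroup_add K -> H `<=` G -> K `<=` H ->
  is_transversal_add G H r -> is_transversal_add H K s ->
  is_transversal_add G K [seq x + y | x <- r, y <- s].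
Proof.
move=> sG sH sK HG KH [Ur rG rP rH] [Us sH' sP sK'].
have key x y x' y' : x \in r -> y \in s -> x' \in r -> y' \in s ->
    K ((x + y) - (x' + y')) -> x = x' /\ y = y'.
  move=> rx sy rx' sy' Kd; have xx' : x = x'.
    apply: rH => //; rewrite (_ : x - x' = (x + y - (x' + y')) + (y' - y)); last by ring.
    by apply: (add_subgroup_add sH); [apply: KH | apply: sH.2; apply: sH'].
  split=> //; apply: sK' => //; have <- : x + y - (x' + y') = y - y' by rewrite xx'; ring.
  exact: Kd.
split.
- apply: allpairs_uniq => // -[x y] [x' y'] /allpairsP[[a b] [/= ra sb [-> ->]]].
  move=> /allpairsP[[a' b'] [/= ra' sb' [-> ->]]] /= e.
  by have [|-> ->] := key a b a' b' ra sb ra' sb'; rewrite ?e ?subrr //; case: sK.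
- move=> _ /allpairsP[[x y] [/= rx sy ->]]; apply: (add_subgroup_add sG); first exact: rG.
  by apply/HG/sH'.
- move=> z Gz; have [x rx Hzx] := rP z Gz; have [y sy Kd] := sP _ Hzx.
  exists (x + y); first by apply/allpairsP; exists (x, y).
  by rewrite opprD addrA.
- move=> _ _ /allpairsP[[x y] [/= rx sy ->]] /allpairsP[[x' y'] [/= rx' sy' ->]].
  by move=> /(key _ _ _ _ rx sy rx' sy')[-> ->].
Qed.

(** * Ideal norms *)

Section Norms.
Variables (k : set algC) (n : nat).
Hypothesis kN : is_nf n k.
Let kF : is_subfield k. Proof. by case: kN. Qed.
Local Notation O := (integers k).
Local Notation "I ** J" := (ideal_mul k I J) (at level 40, left associativity).
Implicit Types (I J A B P Q : set algC).

Let addO : is_subgroup_add O.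
Proof. exact: add_subgroup_submodule (integers_submodule kF). Qed.

Lemma ideal_add_subgroup I : nz_ideal k I -> is_subgroup_add I.
Proof. by move=> [[sI _] _]; apply: (add_subgroup_submodule kF). Qed.

Lemma ideal_transversal (G : set algC) I : nz_ideal k I -> G `<=` O ->
  exists r, is_transversal_add G I r.
Proof.
move=> nI GO; have [N N0 IN] := nz_ideal_int kN nI.
apply: (exists_transversal kN N0 GO (ideal_add_subgroup nI)).
by apply: scale_sub_ideal => //; apply: nz_ideal_submodule.
Qed.

Lemma ideal_normE I r : nz_ideal k I -> is_transversal_add O I r ->
  ideal_norm k I = size r.
Proof. by move=> nI; apply: card_add_quotient; apply: ideal_add_subgroup. Qed.

Lemma ideal_norm_gt0 I : nz_ideal k I -> (0 < ideal_norm k I)%N.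
Proof.
move=> nI; have [r tr] := ideal_transversal nI (@subset_refl _ O).
rewrite (ideal_normE nI tr); case: tr => _ _ /(_ 0 (oi0 kF))[y ry _] _.
by rewrite -has_predT; apply/hasP; exists y.
Qed.

(* Multiplication by an element of [I] outside [I ** P] induces an isomorphism
   of [O / P] onto [I / (I ** P)]. *)
Lemma ideal_norm_mul_prime I P : nz_ideal k I -> is_prime k P ->
  ideal_norm k (I ** P) = (ideal_norm k I * ideal_norm k P)%N.
Proof.
move=> nI pP; have nP := prime_nz pP; have nIP := nz_ideal_mul kF nI nP.
have [sI IO] := nI.1; have [sP PO] := nP.1; have sIP := nz_ideal_submodule nIP.
have IPI : I ** P `<=` I by apply: ideal_mul_subl.
have [a Ia nIPa] : exists2 a, I a & ~ (I ** P) a.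
  apply: contrapT => H; apply: (prime_not1 pP); apply: (nakayama kN nI nP.1).
  by move=> x Ix; apply: contrapT => nx; apply: H; exists x.
have a0 : a != 0 by apply: contra_notN nIPa => /eqP ->; apply: sub0 sIP.
have aP x : O x -> (I ** P) (a * x) <-> P x.
  move=> Ox; split=> [IPax|Px]; last exact: mem_ideal_mul.
  apply: contrapT => nPx.
  pose C := [set y | O y /\ (I ** P) (a * y)].
  have iC : is_ideal k C.
    split=> [|y []//]; split=> [|u v [Ou Cu] [Ov Cv]|u v Ou [Ov Cv]].
    - by split; [exact: (oi0 kF) | rewrite mulr0; exact: sub0 sIP].
    - by split; [exact: (oiD kF) | rewrite mulrDr; exact: (subD sIP)].
    - by split; [exact: (oiM kF) | rewrite mulrCA; exact: (subM sIP)].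
  have PC : P `<=` C by move=> y Py; split; [exact: PO | exact: mem_ideal_mul].
  have [eC|eC] := prime_maximal kN pP iC PC; first by apply: nPx; rewrite -eC.
  have : C 1 by rewrite eC; exact: (oi1 kF).
  by case=> _; rewrite mulr1.
have [r tr] := ideal_transversal nI (@subset_refl _ O).
have [s ts] := ideal_transversal nP (@subset_refl _ O).
have [Us sO sQ sD] := ts.
suff ts' : is_transversal_add I (I ** P) [seq a * x | x <- s].
  rewrite (ideal_normE nI tr) (ideal_normE nP ts).
  rewrite (ideal_normE nIP (transversal_mul addO (ideal_add_subgroup nI)
    (ideal_add_subgroup nIP) IO IPI tr ts')).
  by rewrite size_allpairs size_map.
split.
- by rewrite map_inj_uniq //; apply: mulfI.
- by move=> _ /mapP[x sx ->]; rewrite mulrC; apply: (subM sI) => //; apply: sO.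
- move=> z Iz.
  (* This ideal, I P + (a), lies between I P and I and is not I P; by maximality of [P] it is I, so
     that multiples of [a] reach every class. *)
  pose J := [set z | exists2 x, O x & (I ** P) (z - a * x)].
  have sJ : is_submodule k J.
    split=> [|u v [x Ox e] [y Oy f]|u v Ou [x Ox e]].
    - by exists 0; rewrite ?mulr0 ?subr0; [exact: (oi0 kF) | exact: sub0 sIP].
    - exists (x + y); first exact: (oiD kF).
      by rewrite mulrDr opprD addrACA; apply: (subD sIP).
    - exists (u * x); first exact: (oiM kF).
      by rewrite mulrCA -mulrBr; apply: (subM sIP).
  have JI : J `<=` I.
    move=> u [x Ox e]; rewrite -(subrK (a * x) u); apply: (subD sI); first exact: IPI.
    by rewrite mulrC; apply: (subM sI).
  have IPJ : I ** P `<=` J.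
    by move=> u IPu; exists 0; rewrite ?mulr0 ?subr0 //; exact: (oi0 kF).
  have Ja : J a by exists 1; rewrite ?mulr1 ?subrr; [exact: (oi1 kF) | exact: sub0 sIP].
  have [D iD eJ] := ideal_sub_dvd kN nI sJ JI.
  have PD : P `<=` D.
    apply: (ideal_mul_sub_cancel kN nI sP iD.1); rewrite -eJ //.
  have [eD|eD] := prime_maximal kN pP iD PD.
    by case: nIPa; rewrite -eD -eJ.
  have [x Ox e] : J z by rewrite eJ eD (mul_ideal1 kF).
  have [y sy Pxy] := sQ x Ox; exists (a * y); first by apply/mapP; exists y.
  rewrite (_ : z - a * y = (z - a * x) + a * (x - y)); last by ring.
  by apply: (subD sIP) => //; apply: mem_ideal_mul.
- move=> _ _ /mapP[x sx ->] /mapP[y sy ->]; rewrite -mulrBr => h.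
  congr (_ * _); apply: sD => //; apply/aP => //.
  by apply: (oiB kF); apply: sO.
Qed.

Lemma ideal_norm_integers : ideal_norm k O = 1%N.
Proof.
rewrite (@ideal_normE O [:: 0]) //; first exact: (nz_ideal_integers kF).
split=> // [x|x Ox|x y]; rewrite ?inE.
- by move=> /eqP ->; exact: (oi0 kF).
- by exists 0; rewrite ?inE ?subr0.
- by move=> /eqP -> /eqP ->.
Qed.

Lemma ideal_norm_prod (s : seq (set algC)) : {in s, forall P, is_prime k P} ->
  ideal_norm k (ideal_prod k s) = \prod_(P <- s) ideal_norm k P.
Proof.
elim: s => [|P s IH] sP; first by rewrite big_nil ideal_norm_integers.
have sP' : {in s, forall P, is_prime k P}.
  by move=> Q sQ; apply: sP; rewrite in_cons sQ orbT.
rewrite big_cons /= ideal_mulC ideal_norm_mul_prime ?IH 1?mulnC //.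
  by apply: (nz_ideal_prod kF) => Q /sP' /prime_nz.
by apply: sP; rewrite mem_head.
Qed.

(* Enlarging [H] by a cyclic group multiplies it by [p], until it is [O]. *)
Lemma transversal_p_power p (H : set algC) r : prime p -> is_subgroup_add H ->
  H `<=` O -> scale p%:R O `<=` H -> is_transversal_add O H r ->
  exists j, size r = (p ^ j)%N.
Proof.
move=> pp; have [m] : exists m, (size r < m)%N by exists (size r).+1.
elim: m H r => [|m IH] H r // lt_m sH HO pH tr.
have [H0 HB] := sH.
have [eH|[x Ox nHx]] : (O `<=` H) \/ exists2 x, O x & ~ H x.
  have [|H1] := pselect (O `<=` H); [by left | right].
  by apply: contrapT => H2; apply: H1 => x Ox; apply: contrapT => nHx; apply: H2; exists x.
  exists 0%N; rewrite -(card_add_quotient sH tr).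
  rewrite (card_add_quotient (r := [:: 0]) sH) //.
  split=> // [z|z Oz|z w]; rewrite ?inE.
  - by move=> /eqP ->; exact: (oi0 kF).
  - by exists 0; rewrite ?inE ?subr0 //; apply: eH.
  - by move=> /eqP -> /eqP ->.
pose H' := [set z | exists c : int, H (z - c%:~R * x)].
have sH' : is_subgroup_add H'.
  split; first by exists 0; rewrite mulr0z mul0r subr0.
  move=> u v [c Hc] [e He]; exists (c - e).
  by rewrite (_ : _ - _ = (u - c%:~R * x) - (v - e%:~R * x)) ?rmorphB; [exact: HB | ring].
have HH' : H `<=` H' by move=> z Hz; exists 0; rewrite mulr0z mul0r subr0.
have H'O : H' `<=` O.
  move=> z [c Hc]; rewrite -(subrK (c%:~R * x) z).
  by apply: (oiD kF); [exact: HO | apply: (oiM kF) => //; exact: (oiint kF)].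
have pH' : scale p%:R O `<=` H' by apply: subset_trans HH'.
have Hint (c : int) : H (c%:~R * x) -> (p %| c)%Z.
  move=> Hc; apply: contraT => npc; case: nHx.
  have : coprimez p c by rewrite /coprimez /gcdz /= eqz_nat -/(coprime _ _) prime_coprime.
  case/coprimezP => -[u v] /= e.
  have := congr1 (fun z : int => z%:~R : algC) e; rewrite rmorphD !rmorphM /= mulr1z => e1.
  have Hmul (a : int) z : H z -> H (a%:~R * z).
    move=> Hz; have Hn (b : nat) : H (b%:R * z).
      elim: b => [|b IHb]; first by rewrite mul0r.
      by rewrite -addn1 natrD mulrDl mul1r; apply: add_subgroup_add.
    case: a => b; first exact: Hn.
    by rewrite NegzE rmorphN mulNr; apply: (add_subgroup_opp sH); apply: Hn.
  rewrite -[x]mul1r -e1 mulrDl; apply: (add_subgroup_add sH); last first.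
    by rewrite -mulrA; apply: Hmul.
  rewrite -mulrA; apply: Hmul; apply: pH; by exists x.
have [N N0 HN] : exists2 N : nat, (0 < N)%N & scale N%:R O `<=` H.
  by exists p; first exact: prime_gt0.
have [r' tr'] := exists_transversal kN N0 (@subset_refl _ O) sH' (subset_trans HN HH').
pose s : seq algC := [seq c%:R * x | c <- iota 0 p].
have x0 : x != 0 by apply: contra_notN nHx => /eqP ->.
have ts : is_transversal_add H' H s.
  split.
  - rewrite map_inj_uniq ?iota_uniq // => a b /(mulIf x0) /eqP.
    by rewrite eqr_nat => /eqP.
  - by move=> _ /mapP[c _ ->]; exists c; rewrite subrr.
  - move=> z [c Hc]; have p0 : p%:Z != 0 by rewrite eqz_nat -lt0n prime_gt0.
    have [b Db] : exists b : nat, (c %% p)%Z = b.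
      by have := modz_ge0 c p0; case: (c %% p)%Z => // b _; exists b.
    have bp : (b < p)%N.
      by rewrite -ltz_nat -Db ltz_pmod // ltz_nat prime_gt0.
    exists (b%:R * x); first by apply/mapP; exists b; rewrite ?mem_iota.
    have -> : z - b%:R * x = (z - c%:~R * x) + p%:R * ((c %/ p)%Z%:~R * x).
      have -> : c%:~R = (c %/ p)%Z%:~R * p%:R + b%:R :> algC.
        by rewrite {1}(divz_eq c p) Db rmorphD rmorphM.
      by ring.
    apply: (add_subgroup_add sH) => //; apply: pH.
    by exists ((c %/ p)%Z%:~R * x) => //; apply: (oiM kF) => //; exact: (oiint kF).
  - move=> _ _ /mapP[a ap ->] /mapP[b bp ->]; rewrite -mulrBl => Hab.
    have : H ((a%:Z - b%:Z)%:~R * x) by rewrite rmorphB.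
    move=> /Hint; rewrite -eqz_mod_dvd.
    move: ap bp; rewrite !mem_iota !add0n /= => ap bp.
    by rewrite !modz_nat eqz_nat !modn_small // => /eqP ->.
have e : size r = (size r' * p)%N.
  rewrite -(card_add_quotient sH tr).
  rewrite (card_add_quotient sH (transversal_mul addO sH' sH H'O HH' tr' ts)).
  by rewrite size_allpairs size_map size_iota.
have r'0 : (0 < size r')%N.
  have [_ _ /(_ 0 (oi0 kF))[y ry _] _] := tr'.
  by rewrite -has_predT; apply/hasP; exists y.
have [|j ej] := IH H' r' _ sH' H'O pH' tr'.
  by have := prime_gt1 pp; nia.
by exists j.+1; rewrite e ej expnSr.
Qed.

Lemma ideal_norm_prime P : is_prime k P ->
  exists j, ideal_norm k P = (residue_char P ^ j.+1)%N.
Proof.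
move=> pP; have nP := prime_nz pP; have [pp Pp] := residue_charP kN pP.
have [r tr] := ideal_transversal nP (@subset_refl _ O).
have [j e] : exists j, size r = (residue_char P ^ j)%N.
  apply: (transversal_p_power pp (ideal_add_subgroup nP) (nz_ideal_sub nP) _ tr).
  by apply: scale_sub_ideal => //; apply: nz_ideal_submodule.
(* With exponent 0 there would be a single class, and 1 would lie in [P]. *)
rewrite (ideal_normE nP tr) e; case: j e => [|j] e; last by exists j.
have [_ _ rP rD] := tr; case: (prime_not1 pP).
have [y ry Py] := rP 0 (oi0 kF); have [z rz Pz] := rP 1 (oi1 kF).
have yz : y = z by case: (r) e ry rz => [|u [|v r']] //= _; rewrite !inE => /eqP -> /eqP ->.
rewrite -(subrK z 1); apply: (subD (nz_ideal_submodule nP)) => //.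
by rewrite -yz -[y]opprK; apply: (subN kF (nz_ideal_submodule nP)); rewrite -sub0r.
Qed.

End Norms.

(** * Units and the class group *)

Section Units.
Variables (F : set algC) (d : nat) (theta : algC).
Variables (nu : 'I_d -> {rmorphism algC -> algC}).
Hypothesis G : nf_gen F theta nu.
Let FF : is_subfield F. Proof. by case: G. Qed.
Local Notation O := (integers F).

Definition is_unit_of (k : set algC) (u : algC) : Prop :=
  [/\ u != 0, integers k u & integers k u^-1].
Local Notation U := (is_unit_of F).

Lemma unit_of1 : U 1.
Proof. by split; rewrite ?oner_eq0 ?invr1; [|exact: (oi1 FF)|exact: (oi1 FF)]. Qed.

Lemma unit_ofM u v : U u -> U v -> U (u * v).
Proof.
by move=> [u0 Ou Ou'] [v0 Ov Ov']; split; rewrite ?mulf_neq0 ?invfM //; apply: (oiM FF).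
Qed.

Lemma unit_ofV u : U u -> U u^-1.
Proof. by move=> [u0 Ou Ou']; split; rewrite ?invr_eq0 ?invrK. Qed.

Lemma unit_ofXz u (c : int) : U u -> U (u ^ c).
Proof.
move=> Uu; have Un (m : nat) : U (u ^+ m).
  by elim: m => [|m IH]; [exact: unit_of1 | rewrite exprS; apply: unit_ofM].
by case: c => m; [exact: Un | apply/unit_ofV/Un].
Qed.

Lemma unit_of_prod (I : finType) (P : pred I) (f : I -> algC) :
  (forall i, U (f i)) -> U (\prod_(i | P i) f i).
Proof. by move=> Uf; apply: big_ind => //; [exact: unit_of1 | exact: unit_ofM]. Qed.

Definition is_root_of_unity (w : algC) : Prop := F w /\ exists2 N : nat, (0 < N)%N & w ^+ N = 1.
Local Notation mu := is_root_of_unity.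

Lemma root_of_unity_unit w : mu w -> U w.
Proof.
move=> [Fw [N N0 wN]]; have Aw : w \in Aint.
  by apply: (Aint_unity_root N0); apply/unity_rootP.
have w0 : w != 0 by apply: contra_eqN wN => /eqP ->; rewrite expr0n gtn_eqF // eq_sym oner_eq0.
split=> //; have -> : w^-1 = w ^+ N.-1.
  by apply: (mulfI w0); rewrite mulfV // -exprS prednK.
by apply: (oiX FF).
Qed.

Lemma root_of_unityM w w' : mu w -> mu w' -> mu (w * w').
Proof.
move=> [Fw [N N0 wN]] [Fw' [N' N'0 wN']]; split; first exact: (sfM FF).
exists (N * N')%N; first by rewrite muln_gt0 N0.
by rewrite exprMn exprM wN expr1n mulnC exprM wN' expr1n mul1r.
Qed.

Lemma root_of_unityV w : mu w -> mu w^-1.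
Proof.
by move=> [Fw [N N0 wN]]; split; [exact: (sfV FF) | exists N; rewrite // exprVn wN invr1].
Qed.

Lemma root_of_unity_root w (l : nat) : F w -> (0 < l)%N -> mu (w ^+ l) -> mu w.
Proof.
move=> Fw l0 [_ [N N0 wN]]; split=> //; exists (l * N)%N; first by rewrite muln_gt0 l0.
by rewrite exprM.
Qed.

(** The conjugates of a root of unity have absolute value 1, so [F] contains finitely many, and a
    finite multiplicative group in a field is cyclic. *)
Lemma roots_of_unity_cyclic : exists2 g, mu g & forall w, mu w -> exists i : nat, w = g ^+ i.
Proof.
have [s sP] := bounded_finite G 1.
pose r := undup [seq w <- s | `[< mu w >]].
have rP w : (w \in r) = `[< mu w >].
  rewrite mem_undup mem_filter; apply: andb_idr => /asboolP mw.
  apply: sP; first by have [] := root_of_unity_unit mw.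
  move=> j; have [Fw [N N0 wN]] := mw.
  have : `|nu j w| ^+ N = 1 by rewrite -normrX -rmorphXn wN rmorph1 normr1.
  by move/eqP; rewrite pexpr_eq1 // => /eqP ->.
have Ur : uniq r by apply: undup_uniq.
have m1 : mu 1 by split; [exact: (sf1 FF) | exists 1%N; rewrite ?expr1n].
have N0 : (0 < size r)%N by rewrite -has_predT; apply/hasP; exists 1; rewrite ?rP //; apply/asboolP.
have wN w : mu w -> w ^+ size r = 1.
  move=> mw; have [w0 _ _] := root_of_unity_unit mw.
  have p0 : \prod_(v <- r) v != 0.
    rewrite prodf_seq_neq0; apply/allP => v; rewrite rP => /asboolP.
    by move=> /root_of_unity_unit[].
  (* Multiplication by [w] permutes [r]; comparing the products of the two lists gives the
     exponent. *)
  have pr : perm_eq [seq w * v | v <- r] r.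
    apply: uniq_perm => //; first by rewrite map_inj_uniq //; apply: mulfI.
    move=> v; rewrite rP; apply/mapP/asboolP.
      by move=> [v']; rewrite rP => /asboolP mv' ->; apply: root_of_unityM.
    move=> mv; exists (w^-1 * v); last by rewrite mulVKf.
    by rewrite rP; apply/asboolP/root_of_unityM => //; apply: root_of_unityV.
  have : \prod_(v <- [seq w * v | v <- r]) v = \prod_(v <- r) v by apply: perm_big.
  rewrite big_map big_split /= big_const_seq count_predT.
  rewrite iter_mulr mulr1.
  by move/(congr1 (fun x => x / \prod_(v <- r) v)); rewrite mulfK // mulfV.
have : has (size r).-primitive_root r.
  apply: cyclic.has_prim_root => //.
  by apply/allP => w; rewrite rP => /asboolP /wN; move/unity_rootP.
case/hasP=> g; rewrite rP => /asboolP mg gprim; exists g => // w.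
by move=> /wN /(prim_rootP gprim)[i ->]; exists i.
Qed.

Variable l : nat.
Hypothesis lp : prime l.

(** Triviality in the units modulo torsion and l-th powers, a vector space over the field with [l]
    elements; [unit_indep] is linear independence there. *)
Definition unit_rel (x : algC) : Prop := exists w z, [/\ mu w, U z & x = w * z ^+ l].

Definition unit_indep r (t : 'I_r -> algC) : Prop :=
  (forall i, U (t i)) /\
  forall c : 'I_r -> int, unit_rel (\prod_i t i ^ c i) -> forall i, (l %| c i)%Z.

(** Infinite descent: the exponents of such a product are divisible by [l], and dividing them by [l]
    leaves a root of unity. *)
Lemma unit_indep_torsion r (t : 'I_r -> algC) (c : 'I_r -> int) :
  unit_indep t -> mu (\prod_i t i ^ c i) -> forall i, c i = 0.
Proof.
move=> [Ut tI].
have [m] : exists m, (\sum_i `|c i| < m)%N by exists (\sum_i `|c i|).+1%N.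
elim: m c => [|m IH] c // lt_m mc.
have lc : forall i, (l %| c i)%Z.
  by apply: tI; exists (\prod_i t i ^ c i), 1; rewrite expr1n mulr1; split=> //; exact: unit_of1.
pose c' i := (c i %/ l)%Z.
have cE i : c i = c' i * l%:Z by rewrite divzK.
have [|c0] := boolP [forall i, c i == 0]; first by move=> /forallP c0 i; apply/eqP.
have l1 := prime_gt1 lp.
suff c'0 : forall i, c' i = 0 by move=> i; rewrite cE c'0 mul0r.
apply: IH.
  move: c0; rewrite negb_forall => /existsP[i ci].
  rewrite -ltnS; apply: leq_trans lt_m.
  rewrite (bigD1 i) //= [X in (_ < X.+1)%N](bigD1 i) //=.
  have cj j : (`|c' j| <= `|c j|)%N by rewrite [c j]cE abszM leq_pmulr // absz_nat prime_gt0.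
  rewrite ltnS -addSn leq_add ?leq_sum // [c i]cE abszM absz_nat.
  by rewrite ltn_Pmulr // absz_gt0; apply: contra_neq ci => bi; rewrite cE bi mul0r.
apply: (@root_of_unity_root _ l); last 2 first.
- exact: prime_gt0.
- rewrite -prodrXl (eq_bigr (fun i => t i ^ c i)) // => i _.
  by rewrite [c i]cE -exprz_exp exprnP.
by have [] := unit_of_prod xpredT (fun i => unit_ofXz (c' i) (Ut i)) => _ [].
Qed.

(** The binary logarithm rounded down, which sorts absolute values into finitely many cells. *)
Lemma pow2_cell (B : nat) (x : algC) : 1 <= x -> x <= 2 ^+ B ->
  exists m : 'I_B.+1, 2 ^+ m <= x < 2 ^+ m.+1.
Proof.
move=> x1; elim: B => [|B IH] xB.
  by exists ord0; rewrite expr0 x1 expr1 (le_lt_trans xB) ?ltr1n.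
have xr : x \is Num.real by rewrite ger0_real // (le_trans ler01).
have [xB'|xB'] := real_leP xr (rpredX B (rpred_nat _ 2) : (2 ^+ B : algC) \is Num.real).
  have [m mP] := IH xB'; exists (widen_ord (leqnSn _) m) => //.
move: xB; rewrite le_eqVlt => /orP[/eqP ->|xB].
  by exists ord_max; rewrite /= lexx ltr_eXn2l ?ltr1n /=.
by exists (widen_ord (leqnSn _) ord_max); rewrite /= (ltW xB').
Qed.

Lemma unit_pow2_bound r (t : 'I_r -> algC) : (forall i, U (t i)) ->
  exists H : nat, forall i j, 1 <= 2 ^+ H * `|nu j (t i)| /\ `|nu j (t i)| <= 2 ^+ H.
Proof.
move=> Ut; pose f (i : 'I_r) (j : 'I_d) := `|nu j (t i)| + `|nu j (t i)|^-1.
have f0 i j : 0 <= f i j by rewrite addr_ge0 ?invr_ge0.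
exists (Num.bound (\sum_i \sum_j f i j)) => i j.
set N := Num.bound _.
have : f i j < 2 ^+ N.
  apply: (@le_lt_trans _ _ (\sum_i \sum_j f i j)).
    rewrite (bigD1 i) //= (bigD1 j) //= -addrA lerDl addr_ge0 // sumr_ge0 // => i' _.
    by rewrite sumr_ge0.
  apply: (lt_le_trans (archi_boundP _)); first by do 2!(rewrite sumr_ge0 // => ? _).
  by rewrite -natrX ler_nat ltnW // ltn_expl.
move=> fN; have [t0 _ _] := Ut i.
have a0 : 0 < `|nu j (t i)| by rewrite normr_gt0 fmorph_eq0.
split; last by apply/ltW/(le_lt_trans _ fN); rewrite lerDl invr_ge0 ltW.
by rewrite -ler_pdivrMr // div1r ltW // (le_lt_trans _ fN) // lerDr ltW.
Qed.

(** A box principle in place of the logarithmic embedding. Products of the [t i] with exponents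
    below A are sorted by the rounded binary logarithms of their [d] conjugates. Two products in one
    cell have a quotient whose conjugates are at most 2 in absolute value, hence a quotient in the
    finite list [s]. For r > d the products are too numerous, and two of them coincide, against
    independence modulo torsion. *)
Lemma unit_indep_size r (t : 'I_r -> algC) : unit_indep t -> (r <= d)%N.
Proof.
move=> tI; have [Ut _] := tI; rewrite leqNgt; apply/negP => lt_r.
have [H HP] := unit_pow2_bound Ut; have [s sP] := bounded_finite G 2.
(* Each conjugate has 2 B + 1 <= A (2 H r + 1) possible cells, and A > (2 H r + 1)^d M gives A^r >=
   A^(d + 1) > (A (2 H r + 1))^d M. *)
pose M := (size s).+1; pose A := ((2 * H * r).+1 ^ d * M).+1.
pose B := (H * A * r)%N.
pose y (a : {ffun 'I_r -> 'I_A}) := \prod_i t i ^ (a i : nat)%:Z.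
have Uy a : U (y a) by apply: unit_of_prod => i; apply: unit_ofXz.
have yB a j : 1 <= 2 ^+ B * `|nu j (y a)| /\ 2 ^+ B * `|nu j (y a)| <= 2 ^+ (2 * B).
  have -> : 2 ^+ B = \prod_(i < r) 2 ^+ (H * A) :> algC.
    by rewrite prodr_const card_ord -exprM.
  have -> : `|nu j (y a)| = \prod_i `|nu j (t i)| ^+ a i.
    by rewrite rmorph_prod normr_prod; apply: eq_bigr => i _; rewrite rmorphXn normrX.
  have aA i : (H * a i <= H * A)%N by rewrite leq_mul2l ltnW ?orbT.
  rewrite -big_split /=; split.
    apply: (big_ind (fun z => 1 <= z)) => [||i _]; [by [] | exact: mulr_ege1 |].
    have [h _] := HP i j.
    apply: (@le_trans _ _ (2 ^+ (H * a i) * `|nu j (t i)| ^+ a i)).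
      by rewrite exprM -exprMn exprn_ege1.
    by rewrite ler_wpM2r ?exprn_ge0 // ler_eXn2l ?ltr1n.
  have -> : 2 ^+ (2 * B) = \prod_(i < r) 2 ^+ (2 * (H * A)) :> algC.
    by rewrite prodr_const card_ord -exprM; congr (_ ^+ _); rewrite /B; ring.
  apply: ler_prod => i _; rewrite mulr_ge0 ?exprn_ge0 //=.
  rewrite mulSn mul1n exprD ler_wpM2l ?exprn_ge0 //.
  apply: (@le_trans _ _ (2 ^+ (H * a i))); last by rewrite ler_eXn2l ?ltr1n.
  by rewrite exprM lerXn2r ?nnegrE ?exprn_ge0 //; have [] := HP i j.
have /choice[cell cellP] : forall a, exists m : {ffun 'I_d -> 'I_(2 * B).+1},
    forall j, 2 ^+ m j <= 2 ^+ B * `|nu j (y a)| < 2 ^+ (m j).+1.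
  move=> a; have /choice[m mP] : forall j, exists m : 'I_(2 * B).+1,
      2 ^+ m <= 2 ^+ B * `|nu j (y a)| < 2 ^+ m.+1.
    by move=> j; have [h1 h2] := yB a j; apply: pow2_cell.
  by exists (finfun m) => j; rewrite ffunE.
have mem_s a b : cell a = cell b -> y a / y b \in s.
  move=> eab; have [yb0 _ Oyb] := Uy b; apply: sP.
    by apply: (oiM FF) => //; have [] := Uy a.
  move=> j; rewrite fmorph_div normrM normfV.
  have b0 : 0 < `|nu j (y b)| by rewrite normr_gt0 fmorph_eq0.
  rewrite ler_pdivrMr // -(ler_pM2l (exprn_gt0 B (ltr0n algC 2))) ?ltr0n //.
  have /andP[_ /ltW ha] := cellP a j; have /andP[hb _] := cellP b j.
  apply: le_trans ha _; rewrite eab exprS mulrCA.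
  by rewrite ler_pM2l ?ltr0n.
(* One fixed element per cell: the products in a cell are told apart by their quotients by it, which
   lie in [s]. *)
pose rep c := odflt [ffun=> ord0] [pick a | cell a == c].
have repP a : cell (rep (cell a)) = cell a.
  by rewrite /rep; case: pickP => [b /eqP //|/(_ a)]; rewrite eqxx.
pose f a : {ffun 'I_d -> 'I_(2 * B).+1} * 'I_M :=
  (cell a, inord (index (y a / y (rep (cell a))) s)).
have /injectivePn[a [b ab fab]] : ~~ injectiveb f.
  apply/negP => /injectiveP/leq_card; apply/negP; rewrite -ltnNge.
  rewrite card_prod !card_ffun !card_ord.
  apply: (@leq_ltn_trans ((A * (2 * H * r).+1) ^ d * M)).
    have d0 : (0 < d)%N by have [_ _ _ []] := G.
    rewrite leq_mul // leq_exp2r // mulnS (_ : 2 * B = A * (2 * H * r))%N; last by rewrite /B; ring.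
    by rewrite -add1n leq_add2r.
  apply: (@leq_trans (A ^ d.+1)); last exact: leq_pexp2l.
  by rewrite expnMn -mulnA expnSr ltn_pmul2l ?expn_gt0.
have [eab eidx] : cell a = cell b /\ y a / y (rep (cell a)) = y b / y (rep (cell b)).
  case: fab => eab /(congr1 (@nat_of_ord _)) eidx; split=> //.
  have sa := mem_s a (rep (cell a)) (esym (repP a)).
  have sb := mem_s b (rep (cell b)) (esym (repP b)).
  move: eidx; rewrite !inordK ?ltnS ?index_size // => e.
  by rewrite -(nth_index 0 sa) e nth_index.
have yab : y a = y b.
  by move: eidx; rewrite eab => /(mulIf _); apply; rewrite invr_eq0; have [] := Uy (rep (cell b)).
have : forall i, (a i : nat)%:Z - (b i : nat)%:Z = 0.
  apply: (unit_indep_torsion tI).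
  have -> : \prod_i t i ^ ((a i : nat)%:Z - (b i : nat)%:Z) = y a / y b.
    rewrite -prodf_div; apply: eq_bigr => i _; have [t0 _ _] := Ut i.
    by rewrite expfzDr // invr_expz.
  rewrite yab mulfV; first by split; [exact: (sf1 FF) | exists 1%N; rewrite ?expr1n].
  by have [] := Uy b.
move=> e; move/eqP: ab; apply; apply/ffunP => i; apply/val_inj.
by have /eqP := e i; rewrite subr_eq0 eqz_nat => /eqP.
Qed.

Lemma unit_relM x y : unit_rel x -> unit_rel y -> unit_rel (x * y).
Proof.
move=> [w [z [mw Uz ->]]] [w' [z' [mw' Uz' ->]]]; exists (w * w'), (z * z').
split; [exact: root_of_unityM | exact: unit_ofM | by rewrite exprMn; ring].
Qed.

Lemma root_of_unity1 : mu 1.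
Proof. by split; [exact: (sf1 FF) | exists 1%N; rewrite ?expr1n]. Qed.

Lemma unit_rel_pow z : U z -> unit_rel (z ^ l%:Z).
Proof. by move=> Uz; exists 1, z; split; rewrite ?mul1r //; exact: root_of_unity1. Qed.

Lemma unit_rel_mult z (c : int) : U z -> (l %| c)%Z -> unit_rel (z ^ c).
Proof.
by move=> Uz /dvdzP[q ->]; rewrite -exprz_exp; apply/unit_rel_pow/unit_ofXz.
Qed.

Lemma unit_relXz x (a : int) : unit_rel x -> unit_rel (x ^ a).
Proof.
have relX y (m : nat) : unit_rel y -> unit_rel (y ^+ m).
  move=> Ry; elim: m => [|m IH]; last by rewrite exprS; apply: unit_relM.
  by rewrite expr0 -(expr1n _ l) exprnP; apply: unit_rel_pow unit_of1.
move=> Rx; case: a => m; first exact: relX.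
have -> : x ^ Negz m = (x ^+ m.+1)^-1 by [].
have [w [z [mw Uz ->]]] := relX _ m.+1 Rx.
exists w^-1, z^-1; split; [exact: root_of_unityV | exact: unit_ofV |].
by rewrite invfM exprVn.
Qed.

Lemma prodXz (I : finType) (f : I -> algC) (c : I -> int) (a : int) :
  \prod_i f i ^ (c i * a) = (\prod_i f i ^ c i) ^ a.
Proof.
rewrite (big_morph (fun x : algC => x ^ a) (id1 := 1) (op1 := *%R)).
- by apply: eq_bigr => i _; rewrite exprz_exp.
- by move=> x y; rewrite expfzMl.
- by rewrite exp1rz.
Qed.

(** If [l] divides the exponent of [u] in a relation, this factor is trivial and drops out;
    otherwise Bezout isolates [u] and expresses it through the [t i]. *)
Lemma unit_indep_cons r (t : 'I_r -> algC) u : unit_indep t -> U u ->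
  ~ (exists c : 'I_r -> int, unit_rel (u * \prod_i t i ^ c i)) ->
  unit_indep (fun i : 'I_r.+1 => oapp t u (unlift ord0 i)).
Proof.
move=> [Ut tI] Uu nu_gen; split=> [i|c]; first by case: unliftP => [j _|_] /=.
rewrite big_ord_recl unlift_none /=.
under eq_bigr do rewrite liftK /=.
set Y := \prod_(i < r) _ => rel.
have lc0 : (l %| c ord0)%Z.
  apply: contraT => nlc; case: nu_gen.
  have : coprimez l (c ord0) by rewrite /coprimez /gcdz /= eqz_nat -/(coprime _ _) prime_coprime.
  case/coprimezP => -[b a] /= e.
  exists (fun i => c (lift ord0 i) * a); rewrite prodXz -/Y.
  have u0 : u != 0 by case: Uu.
  have -> : u * Y ^ a = (u ^ c ord0 * Y) ^ a * (u ^ b) ^ l%:Z.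
    rewrite -{1}[u]expr1z -e expfzDr // expfzMl !exprz_exp.
    by rewrite (mulrC (c ord0)); ring.
  by apply: unit_relM; [exact: unit_relXz | apply/unit_rel_pow/unit_ofXz].
have relY : unit_rel Y.
  have u0 : u != 0 by case: Uu.
  have -> : Y = (u ^ c ord0 * Y) * u ^ (- c ord0).
    by rewrite -invr_expz mulrAC mulfV ?mul1r // expfz_neq0.
  by apply: unit_relM => //; apply: unit_rel_mult => //; rewrite dvdzE abszN -dvdzE.
by move=> i; case: (unliftP ord0 i) => [j ->|->] //; apply: (tI _ relY).
Qed.

Lemma unit_basis : exists r (t : 'I_r -> algC), [/\ (r <= d)%N, unit_indep t
  & forall u, U u -> exists c : 'I_r -> int, unit_rel (u * \prod_i t i ^ c i)].
Proof.
apply: contrapT => nex.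
suff /(_ d.+1)[t /unit_indep_size] : forall r, exists t : 'I_r -> algC, unit_indep t.
  by rewrite ltnn.
elim=> [|r [t tI]]; first by exists (fun=> 1); split=> [i|c _ [//]]; exact: unit_of1.
have [u Uu ngen] : exists2 u, U u & ~ exists c : 'I_r -> int, unit_rel (u * \prod_i t i ^ c i).
  apply: contrapT => H; apply: nex; exists r, t; split=> //; first exact: unit_indep_size tI.
  by move=> u Uu; apply: contrapT => ngen; apply: H; exists u.
by exists (fun i => oapp t u (unlift ord0 i)); apply: unit_indep_cons.
Qed.

(** Up to l-th powers, a unit is determined by the exponents modulo [l] of at most [d] basis units
    and of a generator of the roots of unity, whence [d.+1]. *)
Lemma unit_classes_bound m (u : 'I_m -> algC) : (forall i, U (u i)) ->
  (forall i j, (exists2 z, U z & u i = u j * z ^+ l) -> i = j) ->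
  (m <= l ^ d.+1)%N.
Proof.
move=> Uu uI; have [r [t [rd [Ut _] gen]]] := unit_basis.
have [g mg gP] := roots_of_unity_cyclic; have Ug := root_of_unity_unit mg.
have l0 := prime_gt0 lp.
have /choice[v vP] : forall i, exists v : {ffun 'I_r -> int} * nat, exists z,
    U z /\ u i * \prod_h t h ^ v.1 h = g ^+ v.2 * z ^+ l.
  move=> i; have [c [w [z [mw Uz e]]]] := gen _ (Uu i).
  have [a wE] := gP w mw; exists (finfun c, a), z; split=> //=; rewrite -wE -e.
  by congr (_ * _); apply: eq_bigr => h _; rewrite ffunE.
have /choice[red redP] : forall c : int, exists b : 'I_l.-1.+1, (c %% l)%Z = b.
  move=> c; have := modz_ge0 c (_ : l%:Z != 0); rewrite eqz_nat -lt0n => /(_ l0).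
  have := ltz_pmod c (_ : 0 < l%:Z); rewrite ltz_nat => /(_ l0).
  case: (c %% _)%Z => // b; rewrite ltz_nat => bl _.
  by rewrite -(prednK l0) in bl; exists (Ordinal bl).
pose f i : {ffun 'I_r -> 'I_l.-1.+1} * 'I_l.-1.+1 :=
  ([ffun h => red ((v i).1 h)], red (v i).2).
have finj : injective f.
  move=> i j [e1 e2]; apply: uI.
  have dvd_red a b : red a = red b -> exists q : int, a = b + q * l%:Z.
    move/(congr1 (fun x : 'I_l.-1.+1 => (x : nat)%:Z)); rewrite -!redP => /eqP.
    rewrite eqz_mod_dvd => /dvdzP[q e]; exists q.
    by rewrite -e addrC subrK.
  have [q2 E2] := dvd_red _ _ e2.
  have /choice[q1 E1] : forall h, exists q : int, (v i).1 h = (v j).1 h + q * l%:Z.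
    by move=> h; apply: dvd_red; have /ffunP/(_ h) := e1; rewrite !ffunE.
  have [zi [Uzi ei]] := vP i; have [zj [Uzj ej]] := vP j.
  have [zi0 _ _] := Uzi; have [zj0 _ _] := Uzj.
  have prod0 (c : 'I_r -> int) : \prod_h t h ^ c h != 0.
    by have [] := unit_of_prod xpredT (fun h => unit_ofXz (c h) (Ut h)).
  have g0 : g != 0 by case: Ug.
  pose Q := \prod_h t h ^ q1 h.
  have Q0 : Q != 0 := prod0 _.
  have ei' : u i * (\prod_h t h ^ (v j).1 h * Q ^+ l) = g ^+ (v j).2 * (g ^ q2) ^+ l * zi ^+ l.
    rewrite exprnP -prodXz -big_split /=; transitivity (g ^+ (v i).2 * zi ^+ l).
      rewrite -ei; congr (_ * _); apply: eq_bigr => h _; have [th0 _ _] := Ut h.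
      by rewrite -expfzDr // E1.
    congr (_ * _); rewrite [LHS]exprnP E2 expfzDr // -exprz_exp //.
  exists (zi / zj * g ^ q2 / Q).
    apply: unit_ofM; last by apply/unit_ofV/unit_of_prod => h; apply: unit_ofXz.
    by apply: unit_ofM (unit_ofXz _ Ug); apply: unit_ofM => //; apply: unit_ofV.
  have P0 := prod0 (v j).1; set P := \prod_h t h ^ (v j).1 h in ej ei' P0.
  have Ui : u i = g ^+ (v j).2 * (g ^ q2) ^+ l * zi ^+ l / (P * Q ^+ l).
    by rewrite -ei' mulfK // mulf_neq0 // expf_neq0.
  have Uj : u j = g ^+ (v j).2 * zj ^+ l / P by rewrite -ej mulfK.
  rewrite Ui Uj !exprMn !exprVn.
  have Ql : Q ^+ l != 0 by rewrite expf_neq0.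
  have zl : zj ^+ l != 0 by rewrite expf_neq0.
  by field; rewrite P0 Ql zl.
have := leq_card f finj; rewrite card_prod card_ffun !card_ord prednK //.
by move/leq_trans; apply; rewrite -expnSr leq_pexp2l.
Qed.

End Units.

Lemma card_fibers (X : finType) (S : {set X}) (Y : eqType) (g : X -> Y) (A : seq Y) b :
  {in S, forall x, g x \in A} ->
  {in A, forall y, #|[set x in S | g x == y]%SET| <= b}%N ->
  (#|S| <= size A * b)%N.
Proof.
move=> gA fib; rewrite -sum1_card.
apply: (@leq_trans (\sum_(x in S) \sum_(y <- A) (g x == y))).
  apply: leq_sum => x xS; rewrite (big_rem _ (gA x xS)) /= eqxx.
  by rewrite leq_addr.
rewrite exchange_big /= mulnC -iter_addn_0 -(count_predT A) -big_const_seq.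
rewrite !big_seq; apply: leq_sum => y yA; apply: leq_trans (fib y yA).
rewrite -sum1_card big_mkcond [leqRHS]big_mkcond; apply: leq_sum => x _.
by rewrite inE; case: (x \in S); case: (g x == y).
Qed.

Lemma card_fset_prod (K K' : choiceType) (A : {fset K}) (B : {fset K'}) :
  #|` (A `*` B)%fset| = (#|` A| * #|` B|)%N.
Proof.
have -> : (A `*` B)%fset = [fset p in [seq (x, y) | x <- enum_fset A, y <- enum_fset B]]%fset.
  apply/fsetP => -[x y]; rewrite in_fsetM !inE /=; apply/andP/allpairsP.
    by move=> [xA yB]; exists (x, y).
  by move=> [[x' y'] [/= xA yB [-> ->]]].
rewrite card_fseq undup_id ?size_allpairs //.
by apply: allpairs_uniq => // -[x y] [x' y'] _ _ [-> ->].
Qed.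

(** * Torsion and elementary quotients of a finite abelian group *)

Section AbelianGroup.
Variables (T : choiceType) (op : T -> T -> T) (one : T) (G : set T).
Hypothesis finG : finite_set G.
Hypothesis G1 : G one.
Hypothesis GM : forall x y, G x -> G y -> G (op x y).
Hypothesis opA : forall x y z, G x -> G y -> G z -> op x (op y z) = op (op x y) z.
Hypothesis opC : forall x y, G x -> G y -> op x y = op y x.
Hypothesis op1 : forall x, G x -> op x one = x.
Hypothesis opV : forall x, G x -> exists2 y, G y & op x y = one.

Let pow n x := iter n (op x) one.

Let powG n x : G x -> G (pow n x).
Proof. by move=> Gx; elim: n => [|n IH] //=; apply: GM. Qed.

Let iteropE n x : G x -> iterop n op x one = pow n x.
Proof.
by move=> Gx; case: n => // n; rewrite iteropS /pow iterSr op1.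
Qed.

Let op1x x : G x -> op one x = x.
Proof. by move=> Gx; rewrite opC ?op1. Qed.

Let opCA x y z : G x -> G y -> G z -> op x (op y z) = op y (op x z).
Proof. by move=> Gx Gy Gz; rewrite opA // (opC Gx Gy) -opA. Qed.

Let powM n x y : G x -> G y -> pow n (op x y) = op (pow n x) (pow n y).
Proof.
move=> Gx Gy; elim: n => [|n IH] /=; first by rewrite op1.
rewrite IH -!opA //; try by do ?[apply: GM | apply: powG].
by rewrite (opCA Gy) //; do ?[apply: GM | apply: powG].
Qed.

Let op_inj x y z : G x -> G y -> G z -> op x z = op y z -> x = y.
Proof.
move=> Gx Gy Gz e; have [w Gw zw] := opV Gz.
by rewrite -[x]op1 // -[y]op1 // -zw !opA // e.
Qed.

Variable l : nat.
Hypothesis l_gt0 : (0 < l)%N.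

Let H : set T := [set pow l x | x in G].

Let coset_mul x y : G x -> G y ->
  setop op (Defs.coset op H x) (Defs.coset op H y) = Defs.coset op H (op x y).
Proof.
move=> Gx Gy; rewrite eqEsubset; split=> [_ [_ [_ [u Gu <-] <-] [_ [_ [v Gv <-] <-] <-]]|].
  exists (pow l (op u v)); first by exists (op u v) => //; apply: GM.
  rewrite powM // -!opA //; try by do ?[apply: GM | apply: powG].
  by rewrite (opCA Gy) //; do ?[apply: GM | apply: powG].
move=> _ [_ [u Gu <-] <-]; exists (op x (pow l u)); first by exists (pow l u) => //; exists u.
exists (op y one); first by exists one => //; exists one => //; rewrite /pow; elim: l => //= n ->; rewrite op1.
by rewrite op1 // -!opA ?(opC (powG _ Gu) Gy) //; apply: powG.
Qed.

Let coset_pow x : H x -> Defs.coset op H x = H.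
Proof.
move=> [u Gu <-]; rewrite eqEsubset; split=> [_ [_ [v Gv <-] <-]|_ [v Gv <-]].
  by exists (op u v); [exact: GM | rewrite powM].
have [w Gw uw] := opV Gu; exists (pow l (op w v)); first by exists (op w v) => //; apply: GM.
by rewrite -powM ?opA ?uw ?op1x //; apply: GM.
Qed.

Let powers_elementary : is_subgroup op one G H /\
  elementary_abelian l (setop op) H (quotient op G H).
Proof.
have H1 : H one by exists one => //; rewrite /pow; elim: l => //= n ->; rewrite op1.
split.
  split=> // [_ [x Gx <-]|_ _ [x Gx <-] [y Gy <-]|_ [x Gx <-]]; first exact: powG.
    by exists (op x y); [exact: GM | rewrite powM].
  have [y Gy xy] := opV Gx; exists (pow l y); first by exists y.
  by rewrite -powM // xy; rewrite /pow; elim: l => //= n ->; rewrite op1.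
split=> [_ _ [x Gx <-] [y Gy <-]|_ [x Gx <-]]; first by rewrite !coset_mul // opC.
have it n : iterop n.+1 (setop op) (Defs.coset op H x) H = Defs.coset op H (pow n.+1 x).
  rewrite iteropS; elim: n => [|n IH]; first by rewrite /= op1.
  by rewrite iterS IH coset_mul //; apply: powG.
by rewrite -(prednK l_gt0) it prednK // coset_pow //; exists x.
Qed.

(* The [l]-torsion and the quotient by the [l]-th powers have the same order;
   the smallest subgroup in the definition of the quotient lies in the latter. *)
Lemma torsion_le_elementary_quotient (A : {fset T}) :
  (forall x, x \in A -> G x /\ iterop l op x one = one) ->
  (#|` A| <= #|` fset_set (elementary_quotient l op one G)|)%N.
Proof.
move=> AP; set H0 := smallest [set X | is_subgroup op one G X /\
  elementary_abelian l (setop op) X (quotient op G X)] set0.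
have H0H : H0 `<=` H by apply: smallest_sub.
have H01 : H0 one by move=> X [[[_ X1 _ _] _] _].
have HG : H `<=` G by move=> _ [x Gx <-]; apply: powG.
have finH : finite_set H := sub_finite_set HG finG.
have finQ : finite_set (quotient op G H0) by apply: finite_image.
have /choice[s sP] : forall y, exists x, H y -> G x /\ pow l x = y.
  move=> y; have [[x Gx e]|nH] := pselect (H y); first by exists x.
  by exists one.
have /choice[rho rhoP] : forall c, exists x, quotient op G H0 c ->
    G x /\ Defs.coset op H0 x = c.
  move=> c; have [[x Gx e]|nH] := pselect (quotient op G H0 c); first by exists x.
  by exists one.
(* A torsion element times a chosen l-th root [s y] of [y] determines both: its l-th power is
   [y]. *)
have le1 : (#|` A| * #|` fset_set H| <= #|` fset_set G|)%N.
  rewrite -card_fset_prod.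
  have <- : #|` [fset op p.1 (s p.2) | p in (A `*` fset_set H)%fset]%fset| =
      #|` (A `*` fset_set H)%fset|.
    apply: card_in_imfset => -[t y] [t' y'] /=; rewrite !in_fsetM /= !in_fset_set //.
    move=> /andP[/AP[Gt lt] /set_mem Hy] /andP[/AP[Gt' lt'] /set_mem Hy'] e.
    have [Gs ps] := sP _ Hy; have [Gs' ps'] := sP _ Hy'.
    have yy' : y = y'.
      have := congr1 (pow l) e; rewrite !powM // ps ps' -!iteropE // lt lt'.
      by rewrite !op1x //; apply: HG.
    by move: e; rewrite yy' => /(op_inj Gt Gt' Gs') ->.
  apply: fsubset_leq_card; apply/fsubsetP => z /imfsetP[[t y] /=].
  rewrite in_fsetM /= in_fset_set // => /andP[/AP[Gt _] /set_mem Hy] ->.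
  by rewrite in_fset_set //; apply/mem_set/GM => //; have [] := sP _ Hy.
(* Every element is a chosen coset representative times an element of [H0], hence of [H]. *)
have le2 : (#|` fset_set G| <= #|` fset_set (quotient op G H0)| * #|` fset_set H|)%N.
  rewrite -card_fset_prod.
  apply: (@leq_trans #|` [fset op (rho p.1) p.2 |
    p in (fset_set (quotient op G H0) `*` fset_set H)%fset]%fset|); last first.
    exact: leq_imfset_card.
  apply: fsubset_leq_card; apply/fsubsetP => x; rewrite in_fset_set // => /set_mem Gx.
  have qx : quotient op G H0 (Defs.coset op H0 x) by exists x.
  have [Gr er] := rhoP _ qx.
  have : Defs.coset op H0 x x by exists one => //; rewrite op1.
  rewrite -er => -[h H0h e]; apply/imfsetP; exists (Defs.coset op H0 x, h) => //=.
  rewrite in_fsetM /= !in_fset_set //; apply/andP.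
  by split; apply/mem_set => //; apply: H0H.
have H_gt0 : (0 < #|` fset_set H|)%N.
  rewrite cardfs_gt0; apply/fset0Pn; exists one; rewrite in_fset_set //.
  by apply/mem_set/H0H.
by rewrite -(leq_pmul2r H_gt0) (leq_trans le1).
Qed.

End AbelianGroup.

(** * Ideal classes, and elements modulo l-th powers *)

Section ClassGroup.
Variables (k : set algC) (n : nat).
Hypothesis kN : is_nf n k.
Let kF : is_subfield k. Proof. by case: kN. Qed.
Local Notation O := (integers k).
Local Notation "I ** J" := (ideal_mul k I J) (at level 40, left associativity).
Implicit Types (I J A B P Q : set algC).

Definition ideal_class I : set (set algC) := Defs.coset (ideal_mul k) (principal k) I.

Let sO : is_submodule k O := integers_submodule kF.

Lemma principalP X : principal k X <-> exists a, [/\ k a, a != 0 & X = scale a O].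
Proof.
split=> [[a [ka a0] <-]|[a [ka a0 ->]]]; exists a => //; first by rewrite module_span1.
exact: module_span1.
Qed.

Lemma ideal_classP I X : is_submodule k I ->
  ideal_class I X <-> exists a, [/\ k a, a != 0 & X = scale a I].
Proof.
move=> sI; split=> [[_ /principalP[a [ka a0 ->]] <-]|[a [ka a0 ->]]].
  by exists a; split=> //; rewrite scale_mul (mul_ideal1 kF).
exists (scale a O); first by apply/principalP; exists a.
by rewrite scale_mul (mul_ideal1 kF).
Qed.

Lemma ideal_class_eq I J : is_submodule k I -> is_submodule k J ->
  ideal_class I = ideal_class J <-> exists a, [/\ k a, a != 0 & I = scale a J].
Proof.
move=> sI sJ; split=> [e|[a [ka a0 ->]]].
  apply/ideal_classP => //; rewrite -e; apply/ideal_classP => //.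
  by exists 1; split; [exact: (sf1 kF) | exact: oner_neq0 | rewrite scale1].
have sa := scale_submodule a sJ.
rewrite eqEsubset; split=> X /ideal_classP => [/(_ sa)|/(_ sJ)] [b [kb b0 ->]];
  apply/ideal_classP => //.
  by exists (b * a); split; [exact: (sfM kF) | rewrite mulf_neq0 | rewrite scaleA].
exists (b / a); split; first exact: (sfdiv kF).
  by rewrite mulf_neq0 // invr_eq0.
by rewrite scaleA divfK.
Qed.

Lemma ideal_class1 : ideal_class O = principal k.
Proof.
rewrite eqEsubset; split=> X; first by move=> /(ideal_classP _ sO)/principalP.
by move=> /principalP XP; apply/ideal_classP.
Qed.

Lemma ideal_classM I J : is_submodule k I -> is_submodule k J ->
  setop (ideal_mul k) (ideal_class I) (ideal_class J) = ideal_class (I ** J).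
Proof.
move=> sI sJ; have sIJ := ideal_mul_submodule k I J.
rewrite eqEsubset; split.
  move=> _ [_ /(ideal_classP _ sI)[a [ka a0 ->]] [_ /(ideal_classP _ sJ)[b [kb b0 ->]] <-]].
  apply/ideal_classP => //; exists (a * b); split; first exact: (sfM kF).
    by rewrite mulf_neq0.
  by rewrite mul_scale scale_mul scaleA.
move=> X /(ideal_classP _ sIJ)[a [ka a0 ->]].
exists (scale a I); first by apply/ideal_classP => //; exists a.
exists J; last by rewrite mul_scale.
by apply/ideal_classP => //; exists 1; split; [exact: (sf1 kF) | exact: oner_neq0 | rewrite scale1].
Qed.

Lemma nz_ideal_fractional I : nz_ideal k I -> is_fractional k I.
Proof.
move=> nI; have [[sI IO] I0] := (nz_idealP k I).1 nI; split=> //.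
  by move=> x /IO[].
by exists 1; split=> [||x /IO]; [exact: (oi1 kF) | exact: oner_neq0 | rewrite mul1r].
Qed.

Lemma class_groupE : class_group k = [set ideal_class I | I in nz_ideal k].
Proof.
rewrite eqEsubset; split=> [_ [I [sI Ik I0 [d [Od d0 dI]]] <-]|_ [I nI <-]]; last first.
  by exists I => //; apply: nz_ideal_fractional.
exists (scale d I); last first.
  by apply/ideal_class_eq => //; [exact: scale_submodule | exists d; split=> //; case: Od].
apply/nz_idealP; split.
  by split; [exact: scale_submodule | move=> _ [x Ix <-]; apply: dI].
move=> e; apply: I0; rewrite eqEsubset; split=> [x Ix|_ ->]; last exact: sub0 sI.
have : scale d I (d * x) by exists x.
by rewrite e /= => /eqP; rewrite mulf_eq0 (negPf d0) => /eqP.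
Qed.

(** Every class is represented by an ideal containing the fixed integer M, and such ideals are
    finite in number. *)
Lemma class_group_finite : finite_set (class_group k).
Proof.
have [M M0 rep] := ideal_class_rep kN; have [L fin] := ideal_between_finite kN M0.
have M0' : M%:R != 0 :> algC by rewrite pnatr_eq0 -lt0n.
pose S := [set B | nz_ideal k B /\ B M%:R].
have finS : finite_set S.
  apply: contrapT => /infiniteP/pcard_leP/injfunPex[f fS finj].
  have [|i [j [ij e]]] := fin (fun i : 'I_L.+1 => f i); first by move=> i; apply: (fS i).
  have /eqP := finj i j (mem_setT _) (mem_setT _) e.
  by apply/negP; rewrite neq_ltn ij.
apply: (sub_finite_set _ (finite_image ideal_class finS)).
rewrite class_groupE => _ [A nA <-]; have [b [B [Ob b0 nB BM e]]] := rep A nA.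
exists B => //; apply/esym/ideal_class_eq.
- exact: nz_ideal_submodule nA.
- exact: nz_ideal_submodule nB.
exists (b / M%:R); split.
- by apply: (sfdiv kF); [case: Ob | exact: (sfnat kF)].
- by rewrite mulf_neq0 // invr_eq0.
- by apply: (scale_inj M0'); rewrite e scaleA mulrC divfK.
Qed.

Lemma iter_ideal_class I l : (0 < l)%N -> is_submodule k I ->
  iterop l (setop (ideal_mul k)) (ideal_class I) (principal k) =
  ideal_class (ideal_exp k I l).
Proof.
case: l => // l _ sI; rewrite iteropS; elim: l => [|l IH].
  by rewrite (ideal_exp1 kF).
rewrite iterS IH ideal_classM //; exact: ideal_mul_submodule.
Qed.

Lemma class_torsion_bound l (A : {fset set (set algC)}) : (0 < l)%N ->
  (forall c, c \in A -> exists I, [/\ nz_ideal k I, c = ideal_class I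
     & exists a, [/\ k a, a != 0 & ideal_exp k I l = scale a O]]) ->
  (#|` A| <= class_group_ell_order l k)%N.
Proof.
move=> l0 AP; apply: torsion_le_elementary_quotient => //.
- exact: class_group_finite.
- by rewrite class_groupE -ideal_class1; exists O => //; apply: (nz_ideal_integers kF).
- rewrite class_groupE => _ _ [I nI <-] [J nJ <-]; exists (I ** J).
    exact: (nz_ideal_mul kF).
  by rewrite ideal_classM //; apply: nz_ideal_submodule.
- rewrite class_groupE => _ _ _ [I /nz_ideal_submodule sI <-]
    [J /nz_ideal_submodule sJ <-] [K /nz_ideal_submodule sK <-].
  by rewrite !ideal_classM ?ideal_mulA //; apply: ideal_mul_submodule.
- rewrite class_groupE => _ _ [I /nz_ideal_submodule sI <-] [J /nz_ideal_submodule sJ <-].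
  by rewrite !ideal_classM // ideal_mulC.
- rewrite class_groupE => _ [I /nz_ideal_submodule sI <-].
  by rewrite -ideal_class1 ideal_classM // (mul_ideal1 kF).
- rewrite class_groupE => _ [I nI <-]; have sI := nz_ideal_submodule nI.
  have [a [B [Oa a0 nB e]]] := ideal_inv kN nI.
  exists (ideal_class B); first by exists B.
  rewrite ideal_classM ?e //; last exact: nz_ideal_submodule nB.
  rewrite -ideal_class1; apply/ideal_class_eq => //; first exact: scale_submodule.
  by exists a; split=> //; case: Oa.
- move=> c cA; have [I [nI -> [a [ka a0 e]]]] := AP c cA.
  have sI := nz_ideal_submodule nI; split; first by rewrite class_groupE; exists I.
  rewrite iter_ideal_class // -ideal_class1; apply/ideal_class_eq => //.
    exact: (ideal_prod_submodule kF).
  by exists a.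
Qed.

(** Euclidean division of all exponents by [l]; outside [T] the remainders are 0. *)
Lemma ideal_split_power l (T : seq (set algC)) A : (0 < l)%N -> uniq T ->
  nz_ideal k A -> {in T, forall P, is_prime k P} ->
  (forall P, is_prime k P -> P \notin T -> (l %| ideal_val k P A)%N) ->
  exists2 I, nz_ideal k I &
    A = ideal_prod k (flatten [seq nseq (ideal_val k P A %% l) P | P <- T]) ** ideal_exp k I l.
Proof.
move=> l0 UT nA TP dv; have [sP eA] := factorsP kN nA.
pose s := factors k A; rewrite -/s in sP eA.
have cnt (f : set algC -> nat) (t : seq (set algC)) Q : uniq t ->
    count_mem Q (flatten [seq nseq (f P) P | P <- t]) = ((Q \in t) * f Q)%N.
  elim: t => [|P t IH] //= /andP[Pt Ut]; rewrite count_cat count_nseq IH // in_cons /=.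
  rewrite eq_sym; case: eqVneq => [->|_] /=; last by rewrite !mul0n.
  by rewrite (negPf Pt) !mul1n mul0n addn0.
pose t := flatten [seq nseq (count_mem P s %/ l) P | P <- undup s].
exists (ideal_prod k t).
  apply: (nz_ideal_prod kF) => P /flattenP[_ /mapP[Q sQ ->] /nseqP[-> _]].
  by apply/prime_nz/sP; rewrite -mem_undup.
have -> : ideal_exp k (ideal_prod k t) l = ideal_prod k (flatten (nseq l t)).
  elim: (l) => [|i IH] //; rewrite ideal_expS IH -(ideal_prod_cat kF) //.
rewrite {1}eA -(ideal_prod_cat kF); apply: perm_ideal_prod.
have cnt_rep i Q : count_mem Q (flatten (nseq i t)) = (i * count_mem Q t)%N.
  by elim: i => // i IH; rewrite /= count_cat IH mulSn.
apply/allP => Q _; apply/eqP; rewrite /= count_cat cnt // cnt_rep cnt ?undup_uniq // mem_undup.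
rewrite /ideal_val -/s; have [sQ|sQ] := boolP (Q \in s); last first.
  by rewrite (count_memPn sQ) mod0n div0n !muln0.
rewrite /= mul1n; have [QT|QT] := boolP (Q \in T).
  by rewrite /= mul1n mulnC addnC -divn_eq.
by rewrite /= mul0n add0n mulnC divnK //; apply: dv => //; apply: sP.
Qed.

(** Three successive fibrations. The valuations modulo [l] at the members of [T] take at most l^|T|
    values. Once these are fixed, (a_i) = R I_i^l, and the class of I_i relative to a fixed I_i0 is
    l-torsion. Once that class is fixed as well, the a_i differ by l-th powers and by units, which
    are counted modulo l-th powers. *)
Lemma selmer_bound l (T : seq (set algC)) : prime l -> uniq T ->
  {in T, forall P, is_prime k P} -> exists2 d, (d <= n)%N &
  forall m (a : 'I_m -> algC),
    (forall i, integers k (a i) /\ a i != 0) ->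
    (forall i P, is_prime k P -> P \notin T -> (l %| elt_val k P (a i))%N) ->
    (forall i j, (exists g, [/\ k g, g != 0 & a i = a j * g ^+ l]) -> i = j) ->
    (m <= l ^ size T * (class_group_ell_order l k * l ^ d.+1))%N.
Proof.
move=> lp UT TP; have [d [theta [nu [dn G]]]] := exists_nf_gen kN.
exists d => // m a aP adv aI; have l0 := prime_gt0 lp.
have nzO x : O x -> x != 0 -> nz_ideal k (scale x O) by apply: (nz_principal kN).
have /choice[I IP] : forall i, exists I, nz_ideal k I /\ scale (a i) O =
    ideal_prod k (flatten [seq nseq (elt_val k P (a i) %% l) P | P <- T]) ** ideal_exp k I l.
  move=> i; have [Oa a0] := aP i.
  have [I nI e] := ideal_split_power l0 UT (nzO _ Oa a0) TP (adv i).
  by exists I.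
pose res i : (size T).-tuple 'I_l.-1.+1 :=
  map_tuple (fun P => inord (elt_val k P (a i) %% l)) (in_tuple T).
rewrite -[m]card_ord -cardsT.
have -> : (l ^ size T = size (enum {: (size T).-tuple 'I_l.-1.+1}))%N.
  by rewrite -cardE card_tuple card_ord prednK.
apply: (@card_fibers _ _ _ res) => [i _|y _]; first by rewrite mem_enum.
set S := [set x in [set: 'I_m] | res x == y]%SET.
have [->|[i0 i0S]] := set_0Vmem S; first by rewrite cards0.
pose R := ideal_prod k (flatten [seq nseq (elt_val k P (a i0) %% l) P | P <- T]).
have resE i : i \in S -> scale (a i) O = R ** ideal_exp k (I i) l.
  move=> iS; have [_ ->] := IP i; congr (ideal_prod k _ ** _).
  congr flatten; apply/eq_in_map => P PT; congr nseq.
  move: iS i0S; rewrite !inE /= => /eqP <- /eqP /(congr1 val) /= e.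
  move/eq_in_map: e => /(_ P PT) /(congr1 (@nat_of_ord _)).
  by rewrite !inordK ?prednK ?ltn_mod.
have nR : nz_ideal k R.
  apply: (nz_ideal_prod kF) => P /flattenP[_ /mapP[Q TQ ->] /nseqP[-> _]].
  exact/prime_nz/TP.
have nI i : nz_ideal k (I i) by have [] := IP i.
(* [B] represents the inverse class of [I i0], so that the comparison stays among integral
   ideals. *)
have [b [B [Ob b0 nB eB]]] := ideal_inv kN (nI i0).
pose cl i := ideal_class (I i ** B).
have expM X Y i : ideal_exp k (X ** Y) i = ideal_exp k X i ** ideal_exp k Y i.
  elim: i => [|i IH]; first by rewrite (mul1_ideal kF).
  by rewrite !ideal_expS IH -!ideal_mulA (ideal_mulCA k Y).
have exp_scale x X i : is_submodule k X -> ideal_exp k (scale x X) i = scale (x ^+ i) (ideal_exp k X i).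
  move=> sX; elim: i => [|i IH]; first by rewrite expr0 scale1.
  by rewrite !ideal_expS IH mul_scale scale_mul scaleA exprS.
have expO i : ideal_exp k O i = O.
  by elim: i => // i IH; rewrite ideal_expS IH (mul1_ideal kF).
have ka i : k (a i) by have [[]] := aP i.
pose A := [fset cl i | i in S]%fset.
have cA : (#|` A| <= class_group_ell_order l k)%N.
  apply: class_torsion_bound => // c /imfsetP[i /= iS ->].
  exists (I i ** B); split=> //; first exact: (nz_ideal_mul kF).
  exists (a i * b ^+ l / a i0).
  have [Oai ai0] := aP i; have [Oa0 a00] := aP i0.
  split.
  - by apply: (sfdiv kF) => //; apply: (sfM kF) => //; apply: (sfX kF); case: Ob.
  - by rewrite !mulf_neq0 ?invr_eq0 ?expf_neq0.
  apply: (scale_inj a00); rewrite scaleA mulrC divfK // expM.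
  have sE := ideal_prod_submodule kF.
  have e1 : scale (a i0) (ideal_exp k (I i) l) = scale (a i) (ideal_exp k (I i0) l).
    apply: (ideal_mul_cancel kN nR); try exact/scale_submodule/sE.
    rewrite !scale_mul -!resE // !scaleA mulrC //.
  rewrite -mul_scale e1 mul_scale -expM eB exp_scale // expO scaleA //.
apply: leq_trans (leq_mul cA (leqnn _)).
apply: (@card_fibers _ _ _ cl) => [i iS|c _]; first by apply/imfsetP; exists i.
set S' := [set x in S | cl x == c]%SET.
have [->|[j jS']] := set_0Vmem S'; first by rewrite cards0.
have S'S i : i \in S' -> i \in S by rewrite inE => /andP[].
have /choice[g gP] : forall i, exists g, i \in S' -> [/\ k g, g != 0 & I i = scale g (I j)].
  move=> i; have [iS'|] := boolP (i \in S'); last by exists 0.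
  have : cl i = cl j.
    by move: iS' jS'; rewrite !inE => /andP[_ /eqP ->] /andP[_ /eqP ->].
  have sIB X : is_submodule k (X ** B) := ideal_mul_submodule k X B.
  move/(ideal_class_eq (sIB _) (sIB _)) => [x [kx x0 e]]; exists x => _; split=> //.
  apply: (ideal_mul_cancel kN nB); first exact: nz_ideal_submodule (nI i).
    by apply: scale_submodule; apply: nz_ideal_submodule (nI j).
  by rewrite ideal_mulC e -mul_scale ideal_mulC.
pose f (h : 'I_#|S'|) := enum_val h.
have fS' h : f h \in S' by apply: enum_valP.
pose u h := a (f h) / (a j * g (f h) ^+ l).
have uP h : a (f h) = u h * (a j * g (f h) ^+ l).
  by rewrite /u divfK // mulf_neq0 ?expf_neq0 //; [have [] := aP j | have [] := gP _ (fS' h)].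
apply: (unit_classes_bound G lp (u := u)).
  move=> h; have [kg g0 eg] := gP _ (fS' h); have [Oah ah0] := aP (f h); have [Oaj aj0] := aP j.
  have u0 : u h != 0 by rewrite !(mulf_neq0, invr_eq0, expf_neq0).
  have e : scale (a (f h)) O = scale (a j * g (f h) ^+ l) O.
    rewrite resE ?S'S // eg (exp_scale _ _ _ (nz_ideal_submodule (nI j))) scale_mul.
    by rewrite mulrC -scaleA -resE ?S'S.
  have e' : scale (u h) O = O.
    apply: (@scale_inj (a j * g (f h) ^+ l)); first by rewrite mulf_neq0 ?expf_neq0.
    by rewrite scaleA mulrC -uP e.
  split=> //; first by rewrite -e'; exists 1; rewrite ?mulr1 //; exact: (oi1 kF).
  have : O 1 := oi1 kF.
  by rewrite -{1}e' => -[w Ow /(canRL (mulKf u0))]; rewrite mulr1 => <-.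
move=> h h' [z [z0 Oz _] e]; apply: enum_val_inj; apply: aI.
have [kg g0 _] := gP _ (fS' h); have [kg' g'0 _] := gP _ (fS' h').
exists (z * g (f h) / g (f h')); split.
- by apply: (sfdiv kF) => //; apply: (sfM kF) => //; case: Oz.
- by rewrite !mulf_neq0 ?invr_eq0.
rewrite [LHS](uP h) e [in RHS](uP h') !exprMn exprVn.
have gl : g (f h') ^+ l != 0 by rewrite expf_neq0.
by field.
Qed.

End ClassGroup.

(** * Kummer theory of cyclic extensions *)

Section Cyclic.
Variables (k K : set algC) (sigma : algC -> algC).
Hypothesis kF : is_subfield k.
Hypothesis KF : is_subfield K.
Hypothesis kK : k `<=` K.
Hypothesis sigma_aut : is_automorphism k K sigma.
Hypothesis sigma_fix : forall x, K x -> sigma x = x -> k x.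

Let sK x : K x -> K (sigma x).
Proof. by have [[f _ _] _ _ _] := sigma_aut; apply: f. Qed.
Let sD x y : K x -> K y -> sigma (x + y) = sigma x + sigma y.
Proof. by have [_ + _ _] := sigma_aut; apply. Qed.
Let sM x y : K x -> K y -> sigma (x * y) = sigma x * sigma y.
Proof. by have [_ _ + _] := sigma_aut; apply. Qed.
Let sk x : k x -> sigma x = x.
Proof. by have [_ _ _] := sigma_aut; apply. Qed.
Let s_inj x y : K x -> K y -> sigma x = sigma y -> x = y.
Proof. by have [[_ inj _] _ _ _] := sigma_aut => Kx Ky; apply: inj; rewrite inE. Qed.

Local Notation "s ^: x" := (iter s sigma x) (at level 30).

Lemma iter_autK s x : K x -> K (s ^: x).
Proof. by move=> Kx; elim: s => //= s IH; apply: sK. Qed.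

Lemma iter_autD s x y : K x -> K y -> s ^: (x + y) = s ^: x + s ^: y.
Proof. by move=> Kx Ky; elim: s => //= s ->; rewrite sD //; apply: iter_autK. Qed.

Lemma iter_autM s x y : K x -> K y -> s ^: (x * y) = s ^: x * s ^: y.
Proof. by move=> Kx Ky; elim: s => //= s ->; rewrite sM //; apply: iter_autK. Qed.

Lemma iter_autk s x : k x -> s ^: x = x.
Proof. by move=> kx; elim: s => //= s ->; rewrite sk. Qed.

Lemma iter_aut_inj s x y : K x -> K y -> s ^: x = s ^: y -> x = y.
Proof.
move=> Kx Ky; elim: s => //= s IH /s_inj e; apply: IH.
by apply: e; apply: iter_autK.
Qed.

Lemma iter_aut_sum s (I : finType) (P : pred I) (f : I -> algC) : (forall i, K (f i)) ->
  s ^: (\sum_(i | P i) f i) = \sum_(i | P i) s ^: f i.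
Proof.
move=> Kf; suff [] : K (\sum_(i | P i) f i) /\
    s ^: (\sum_(i | P i) f i) = \sum_(i | P i) s ^: f i by [].
apply: (big_rec2 (fun x y => K x /\ s ^: x = y)) => [|i y x _ [Kx <-]].
  by split; [exact: (sf0 KF) | apply/iter_autk/(sf0 kF)].
by split; [exact: (sfD KF) | rewrite iter_autD].
Qed.

Lemma iter_autX s x j : K x -> s ^: (x ^+ j) = (s ^: x) ^+ j.
Proof.
move=> Kx; elim: j => [|j IH]; first by rewrite !expr0; apply/iter_autk/(sf1 kF).
by rewrite !exprS iter_autM ?IH //; apply: (sfX KF).
Qed.

Lemma iter_aut_lin s m (c e : 'I_m -> algC) : (forall i, k (c i)) -> (forall i, K (e i)) ->
  s ^: (\sum_i c i * e i) = \sum_i c i * s ^: e i.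
Proof.
move=> kc Ke; rewrite iter_aut_sum => [|i]; last by apply: (sfM KF) => //; apply: kK.
apply: eq_bigr => i _; rewrite iter_autM //; last exact: (kK (kc i)).
by rewrite (iter_autk _ (kc i)).
Qed.

Lemma iter_aut_root s (p : {poly algC}) x : (forall i, k p`_i) -> K x ->
  root p x -> root p (s ^: x).
Proof.
move=> kp Kx; rewrite /root !horner_coef => /eqP px.
have := @iter_aut_lin s _ (fun i : 'I_(size p) => p`_i) (fun i => x ^+ i)
  (fun i => kp i) (fun i => sfX KF _ Kx).
rewrite px (iter_autk _ (sf0 kF)) => e; rewrite [X in X == 0](_ : _ = 0) //.
by rewrite [RHS]e; apply: eq_bigr => i _; rewrite iter_autX.
Qed.

Lemma iter_aut_Aint s x : K x -> x \in Aint -> s ^: x \in Aint.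
Proof.
move=> Kx Ax; have /polyOverP Ap := Ax.
apply: (@root_monic_Aint (minCpoly x)) => //; last first.
  by have [q [-> qm] _] := minCpolyP x; rewrite monic_map.
apply: iter_aut_root => //; last exact: root_minCpoly.
by move=> i; have /intrP[a ->] := Ap i; apply: (sfint kF).
Qed.

Lemma iter_autA s t x : (s + t) ^: x = s ^: (t ^: x).
Proof. by rewrite iterD. Qed.

Variables (m : nat) (e : 'I_m -> algC).
Hypothesis eB : is_basis k K e.

Let Ke i : K (e i). Proof. by have [] := eB. Qed.

Lemma basis_coord x : K x -> exists2 c : 'I_m -> algC, (forall i, k (c i)) & x = \sum_i c i * e i.
Proof. by move=> Kx; have [_ /(_ x Kx)[c [[kc xE] _]]] := eB; exists c. Qed.

Lemma basis_free (c : 'I_m -> algC) : (forall i, k (c i)) ->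
  \sum_i c i * e i = 0 -> forall i, c i = 0.
Proof.
move=> kc c0 i; have [_ /(_ 0 (sf0 KF))[b [_ bU]]] := eB.
have b1 : b = finfun c.
  apply: bU; split=> [j|]; first by rewrite ffunE.
  by rewrite -[LHS]c0; apply: eq_bigr => j _; rewrite ffunE.
have b2 : b = [ffun=> 0].
  apply: bU; split=> [j|]; first by rewrite ffunE; apply: (sf0 kF).
  by rewrite big1 // => j _; rewrite ffunE mul0r.
transitivity (b i); first by rewrite b1 ffunE.
by rewrite b2 ffunE.
Qed.

(** [x] is a root of a nonzero polynomial over [k], and so are its images under the iterates of
    [sigma]; two of these coincide, and injectivity gives a period. *)
Lemma aut_finite_orbit x : K x -> exists2 N : nat, (0 < N)%N & N ^: x = x.
Proof.
move=> Kx; have xE (i : 'I_m.+1) : exists2 c : 'I_m -> algC,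
    (forall j, k (c j)) & x ^+ i = \sum_j c j * e j.
  exact/basis_coord/(sfX KF).
have [c [kc [i0 ci0] c0]] := subfield_dep kF (ltnSn m) xE.
pose p : {poly algC} := \poly_(i < m.+1) c (inord i).
have pE i : p`_i = if (i < m.+1)%N then c (inord i) else 0 by rewrite coef_poly.
have p0 : p != 0.
  apply: contra_neq ci0 => p0; have := pE i0; rewrite p0 coef0 ltn_ord => ->.
  by rewrite inord_val.
have px : root p x.
  rewrite /root horner_poly -[X in _ == X]c0; apply/eqP/eq_bigr => i _.
  by rewrite inord_val.
have kp i : k p`_i by rewrite pE; case: ifP => _ //; apply: (sf0 kF).
pose s := [seq i ^: x | i <- iota 0 (size p)].
have : ~~ uniq s.
  apply/negP => Us; have := max_poly_roots p0 _ Us.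
  rewrite size_map size_iota ltnn => /(_ _)/negP[]//.
  by apply/allP => _ /mapP[i _ ->]; apply: iter_aut_root.
move=> /(uniqPn 0)[i [j [ij]]]; rewrite size_map size_iota => jp.
rewrite !(nth_map 0%N) ?size_iota ?(ltn_trans ij) // !nth_iota ?(ltn_trans ij) // !add0n => eij.
exists (j - i)%N; first by rewrite subn_gt0.
apply: (@iter_aut_inj i) => //; first exact: iter_autK.
by rewrite -iter_autA subnKC // ltnW.
Qed.

Definition is_aut_order N : Prop :=
  [/\ (0 < N)%N, (forall x, K x -> N ^: x = x)
    & forall i, (0 < i < N)%N -> exists2 x, K x & i ^: x <> x].

Lemma exists_aut_order : exists N, is_aut_order N.
Proof.
have mult N j x : N ^: x = x -> (j * N) ^: x = x.
  by move=> Nx; elim: j => //= j IH; rewrite mulSn iter_autA IH.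
have /choice[f fP] : forall i, exists N, (0 < N)%N /\ N ^: e i = e i.
  by move=> i; have [N N0 Ne] := aut_finite_orbit (Ke i); exists N.
pose P N := (0 < N)%N && `[< forall x, K x -> N ^: x = x >].
have exP : exists N, P N.
  exists (\prod_i f i)%N; apply/andP; split.
    by rewrite prodn_gt0 // => i; have [] := fP i.
  apply/asboolP => x /basis_coord[c kc ->]; rewrite iter_aut_lin //.
  apply: eq_bigr => i _; congr (_ * _).
  by rewrite (bigD1 i) //= mulnC mult //; have [] := fP i.
case: (ex_minnP exP) => N /andP[N0 /asboolP NK] Nmin; exists N; split=> // i /andP[i0 iN].
apply: contrapT => H; have : P i.
  rewrite /P i0; apply/asboolP => x Kx; apply: contrapT => nx; apply: H; by exists x.
by move=> /Nmin; rewrite leqNgt iN.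
Qed.

Variable N : nat.
Hypothesis ordN : is_aut_order N.

(* Dedekind's lemma: multiplying a shortest relation by a suitable element of
   [K] and subtracting produces a shorter one. *)
Lemma dedekind_indep (a : 'I_N -> algC) :
  (forall x, K x -> \sum_s a s * s ^: x = 0) -> forall s, a s = 0.
Proof.
have [w] : exists w, (#|[set s | (a s != 0)%R]%SET| < w)%N by exists (#|[set s | (a s != 0)%R]%SET|.+1).
elim: w a => [|w IH] a // lt_w a0.
have [|] := boolP [exists p : 'I_N * 'I_N, [&& (p.1 < p.2)%N, a p.1 != 0 & a p.2 != 0]].
  case/existsP => -[s t] /= /and3P[st as0 at0].
  have [y Ky ney] : exists2 y, K y & s ^: y <> t ^: y.
    have [_ _ /(_ (t - s)%N)[|y Ky ne]] := ordN.
      by rewrite subn_gt0 st (leq_ltn_trans (leq_subr _ _)).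
    exists y => // e'; apply: ne; apply: (@iter_aut_inj s) => //; first exact: iter_autK.
    by rewrite -iter_autA subnKC // ltnW.
  pose b u := a u * (u ^: y - s ^: y).
  have b0 x : K x -> \sum_u b u * u ^: x = 0.
    move=> Kx; transitivity (\sum_(u < N) a u * u ^: (y * x) - s ^: y * \sum_(u < N) a u * u ^: x).
      rewrite mulr_sumr -sumrB; apply: eq_bigr => u _; rewrite iter_autM // /b; ring.
    by rewrite !a0 ?mulr0 ?subr0 //; apply: (sfM KF).
  have bt : b t != 0 by rewrite mulf_neq0 // subr_eq0 eq_sym; apply/eqP.
  case/eqP: bt; apply: (IH b) => //; rewrite -ltnS; apply: leq_trans lt_w.
  rewrite ltnS; apply: proper_card; apply/properP; split.
    apply/fintype.subsetP => u; rewrite !inE /b; apply: contra_neq => ->; exact: mul0r.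
  by exists s; rewrite !inE // negbK /b subrr mulr0.
rewrite negb_exists => /forallP H s; apply/eqP; apply: contraT => as0.
have := a0 1 (sf1 KF); rewrite (bigD1 s) //= big1 ?addr0 => [/eqP|t ts].
  by rewrite (iter_autk _ (sf1 kF)) mulr1 (negPf as0).
have -> : a t = 0; last by rewrite mul0r.
apply/eqP; apply: contraT => at0; move: ts; rewrite neq_ltn => /orP[ts|st].
  by have := H (t, s); rewrite /= ts as0 at0.
by have := H (s, t); rewrite /= st as0 at0.
Qed.

Definition conj_basis_mx : 'M[algC]_(N, m) := \matrix_(s, i) s ^: e i.

Lemma conj_basis_free (v : 'rV[algC]_N) : v *m conj_basis_mx = 0 -> v = 0.
Proof.
move=> v0; apply/rowP => s; rewrite mxE; apply: (dedekind_indep (a := fun s => v 0 s)).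
move=> x /basis_coord[c kc ->].
under eq_bigr do rewrite iter_aut_lin // mulr_sumr.
rewrite exchange_big big1 // => i _.
transitivity (c i * (v *m conj_basis_mx) 0 i); last by rewrite v0 mxE mulr0.
by rewrite mxE mulr_sumr; apply: eq_bigr => t _; rewrite mxE; ring.
Qed.

Definition aut_trace x := \sum_(s < N) s ^: x.

Lemma periodic_sum (f : nat -> algC) j : (forall i, f (i + N)%N = f i) ->
  \sum_(s < N) f (s + j)%N = \sum_(s < N) f s.
Proof.
move=> fN; elim: j => [|j <-]; first by apply: eq_bigr => s _; rewrite addn0.
have [N0 _ _] := ordN; case: N N0 fN => // M _ fN.
rewrite big_ord_recr [RHS]big_ord_recl /= addrC; congr (_ + _).
  by rewrite -[RHS]fN; congr f; lia.
by apply: eq_bigr => s _; rewrite /bump /= add1n addSnnS.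
Qed.

Lemma aut_trace_k x : K x -> k (aut_trace x).
Proof.
move=> Kx; apply: sigma_fix; first by apply: (sfsum KF) => s _; apply: iter_autK.
rewrite -[sigma _]/(1 ^: _) iter_aut_sum => [|s]; last exact: iter_autK.
have per i : (i + N) ^: x = i ^: x.
  by have [_ NK _] := ordN; rewrite iter_autA NK.
by rewrite /aut_trace -(periodic_sum 1 per); apply: eq_bigr => s _; rewrite addnC iter_autA.
Qed.

(** Artin's theorem. The rows of conjugates are independent, so N <= m. If N < m, some nontrivial
    combination of the columns with coefficients in [K] vanishes; applying the iterates of [sigma]
    and summing turns the coefficients into traces, which lie in [k]. Hence all traces vanish,
    contrary to Dedekind's lemma. *)
Lemma aut_order_basis : N = m.
Proof.
apply/eqP; rewrite eqn_leq; apply/andP; split.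
  have : row_free conj_basis_mx.
    by apply/inj_row_free => v; apply: conj_basis_free.
  by move=> /eqP <-; apply: rank_leq_col.
rewrite leqNgt; apply/negP => Nm; have [N0 NK _] := ordN.
have [c [Kc [i0 ci0] c0]] := subfield_ker KF Nm (fun i (s : 'I_N) => iter_autK s (Ke i)).
have c0' (t : nat) : \sum_i t ^: c i * e i = 0.
  have NjK j x : K x -> (j * N) ^: x = x.
    by move=> Kx; elim: j => //= j IH; rewrite mulSn iter_autA IH NK.
  (* The residue of -t modulo N, so that t + s is a multiple of the order. *)
  pose s : 'I_N := Ordinal (ltn_pmod (N - t %% N) N0).
  have sE : exists j, (t + s = j * N)%N.
    have tN := ltn_pmod t N0; have Dt := divn_eq t N.
    rewrite /s /=; have [e0|e0] := eqVneq (t %% N)%N 0%N.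
      by exists (t %/ N)%N; rewrite e0 subn0 modnn; lia.
    exists (t %/ N).+1%N; rewrite modn_small ?ltn_subrL ?N0 ?lt0n ?e0 // mulSn; lia.
  have [j tsE] := sE.
  have := congr1 (iter t sigma) (c0 s); rewrite (iter_autk _ (sf0 kF)) iter_aut_sum; last first.
    by move=> i; apply: (sfM KF) => //; apply: iter_autK.
  move=> h; rewrite -[RHS]h; apply: eq_bigr => i _; rewrite iter_autM //; last exact: iter_autK.
  by rewrite -iter_autA tsE NjK.
have tr0 z : K z -> aut_trace z = 0.
  move=> Kz; have Kzc i : K (z / c i0 * c i) by apply: (sfM KF) => //; apply: (sfdiv KF).
  have := basis_free (fun i => aut_trace_k (Kzc i)) _ i0; rewrite divfK //; apply.
  under eq_bigr do rewrite mulr_suml.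
  rewrite exchange_big big1 // => s _ /=.
  transitivity (s ^: (z / c i0) * \sum_i s ^: c i * e i); last by rewrite c0' mulr0.
  rewrite mulr_sumr; apply: eq_bigr => i _; rewrite iter_autM ?mulrA //.
  by apply: (sfdiv KF).
have one0 x : K x -> \sum_(s < N) 1 * s ^: x = 0.
  by move=> Kx; rewrite -[RHS](tr0 x Kx); apply: eq_bigr => s _; exact: mul1r.
by have /eqP := dedekind_indep one0 (Ordinal N0); rewrite oner_eq0.
Qed.

End Cyclic.

(** * Lagrange resolvents *)

Section Kummer.
Variables (k K : set algC) (sigma : algC -> algC).
Hypothesis kF : is_subfield k.
Hypothesis KF : is_subfield K.
Hypothesis kK : k `<=` K.
Hypothesis sigma_aut : is_automorphism k K sigma.
Hypothesis sigma_fix : forall x, K x -> sigma x = x -> k x.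
Variables (l : nat) (zeta : algC).
Hypothesis ordl : is_aut_order K sigma l.
Hypothesis zetaP : l.-primitive_root zeta.

Local Notation F := (adjoin k zeta).
Let FF : is_subfield F := is_subfield_adjoin k zeta.
Let Fzeta i : F (zeta ^+ i). Proof. by apply: (sfX FF); exact: adjoin_gen. Qed.
Let kF' x : k x -> F x. Proof. exact: sub_adjoin. Qed.
Let l_gt0 : (0 < l)%N. Proof. by case: ordl. Qed.

Local Notation "s ^: x" := (iter s sigma x) (at level 30).

Let itK := iter_autK sigma_aut.

(** The matrix of conjugates diagonalizes the multiplication by [x], whatever the basis, so every
    matrix allowed in [rel_trace] has the same trace. *)
Lemma rel_traceE m (e : 'I_m -> algC) x : is_basis k K e -> K x ->
  rel_trace k K x = \sum_(s < l) s ^: x.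
Proof.
move=> eB Kx; rewrite /rel_trace; set S := [set t | _].
have SP t : S t -> t = \sum_(s < l) s ^: x.
  move=> [n [f [M [fB kM xf ->]]]].
  have ln := aut_order_basis kF KF kK sigma_aut sigma_fix fB ordl.
  subst n; pose E := conj_basis_mx sigma f l.
  have Kf i : K (f i) by case: fB.
  pose D : 'M[algC]_l := diag_mx (\row_(i < l) ((i : nat) ^: x)).
  have DE : D *m E = E *m M^T.
    apply/matrixP => i j; rewrite mul_diag_mx !mxE -(iter_autM sigma_aut) // xf.
    rewrite (iter_aut_lin kF KF kK sigma_aut) //; apply: eq_bigr => h _.
    by rewrite !mxE mulrC.
  have EU : E \in unitmx.
    rewrite -row_free_unit; apply/inj_row_free => v.
    exact: (conj_basis_free kF KF kK sigma_aut fB ordl).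
  have : \tr D = \tr M.
    have -> : D = E *m M^T *m invmx E by rewrite -DE mulmxK.
    by rewrite -(mxtrace_tr M) -mulmxA [LHS]mxtrace_mulC mulmxKV.
  by move=> <-; rewrite mxtrace_diag; apply: eq_bigr => s _; rewrite mxE.
have Ke i : K (e i) by case: eB.
have /choice[M MP] : forall i, exists c : 'I_m -> algC, (forall j, k (c j)) /\ x * e i = \sum_j c j * e j.
  by move=> i; have [c kc xe] := basis_coord eB (sfM KF Kx (Ke i)); exists c.
have St : S (\tr (\matrix_(i, j) M i j)).
  exists m, e, (\matrix_(i, j) M i j); split=> // [i j|i]; rewrite ?mxE; have [] := MP i => //.
  by move=> _ ->; apply: eq_bigr => j _; rewrite mxE.
by case: xgetP => [t -> /SP|/(_ _ St)].
Qed.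

Definition resolvent j x := \sum_(s < l) zeta ^+ (j * s) * s ^: x.

Let zperM i j : zeta ^+ (i + j * l) = zeta ^+ i.
Proof. by rewrite exprD mulnC exprM (prim_expr_order zetaP) expr1n mulr1. Qed.

Lemma resolvent_sum j m (c e : 'I_m -> algC) : (forall i, k (c i)) -> (forall i, K (e i)) ->
  resolvent j (\sum_i c i * e i) = \sum_i c i * resolvent j (e i).
Proof.
move=> kc Ke; rewrite /resolvent.
under eq_bigr do rewrite (iter_aut_lin kF KF kK sigma_aut) // mulr_sumr.
rewrite exchange_big; apply: eq_bigr => i _; rewrite mulr_sumr.
by apply: eq_bigr => s _; ring.
Qed.

(** The substitution t = s + u in the second sum turns the product into a combination of resolvents
    of elements x sigma^u(y) of [K]. *)
Lemma resolventM i j x y : K x -> K y ->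
  resolvent i x * resolvent j y =
  \sum_(u < l) zeta ^+ (j * u) * resolvent (i + j) (x * u ^: y).
Proof.
move=> Kx Ky; rewrite /resolvent mulr_suml.
under [RHS]eq_bigr do rewrite mulr_sumr.
rewrite exchange_big; apply: eq_bigr => s _ /=.
pose f (t : nat) := zeta ^+ (j * t) * t ^: y.
have fper t : f (t + l)%N = f t.
  rewrite /f mulnDr zperM; congr (_ * _).
  by have [_ lK _] := ordl; rewrite iter_autA lK.
rewrite -(periodic_sum ordl s fper) mulr_sumr; apply: eq_bigr => u _.
rewrite /f (iter_autM sigma_aut) //; last exact: itK.
by rewrite addnC iter_autA mulnDr mulnDl !exprD; ring.
Qed.

Lemma resolvent0_k x : K x -> k (resolvent 0 x).
Proof.
move=> Kx; rewrite (_ : resolvent 0 x = aut_trace sigma l x).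
  exact: (aut_trace_k kF KF sigma_aut sigma_fix ordl).
by apply: eq_bigr => s _; rewrite mul0n expr0 mul1r.
Qed.

Lemma resolvent_Aint j x : K x -> x \in Aint -> resolvent j x \in Aint.
Proof.
move=> Kx Ax; apply: rpred_sum => s _.
by rewrite rpredM ?rpredX ?(Aint_prim_root zetaP) // (iter_aut_Aint kF KF kK sigma_aut).
Qed.

Lemma resolvent_inv x : K x -> l%:R * x = \sum_(j < l) resolvent j x.
Proof.
move=> Kx; rewrite /resolvent exchange_big (bigD1 (Ordinal l_gt0)) //= [X in _ + X]big1 ?addr0.
  under eq_bigr do rewrite muln0 expr0 mul1r.
  by rewrite sumr_const card_ord mulr_natl.
move=> s s0; rewrite -mulr_suml.
under eq_bigr do rewrite mulnC exprM.
have zs1 : zeta ^+ s != 1.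
  rewrite -(prim_order_dvd zetaP); apply/negP => /dvdn_leq.
  by rewrite lt0n leqNgt ltn_ord => /(_ s0).
suff -> : \sum_(j < l) (zeta ^+ s) ^+ j = 0 by rewrite mul0r.
have := subrX1 (zeta ^+ s) l; rewrite -exprM mulnC exprM (prim_expr_order zetaP) expr1n subrr.
by move/esym/eqP; rewrite mulf_eq0 subr_eq0 (negPf zs1) => /eqP.
Qed.

Variables (m : nat) (e : 'I_m -> algC).
Hypothesis eB : is_basis k K e.
Let Ke i : K (e i). Proof. by have [] := eB. Qed.

(** For prime [l], this is the eigenspace for zeta^-j of [sigma], extended to K(zeta) so as to fix
    zeta. Defined as a span over k(zeta), it makes the extension unnecessary: [resolvent_spanM]
    expresses the grading, and the part of degree [l] falls back into k(zeta). *)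
Definition resolvent_span j z := exists2 c : 'I_m -> algC,
  (forall h, F (c h)) & z = \sum_h c h * resolvent j (e h).

Lemma resolvent_in_span j x : K x -> resolvent_span j (resolvent j x).
Proof.
move=> /(basis_coord eB)[c kc ->]; exists c; first by move=> h; apply: kF'.
exact: resolvent_sum.
Qed.

Lemma resolvent_span_lin j (I : finType) (c z : I -> algC) : (forall i, F (c i)) ->
  (forall i, resolvent_span j (z i)) -> resolvent_span j (\sum_i c i * z i).
Proof.
move=> Fc zj; have /choice[b bP] : forall i, exists b : 'I_m -> algC,
    (forall h, F (b h)) /\ z i = \sum_h b h * resolvent j (e h).
  by move=> i; have [b Fb zE] := zj i; exists b.
exists (fun h => \sum_i c i * b i h).
  by move=> h; apply: (sfsum FF) => i _; apply: (sfM FF) => //; have [] := bP i.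
under [RHS]eq_bigr do rewrite mulr_suml.
rewrite exchange_big; apply: eq_bigr => i _; rewrite (bP i).2 mulr_sumr.
by apply: eq_bigr => h _; rewrite mulrA.
Qed.

Lemma resolvent_spanM i j y z : resolvent_span i y -> resolvent_span j z ->
  resolvent_span (i + j) (y * z).
Proof.
move=> [b Fb ->] [c Fc ->]; rewrite mulr_suml.
pose w (h : 'I_m) := resolvent i (e h) * \sum_g c g * resolvent j (e g).
rewrite (eq_bigr (fun h => b h * w h)) => [|h _]; last by rewrite /w mulrA.
apply: resolvent_span_lin => // h; rewrite /w mulr_sumr.
rewrite (eq_bigr (fun g => c g * (resolvent i (e h) * resolvent j (e g)))) => [|g _]; last by ring.
apply: resolvent_span_lin => // g; rewrite resolventM //.
apply: resolvent_span_lin => // u; apply: resolvent_in_span.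
by apply: (sfM KF) => //; apply: itK.
Qed.

Lemma resolvent_span_mod z : resolvent_span l z -> F z.
Proof.
move=> [c Fc ->]; apply: (sfsum FF) => h _; apply: (sfM FF) => //; apply: kF'.
rewrite (_ : resolvent l _ = resolvent 0 (e h)); first exact: resolvent0_k.
apply: eq_bigr => s _; rewrite mul0n expr0; congr (_ * _).
by rewrite exprM (prim_expr_order zetaP) expr1n.
Qed.

Lemma resolvent_span_exp z j : resolvent_span 1 z -> (0 < j)%N -> resolvent_span j (z ^+ j).
Proof.
move=> z1; case: j => // j _; elim: j => [|j IH]; first by rewrite expr1.
by rewrite exprS -[j.+2]add1n; apply: resolvent_spanM.
Qed.

(** Dedekind's lemma with the coefficients zeta^s shows that not all resolvents vanish; clearing the
    denominator of [x] makes it integral. *)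
Lemma resolvent1_neq0 : exists x, [/\ K x, x \in Aint & resolvent 1 x != 0].
Proof.
have [x Kx rx] : exists2 x, K x & resolvent 1 x != 0.
  apply: contrapT => H.
  have := dedekind_indep kF KF sigma_aut ordl (a := fun s => zeta ^+ s) _ (Ordinal l_gt0).
  rewrite expr0 => /(_ _)/eqP; rewrite oner_eq0 => h; have : false; last by [].
  apply: h => x Kx; have <- : resolvent 1 x = \sum_(s < l) zeta ^+ s * s ^: x.
    by apply: eq_bigr => s _; rewrite mul1n.
  by apply/eqP; apply: contraT => rx; case: H; exists x.
have [N N0 AN] := Aint_multiple x; exists (N%:R * x); split=> //.
  by apply: (sfM KF) => //; exact: (sfnat KF).
have -> : resolvent 1 (N%:R * x) = N%:R * resolvent 1 x.
  have := @resolvent_sum 1 1 (fun=> N%:R) (fun=> x) (fun=> sfnat kF N) (fun=> Kx).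
  by rewrite !big_ord1.
by rewrite mulf_neq0 // pnatr_eq0 -lt0n.
Qed.

Variable beta : algC.
Hypothesis beta1 : resolvent_span 1 beta.
Hypothesis beta0 : beta != 0.

Lemma kummer_gen_exp : F (beta ^+ l).
Proof. by apply: resolvent_span_mod; apply: resolvent_span_exp. Qed.

Lemma resolvent_kummer j x : (j < l)%N -> K x -> F (resolvent j x * beta ^+ (l - j)).
Proof.
move=> jl Kx; apply: resolvent_span_mod; rewrite -{1}(subnKC (ltnW jl)).
apply: resolvent_spanM; first exact: resolvent_in_span.
by apply: resolvent_span_exp; rewrite ?subn_gt0.
Qed.

(** Fourier inversion writes l x as the sum of its resolvents, the j-th of which lies in beta^j
    k(zeta). *)
Lemma kummer_span x : K x -> exists2 c : 'I_l -> algC, (forall j, F (c j)) &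
  x = \sum_j c j * beta ^+ j.
Proof.
move=> Kx; have l0 : l%:R != 0 :> algC by rewrite pnatr_eq0 -lt0n.
exists (fun j : 'I_l => l%:R^-1 * (resolvent j x * beta ^+ (l - j)) / beta ^+ l) => [j|].
  apply: (sfdiv FF); last exact: kummer_gen_exp.
  apply: (sfM FF); last exact: resolvent_kummer.
  by apply: (sfV FF); exact: (sfnat FF).
apply: (mulfI l0); rewrite resolvent_inv // mulr_sumr; apply: eq_bigr => j _.
have -> : beta ^+ l = beta ^+ (l - j) * beta ^+ j by rewrite -exprD subnK // ltnW.
have b1 : beta ^+ (l - j) != 0 by rewrite expf_neq0.
have b2 : beta ^+ j != 0 by rewrite expf_neq0.
by field; rewrite l0 b1 b2.
Qed.

End Kummer.

(** The residues of the -j run over 0, ..., l - 1. Their sum is the total exponent of the scaling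
    factor in the determinant of [kummer_mx]; it is doubled because that determinant gets
    squared. *)
Lemma sum_neg_mod l : (0 < l)%N -> (2 * \sum_(j < l) (l - j) %% l = l * l.-1)%N.
Proof.
case: l => // n _.
rewrite big_ord_recl subn0 modnn add0n.
have -> : (\sum_(i < n) (n.+1 - lift ord0 i) %% n.+1 = \sum_(i < n) i.+1)%N.
  rewrite (reindex_inj rev_ord_inj); apply: eq_bigr => i _ /=.
  rewrite /bump /= add1n subSS subKn ?modn_small ?ltnS //; exact: ltn_ord.
elim: n => [|n IH]; first by rewrite big_ord0.
by rewrite big_ord_recr /= mulnDr IH; lia.
Qed.

(** * The discriminant and the matrix of resolvents *)

Section KummerDiscriminant.
Variables (k K : set algC) (sigma : algC -> algC).
Hypothesis kF : is_subfield k.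
Hypothesis KF : is_subfield K.
Hypothesis kK : k `<=` K.
Hypothesis sigma_aut : is_automorphism k K sigma.
Hypothesis sigma_fix : forall x, K x -> sigma x = x -> k x.
Variables (l : nat) (zeta : algC).
Hypothesis ordl : is_aut_order K sigma l.
Variable e : 'I_l -> algC.
Hypothesis eB : is_basis k K e.
Let Ke i : K (e i). Proof. by have [] := eB. Qed.

Definition disc_mx : 'M[algC]_l := \matrix_(i, j) rel_trace k K (e i * e j).
Definition fourier_mx : 'M[algC]_l := \matrix_(j, s) zeta ^+ (j * s).
Definition kummer_mx b : 'M[algC]_l :=
  \matrix_(j, i) (resolvent sigma l zeta j (e i) * b ^+ ((l - j) %% l)).

Lemma disc_mxE : disc_mx = (conj_basis_mx sigma e l)^T *m conj_basis_mx sigma e l.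
Proof.
apply/matrixP => i j; rewrite !mxE.
rewrite (rel_traceE kF KF kK sigma_aut sigma_fix ordl eB); last exact: (sfM KF).
by apply: eq_bigr => s _; rewrite (iter_autM sigma_aut) // !mxE.
Qed.

Lemma det_disc_mx_neq0 : \det disc_mx != 0.
Proof.
rewrite disc_mxE det_mulmx det_tr -expr2 expf_neq0 // -unitfE -unitmxE -row_free_unit.
by apply/inj_row_free => v; exact: (conj_basis_free kF KF kK sigma_aut eB ordl).
Qed.

(** The matrix is a diagonal scaling times the Fourier matrix times the matrix of conjugates, and
    the square of the last determinant is the discriminant. *)
Lemma det_kummer_mx b :
  \det (kummer_mx b) ^+ 2 = (b ^+ l) ^+ l.-1 * \det fourier_mx ^+ 2 * \det disc_mx.
Proof.
have -> : kummer_mx b = diag_mx (\row_j b ^+ ((l - (j : nat)) %% l)) *m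
    (fourier_mx *m conj_basis_mx sigma e l) :> 'M[algC]_l.
  apply/matrixP => j i; rewrite mul_diag_mx !mxE mulrC; congr (_ * _).
  by apply: eq_bigr => s _; rewrite !mxE.
rewrite !det_mulmx disc_mxE det_mulmx det_tr det_diag.
have -> : \prod_i (\row_(j < l) b ^+ ((l - (j : nat)) %% l)) (0 : 'I_1) i =
    b ^+ (\sum_(j < l) (l - j) %% l)%N.
  by rewrite expr_sum; apply: eq_bigr => j _; rewrite mxE.
have -> : (b ^+ l) ^+ l.-1 = (b ^+ (\sum_(j < l) (l - j) %% l)%N) ^+ 2.
  rewrite -!exprM; congr (_ ^+ _); rewrite [RHS]mulnC.
  by have [l0 _ _] := ordl; rewrite sum_neg_mod.
by ring.
Qed.

(** Orthogonality of characters: [B], with exponents s (l - j) standing for - s j, is [l] times the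
    inverse of the Fourier matrix. *)
Lemma det_fourier_mx_dvd : l.-primitive_root zeta ->
  exists z, [/\ adjoin k zeta z, z \in Aint & \det fourier_mx * z = l%:R ^+ l].
Proof.
move=> zetaP; have FF := is_subfield_adjoin k zeta; have Az := Aint_prim_root zetaP.
pose B : 'M[algC]_l := \matrix_(s, j) zeta ^+ (s * (l - j)).
exists (\det B); split.
- apply: (sfdet FF) => i j; rewrite mxE; apply: (sfX FF); exact: adjoin_gen.
- by apply: Aint_det => i j; rewrite mxE rpredX.
rewrite -det_mulmx (_ : fourier_mx *m B = l%:R%:M) ?det_scalar //.
have l0 := prim_order_gt0 zetaP.
apply/matrixP => i j; rewrite !mxE.
under eq_bigr do rewrite !mxE (mulnC i) -exprD -mulnDr mulnC exprM.
have [->|ij] := eqVneq i j.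
  rewrite subnKC 1?ltnW // (prim_expr_order zetaP) mulr1n.
  by under eq_bigr do rewrite expr1n; rewrite sumr_const card_ord.
rewrite mulr0n; have zs1 : zeta ^+ (i + (l - j)) != 1.
  rewrite -(prim_order_dvd zetaP); apply: contra_neqN ij => dv; apply/val_inj/eqP => /=.
  have : (i + (l - j) + j = 0 + j %[mod l])%N.
    by apply/eqP; rewrite eqn_modDr mod0n -/(dvdn _ _).
  by rewrite -addnA subnK 1?ltnW // modnDr add0n !modn_small // => ->.
have := subrX1 (zeta ^+ (i + (l - j))) l; rewrite -exprM mulnC exprM.
rewrite (prim_expr_order zetaP) expr1n subrr.
by move/esym/eqP; rewrite mulf_eq0 subr_eq0 (negPf zs1) => /eqP.
Qed.

End KummerDiscriminant.

Lemma is_nf_tower n k K m (e : 'I_m -> algC) : is_nf n k -> is_subfield K ->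
  k `<=` K -> spans k K e -> is_nf (n * m) K.
Proof.
move=> [kF [f [kf fP]]] KF kK [Ke eP]; split=> //.
have [g gK gK'] := curry_mxvec_bij n m.
exists (fun h => f (g h).1 * e (g h).2); split=> [h|x Kx].
  by apply: (sfM KF) => //; apply: kK.
have [c kc ->] := eP x Kx.
have /choice[b bP] : forall j, exists b : 'I_n -> algC,
    (forall i, [set` Crat] (b i)) /\ c j = \sum_i b i * f i.
  by move=> j; have [b Qb cE] := fP _ (kc j); exists b.
exists (fun h => b (g h).2 (g h).1); first by move=> h; have [] := bP (g h).2.
rewrite (reindex _ (curry_mxvec_bij n m)) /=.
rewrite (eq_bigr (fun p : 'I_n * 'I_m => b p.2 p.1 * (f p.1 * e p.2))); last first.
  by move=> [i j] _ /=; have /= -> := gK (i, j) isT.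
rewrite -(pair_big xpredT xpredT (fun i j => b j i * (f i * e j))) exchange_big /=.
apply: eq_bigr => j _; rewrite (bP j).2 mulr_suml; apply: eq_bigr => i _; by rewrite mulrA.
Qed.

Lemma is_nf_adjoin_root n k l zeta : is_nf n k -> l.-primitive_root zeta ->
  exists2 N, (N <= n * l)%N & is_nf N (adjoin k zeta).
Proof.
move=> kN zetaP; have [d [nu [d0 inj fix_nu span]]] := exists_conjugates zeta kN.
have dl : (d <= l)%N.
  have /choice[a aP] : forall j, exists a : 'I_l, nu j zeta = zeta ^+ a.
    move=> j; have zl : nu j zeta ^+ l = 1 by rewrite -rmorphXn (prim_expr_order zetaP) rmorph1.
    by have [a ->] := prim_rootP zetaP zl; exists a.
  have : injective a by move=> i j e; apply: inj; rewrite !aP e.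
  by move/leq_card; rewrite !card_ord.
exists (n * d)%N; first by rewrite leq_mul2l dl orbT.
apply: (is_nf_tower kN (is_subfield_adjoin _ _) (@sub_adjoin _ _)).
split; last by move=> x /span[c kc ->]; exists c => //; apply: eq_bigr.
by move=> i; apply: (sfX (is_subfield_adjoin _ _)); exact: adjoin_gen.
Qed.

Lemma not_in_moved n k x : is_nf n k -> ~ k x ->
  exists2 nu : {rmorphism algC -> algC}, (forall y, k y -> nu y = y) & nu x <> x.
Proof.
move=> kN nkx; have kF := kN.1.
have [d [nu [d0 inj fix_nu span]]] := exists_conjugates x kN.
case: d => [//|[|d]] in nu d0 inj fix_nu span *.
  case: nkx; have [c kc ->] := span x (@adjoin_gen _ _).
  by rewrite big_ord1 expr0 mulr1.
have [e0|e0] := eqVneq (nu ord0 x) x; last by exists (nu ord0); [exact: fix_nu | exact/eqP].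
exists (nu ord_max); first exact: fix_nu.
by rewrite -[X in _ = X]e0 => /inj /(congr1 val).
Qed.

Lemma poly_eq_nat (p q : {poly algC}) : (forall i : nat, p.[i%:R] = q.[i%:R]) -> p = q.
Proof.
move=> pq; apply/eqP; rewrite -subr_eq0; apply: contraT => ne0.
pose s : seq algC := [seq i%:R | i <- iota 0 (size (p - q))].
have Us : uniq s.
  by rewrite map_inj_uniq ?iota_uniq // => i j /eqP; rewrite eqr_nat => /eqP.
have := max_poly_roots ne0 _ Us; rewrite size_map size_iota ltnn; apply.
by apply/allP => _ /mapP[i _ ->]; rewrite /root hornerD hornerN pq subrr.
Qed.

Section CyclicExtension.
Variables (n : nat) (k : set algC) (l : nat) (zeta : algC).
Hypothesis kN : is_nf n k.
Hypothesis lp : prime l.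
Hypothesis zetaP : l.-primitive_root zeta.
Let kF : is_subfield k := kN.1.
Local Notation F := (adjoin k zeta).
Let FF : is_subfield F := is_subfield_adjoin k zeta.

Lemma cyclic_generator K : is_cyclic_extension k l K ->
  exists sigma, [/\ is_automorphism k K sigma, (forall x, K x -> sigma x = x -> k x),
    is_aut_order K sigma l & forall t, is_automorphism k K t ->
        exists n, forall x, K x -> t x = iter n sigma x].
Proof.
move=> [KF kK [e eB] [_ gal] [s saut sgen]]; exists s.
have sfix x : K x -> s x = x -> k x.
  move=> Kx sx; rewrite -gal; split=> // t /sgen[i ->] //.
  by elim: i => //= i ->.
split=> //; have [N ordN] := exists_aut_order kF KF kK saut eB.
by rewrite -(aut_order_basis kF KF kK saut sfix eB ordN).
Qed.

(* [f = \prod_s ('X - sigma ^ s y)] takes values in [k] at the natural numbers,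
   hence is fixed by [nu]. *)
Lemma cyclic_normal K sigma (nu : {rmorphism algC -> algC}) : is_subfield K -> k `<=` K ->
  is_automorphism k K sigma -> (forall x, K x -> sigma x = x -> k x) ->
  is_aut_order K sigma l -> (forall x, k x -> nu x = x) -> is_automorphism k K nu.
Proof.
move=> KF kK saut sfix ord fix_nu; have [l0 lK _] := ord.
pose orb y := [seq iter s sigma y | s <- iota 0 l].
have orbK y z : K y -> z \in orb y -> K z.
  by move=> Ky /mapP[s _ ->]; apply: (iter_autK saut).
have orbP y : K y -> nu y \in orb y.
  move=> Ky; pose f := \prod_(z <- orb y) ('X - z%:P).
  have fnat (i : nat) : k f.[i%:R].
    have fE : f.[i%:R] = \prod_(s < l) (i%:R - iter s sigma y).
      rewrite /f /orb big_map horner_prod -{1}[l]subn0 big_mkord.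
      by apply: eq_bigr => s _; rewrite hornerXsubC.
    have Ki s : K (i%:R - iter s sigma y).
      by apply: (sfB KF); [exact: (sfnat KF) | exact: (iter_autK saut)].
    rewrite fE; apply: sfix; first by apply: (sfprod KF).
    have sub x : K x -> sigma (i%:R - x) = i%:R - sigma x.
      move=> Kx; have ki : k (i%:R) := sfnat kF i.
      have := iter_aut_lin kF KF kK saut 1 (c := fun j : 'I_2 => if j == 0 then i%:R else -1)
        (e := fun j : 'I_2 => if j == 0 then 1 else x).
      rewrite !big_ord_recl !big_ord0 /= !addr0 !mulr1 !mulN1r.
      have s1 : sigma 1 = 1 by have [_ _ _] := saut; apply; exact: (sf1 kF).
      rewrite s1 mulr1; apply=> j; case: ifP => _ //.
      - by apply: (sfN kF); exact: (sf1 kF).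
      - exact: (sf1 KF).
    have mulS (r : seq nat) : sigma (\prod_(s <- r) (i%:R - iter s sigma y)) =
        \prod_(s <- r) (i%:R - iter s.+1 sigma y).
      have [_ _ sM sk] := saut.
      elim: r => [|s r IH]; first by rewrite !big_nil; apply: sk; exact: (sf1 kF).
      rewrite !big_cons sM ?IH ?sub //; last by apply: (sfprod KF).
      exact: (iter_autK saut).
    rewrite -(big_mkord xpredT (fun s => i%:R - iter s sigma y)) mulS big_mkord.
    rewrite -(prednK l0) in lK *.
    rewrite big_mkord big_ord_recr [RHS]big_ord_recl /= mulrC; congr (_ * _).
    by have /= -> := lK _ Ky.
  have nuf : map_poly nu f = f.
    apply: poly_eq_nat => i; rewrite -{1}(rmorph_nat nu i) horner_map /=.
    exact/fix_nu/fnat.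
  rewrite -root_prod_XsubC -/f -nuf fmorph_root /f root_prod_XsubC.
  by apply/mapP; exists 0%N; rewrite // mem_iota.
have nuK y : K y -> K (nu y) by move=> Ky; apply: (orbK y) => //; apply: orbP.
split=> [|x y _ _|x y _ _|x]; [|exact: rmorphD|exact: rmorphM|exact: fix_nu].
split; [by move=> x; apply: nuK | by move=> x y _ _ /fmorph_inj | move=> y Ky].
have yo : y \in undup (orb y) by rewrite mem_undup; apply/mapP; exists 0%N; rewrite // mem_iota.
have sub : {subset [seq nu z | z <- undup (orb y)] <= undup (orb y)}.
  move=> w /mapP[z]; rewrite !mem_undup => zo ->{w}.
  have := orbP z (orbK y z Ky zo); case/mapP: zo => s _ ->.
  case/mapP => t _ ->; rewrite -iter_autA.
  have -> : iter (t + s) sigma y = iter ((t + s) %% l) sigma y.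
    rewrite {1}(divn_eq (t + s) l) addnC iter_autA; congr iter.
    elim: (_ %/ _)%N => //= j IH; rewrite mulSn iter_autA IH lK //.
  by apply/mapP; exists ((t + s) %% l)%N; rewrite // mem_iota ltn_mod.
have Us : uniq [seq nu z | z <- undup (orb y)].
  by rewrite map_inj_uniq ?undup_uniq //; apply: fmorph_inj.
have [|_ e] := uniq_min_size Us sub; first by rewrite size_map.
have : y \in [seq nu z | z <- undup (orb y)] by rewrite e.
by case/mapP => z; rewrite mem_undup => zo ->; exists z => //; apply: orbK zo.
Qed.

End CyclicExtension.

(** Encodes K(zeta) = k(zeta)(beta) by one membership in each direction, without a degree. *)
Definition kummer_data (k K : set algC) l zeta alpha : Prop :=
  exists beta, [/\ beta ^+ l = alpha, alpha != 0, adjoin K zeta beta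
    & forall y, K y -> exists2 c : 'I_l -> algC,
        (forall j, adjoin k zeta (c j)) & y = \sum_j c j * beta ^+ j].

Definition disc_gen (k K : set algC) d : Prop := exists n (e : 'I_n -> algC),
    [/\ is_basis k K e, (forall i, integers K (e i))
      & d = \det (\matrix_(i, j) rel_trace k K (e i * e j))].

(* [d] is the discriminant of an integral basis of [K] and [M] the matrix of its
   Lagrange resolvents, with the row [j] scaled into [k(zeta)] by a power of the
   [l]-th root of [alpha]; [f] is the determinant of the Fourier matrix. *)
Definition kummer_disc (k : set algC) l zeta alpha d : Prop :=
  exists (M : 'M[algC]_l) f f',
  [/\ (forall j i, integers (adjoin k zeta) (M j i)),
      (forall j i, exists2 w, integers (adjoin k zeta) w &
         M j i ^+ l = w * alpha ^+ ((l - j) %% l)),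
      integers (adjoin k zeta) f /\ integers (adjoin k zeta) f', f * f' = l%:R ^+ l
    & \det M ^+ 2 = alpha ^+ l.-1 * f ^+ 2 * d].

Section KummerTheory.
Variables (n : nat) (k : set algC) (l : nat) (zeta : algC).
Hypothesis kN : is_nf n k.
Hypothesis lp : prime l.
Hypothesis zetaP : l.-primitive_root zeta.
Let kF : is_subfield k := kN.1.
Local Notation F := (adjoin k zeta).
Let FF : is_subfield F := is_subfield_adjoin k zeta.

(* An automorphism [nu] over [K] satisfies [nu ^ (l - 1) = id] on [K(zeta)], and
   [nu ^ l = id] on [K'], hence fixes the subfield [K'] of [K(zeta)]. *)
Lemma kummer_sub K K' alpha alpha' gamma : is_cyclic_extension k l K ->
  is_cyclic_extension k l K' -> kummer_data k K l zeta alpha ->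
  kummer_data k K' l zeta alpha' -> F gamma -> gamma != 0 ->
  alpha' = alpha * gamma ^+ l -> K' `<=` K.
Proof.
move=> cK cK' [b [ba a0 Lb _]] [b' [ba' a'0 _ span']] Fg g0 aa' y K'y.
have [KF kK [e eB] _ _] := cK; have [K'F kK' _ _ _] := cK'.
have KN : is_nf (n * l) K.
  apply: (is_nf_tower kN KF kK (e := e)); split; first by case: eB.
  exact: basis_coord eB.
have LF := is_subfield_adjoin K zeta.
have FL : F `<=` adjoin K zeta.
  apply: adjoin_min => //; last exact: adjoin_gen.
  by move=> x /kK Kx; apply: sub_adjoin.
have l0 := prime_gt0 lp.
have b0 : b != 0 by apply: contra_neq a0 => b0; rewrite -ba b0 expr0n gtn_eqF.
have Lb' : adjoin K zeta b'.
  have : (b' / (b * gamma)) ^+ l = 1.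
    by rewrite exprMn exprVn ba' exprMn ba -aa' mulfV.
  case/(prim_rootP zetaP)=> i bi.
  have -> : b' = zeta ^+ i * (b * gamma) by rewrite -bi divfK // mulf_neq0.
  apply: (sfM LF); first by apply: (sfX LF); exact: adjoin_gen.
  by apply: (sfM LF) => //; apply: FL.
have Ly : adjoin K zeta y.
  have [c Fc ->] := span' y K'y; apply: (sfsum LF) => j _.
  by apply: (sfM LF); [apply: FL; apply: Fc | apply: (sfX LF)].
apply: contrapT => nKy; have [nu fix_nu nuy] := not_in_moved KN nKy.
have fix_k x : k x -> nu x = x by move=> /kK /fix_nu.
have [i zi] : exists i : nat, nu zeta = zeta ^+ i.
  have zl : nu zeta ^+ l = 1 by rewrite -rmorphXn (prim_expr_order zetaP) rmorph1.
  by have [i ->] := prim_rootP zetaP zl; exists i.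
have z1 : zeta != 1.
  rewrite -[zeta]expr1 -(prim_order_dvd zetaP) dvdn1.
  by apply: contraTneq (prime_gt1 lp) => ->.
have li : ~~ (l %| i)%N.
  apply/negP; rewrite (prim_order_dvd zetaP) -zi => /eqP nz.
  by case/eqP: z1; apply: (fmorph_inj nu); rewrite nz rmorph1.
have iter_z j : iter j nu zeta = zeta ^+ (i ^ j).
  by elim: j => [|j IH]; rewrite ?expr1 //= IH rmorphXn zi -exprM expnS.
have iter_rm j : exists tau : {rmorphism algC -> algC}, forall x, tau x = iter j nu x.
  elim: j => [|j [tau tauE]]; first by exists idfun.
  by exists (nu \o tau) => x /=; rewrite tauE.
have [tau tauE] := iter_rm l.-1.
have fixL x : adjoin K zeta x -> tau x = x.
  pose S := [set x | tau x = x].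
  suff : adjoin K zeta `<=` S by apply.
  apply: adjoin_min.
  - split=> [|u v|u v]; rewrite ?inE /S /=; first exact: rmorph1.
      by move=> uE vE; rewrite rmorphB /= uE vE.
    by move=> uE vE; rewrite fmorph_div /= uE vE.
  - by move=> u Ku; rewrite /S /= tauE; elim: l.-1 => //= j ->; apply: fix_nu.
  - rewrite /S /= tauE iter_z -(prim_expr_mod zetaP).
    have -> : (i ^ l.-1 = 1 %[mod l])%N.
      by rewrite -(totient_prime lp) cyclic.Euler_exp_totient // coprime_sym prime_coprime.
    by rewrite modn_small ?prime_gt1 // expr1.
have [s [saut sfix sord sgen]] := cyclic_generator kN cK'.
have [j nuE] := sgen _ (cyclic_normal kN K'F kK' saut sfix sord fix_k).
have nul : iter l nu y = y.
  have it h : iter h nu y = iter (j * h) s y.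
    elim: h => [|h IH]; first by rewrite muln0.
    by rewrite /= IH nuE ?mulnS ?iterD //; apply: (iter_autK saut).
  have [_ lK _] := sord; rewrite it; elim: j {nuE it} => //= j IH.
  by rewrite mulSn iterD IH lK.
by apply: nuy; rewrite -{1}(fixL y Ly) tauE -iterS prednK.
Qed.

Lemma kummer_unique K K' alpha alpha' gamma : is_cyclic_extension k l K ->
  is_cyclic_extension k l K' -> kummer_data k K l zeta alpha ->
  kummer_data k K' l zeta alpha' -> F gamma -> gamma != 0 ->
  alpha' = alpha * gamma ^+ l -> K' = K.
Proof.
move=> cK cK' dK dK' Fg g0 e; rewrite eqEsubset; split.
  exact: (kummer_sub cK cK' dK dK' Fg g0 e).
apply: (kummer_sub cK' cK dK' dK (gamma := gamma^-1)); first exact: (sfV FF).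
  by rewrite invr_eq0.
by rewrite e exprVn mulfK // expf_neq0.
Qed.

Lemma exists_kummer K : is_cyclic_extension k l K -> exists alpha,
  [/\ integers F alpha, kummer_data k K l zeta alpha
    & forall d, disc_gen k K d -> [/\ integers k d, d != 0 & kummer_disc k l zeta alpha d]].
Proof.
move=> cK; have [KF kK [e eB] _ _] := cK.
have [s [saut sfix sord _]] := cyclic_generator kN cK.
have l0 := prime_gt0 lp.
have [x [Kx Ax rx]] := resolvent1_neq0 kF KF kK saut zeta sord.
pose beta := resolvent s l zeta 1 x.
have Abeta : beta \in Aint := resolvent_Aint kF KF kK saut zetaP 1 Kx Ax.
have beta1 m (f : 'I_m -> algC) : is_basis k K f -> resolvent_span k s l zeta f 1 beta.
  by move=> fB; apply: (resolvent_in_span kF KF kK saut).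
have Falpha : F (beta ^+ l).
  exact: (kummer_gen_exp kF KF kK saut sfix sord zetaP eB (beta1 _ _ eB)).
exists (beta ^+ l); split.
- by split=> //; apply: rpredX.
- exists beta; split=> //; first by rewrite expf_neq0.
    rewrite /beta; apply: (sfsum (is_subfield_adjoin K zeta)) => t _.
    have LF := is_subfield_adjoin K zeta.
    apply: (sfM LF); first by apply: (sfX LF); exact: adjoin_gen.
    by apply: sub_adjoin; apply: (iter_autK saut).
  exact: (kummer_span kF KF kK saut sfix sord zetaP eB (beta1 _ _ eB) rx).
move=> d [m [f [fB fint ->]]].
have lm := aut_order_basis kF KF kK saut sfix fB sord; subst m.
have Kf i : K (f i) by case: fB.
have -> : \matrix_(i, j) rel_trace k K (f i * f j) = disc_mx k K f by [].
have kdisc i j : integers k (rel_trace k K (f i * f j)).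
  have Kff : K (f i * f j) by apply: (sfM KF).
  rewrite (rel_traceE kF KF kK saut sfix sord fB Kff); split.
    exact: (aut_trace_k kF KF saut sfix sord).
  apply: rpred_sum => t _; apply: (iter_aut_Aint kF KF kK saut) => //.
  by rewrite rpredM //; case: (fint i) (fint j) => _ ? [_ ?].
split.
- split; first by apply: (sfdet kF) => i j; rewrite mxE; case: (kdisc i j).
  by apply: Aint_det => i j; rewrite mxE; case: (kdisc i j).
- exact: (det_disc_mx_neq0 kF KF kK saut sfix sord fB).
have [f' [Ff' Af' ff']] := det_fourier_mx_dvd k zetaP.
have FM j i : integers F (kummer_mx s zeta f beta j i).
  rewrite mxE; split; last first.
    rewrite rpredM ?rpredX //; apply: (resolvent_Aint kF KF kK saut zetaP) => //.
    by case: (fint i).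
  have [j0|j0] := posnP j.
    rewrite j0 subn0 modnn expr0 mulr1; apply: sub_adjoin.
    exact: (resolvent0_k kF KF saut sfix zeta sord).
  rewrite modn_small ?ltn_subrL ?j0 //.
  exact: (resolvent_kummer kF KF kK saut sfix sord zetaP fB (beta1 _ _ fB)).
exists (kummer_mx s zeta f beta), (\det (fourier_mx l zeta)), f'; split=> //.
- move=> j i; pose w := resolvent s l zeta j (f i) ^+ l; exists w; last first.
    by rewrite mxE exprMn -!exprM mulnC.
  have Aw : w \in Aint.
    by rewrite rpredX //; apply: (resolvent_Aint kF KF kK saut zetaP) => //; case: (fint i).
  split=> //; have [FMji _] := FM j i.
  have -> : w = kummer_mx s zeta f beta j i ^+ l / (beta ^+ l) ^+ ((l - j) %% l).
    by rewrite mxE exprMn exprAC mulfK // !expf_neq0.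
  by apply: (sfdiv FF); apply: (sfX FF).
- split; last by split.
  split; first by apply: (sfdet FF) => i j; rewrite mxE; apply: (sfX FF); exact: adjoin_gen.
  by apply: Aint_det => i j; rewrite mxE rpredX // (Aint_prim_root zetaP).
exact: (det_kummer_mx kF KF kK saut sfix zeta sord fB).
Qed.

(** Multiplying a basis by a common denominator [Q] makes its elements integral; so the discriminant
    ideal has a generator, which is what makes it nonzero. *)
Lemma exists_disc_gen K : is_cyclic_extension k l K -> exists d, disc_gen k K d.
Proof.
move=> [KF kK [e [Ke eB]] _ _].
have /choice[M MP] : forall i, exists M : nat, (0 < M)%N /\ M%:R * e i \in Aint.
  by move=> i; have [M M0 AM] := Aint_multiple (e i); exists M.
pose Q := (\prod_i M i)%N.
have Q0 : Q%:R != 0 :> algC.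
  by rewrite pnatr_eq0 -lt0n prodn_gt0 // => i; have [] := MP i.
pose f i := Q%:R * e i.
have kQ := sfnat kF Q.
exists (\det (\matrix_(i, j) rel_trace k K (f i * f j))), l, f; split=> //.
  split=> [i|x Kx]; first by apply: (sfM KF) => //; apply: (sfnat KF).
  have [c [[kc xc] cU]] := eB x Kx.
  exists [ffun i => c i / Q%:R]; split.
    split=> [i|]; first by rewrite ffunE; apply: (sfdiv kF).
    by rewrite xc; apply: eq_bigr => i _; rewrite ffunE /f; field.
  move=> b [kb xb]; have <- : [ffun i => b i * Q%:R] = c.
    apply/esym/cU; split=> [i|]; first by rewrite ffunE; apply: (sfM kF).
    by rewrite xb; apply: eq_bigr => i _; rewrite ffunE /f mulrA.
  by apply/ffunP => i; rewrite !ffunE mulfK.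
move=> i; split; first by apply: (sfM KF) => //; apply: (sfnat KF).
have [_ AM] := MP i; rewrite /f /Q (bigD1 i) //= mulnC natrM -mulrA.
by rewrite rpredM ?rpred_nat.
Qed.

End KummerTheory.

(** The error is kept as an explicit multiple of [p], so that it can be read modulo any ideal
    containing [p], such as the square of a prime. *)
Lemma frobenius_mod k p t x y : is_subfield k -> prime p -> integers k x -> integers k y ->
  exists2 w, integers k w & (x + y) ^+ (p ^ t) = x ^+ (p ^ t) + y ^+ (p ^ t) + p%:R * w.
Proof.
move=> kF; case: p => [|p] // pp.
have one u v : integers k u -> integers k v ->
    exists2 w, integers k w & (u + v) ^+ p.+1 = u ^+ p.+1 + v ^+ p.+1 + p.+1%:R * w.
  move=> Ou Ov; rewrite exprDn.
  exists (\sum_(i < p) u ^+ (p.+1 - i.+1) * v ^+ i.+1 *+ ('C(p.+1, i.+1) %/ p.+1)).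
    apply: (oisum kF) => i _; rewrite -mulr_natr; apply: (oiM kF); last exact: (oinat kF).
    by apply: (oiM kF); apply: (oiX kF).
  rewrite big_ord_recr big_ord_recl /=.
  rewrite subn0 expr0 mulr1 bin0 mulr1n subnn expr0 mul1r binn mulr1n.
  rewrite addrAC; congr (_ + _); rewrite mulr_sumr; apply: eq_bigr => i _.
  rewrite /bump /= add1n -[in LHS](@divnK p.+1 'C(p.+1, i.+1)) ?mulrnA ?mulr_natl //.
  by apply: prime_dvd_bin => //; rewrite /= ltnS; exact: ltn_ord.
move=> Ox Oy; elim: t => [|t [w Ow IH]]; first by exists 0; [exact: (oi0 kF) | rewrite !expr1 mulr0 addr0].
rewrite !expnSr !exprM IH; set X := x ^+ _; set Y := y ^+ _.
have OX : integers k X by apply: (oiX kF).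
have OY : integers k Y by apply: (oiX kF).
have Opw : integers k (p.+1%:R * w) by apply: (oiM kF) => //; exact: (oinat kF).
have [w1 Ow1 ->] := one (X + Y) (p.+1%:R * w) (oiD kF OX OY) Opw.
have [w2 Ow2 ->] := one X Y OX OY.
exists (w2 + p.+1%:R ^+ p * w ^+ p.+1 + w1).
  do ?apply: (oiD kF) => //; apply: (oiM kF); last exact: (oiX kF).
  by apply: (oiX kF); exact: (oinat kF).
by rewrite exprMn [p.+1%:R ^+ p.+1]exprS; ring.
Qed.

(** Raising to the power [p] is injective modulo [P], hence permutes a finite system of
    representatives; some power of this permutation is the identity. *)
Lemma residue_field_frobenius n k p P : is_nf n k -> is_prime k P -> prime p -> P p%:R ->
  exists2 s : nat, (0 < s)%N & forall a, integers k a -> P (a ^+ (p ^ s) - a).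
Proof.
move=> kN pP pp Pp; have kF := kN.1; have nP := prime_nz pP.
have sP := nz_ideal_submodule nP; have [_ _ _ prP] := pP.
have [r [Ur rO rP rD]] := ideal_transversal kN nP (@subset_refl _ (integers k)).
have powm t x y : integers k x -> integers k y -> P (x - y) -> P (x ^+ t - y ^+ t).
  move=> Ox Oy xy; rewrite subrXX mulrC; apply: (subM sP) => //.
  by apply: (oisum kF) => i _; apply: (oiM kF); apply: (oiX kF).
have primeX x t : integers k x -> P (x ^+ t.+1) -> P x.
  move=> Ox; elim: t => [|t IH]; first by rewrite expr1.
  by rewrite exprS => /(prP _ _ Ox (oiX kF _ Ox)) [].
have rO' i : integers k r`_i.
  by have [ir|ir] := ltnP i (size r); [apply/rO/mem_nth | rewrite nth_default //; exact: (oi0 kF)].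
have /choice[f fP] : forall i : 'I_(size r), exists j : 'I_(size r), P (r`_i ^+ p - r`_j).
  move=> i; have [y ry Py] := rP _ (oiX kF p (rO' i)).
  have iy : (index y r < size r)%N by rewrite index_mem.
  by exists (Ordinal iy); rewrite /= nth_index.
have finj : injective f.
  move=> i j e; apply/val_inj/eqP; rewrite -(nth_uniq 0 (ltn_ord i) (ltn_ord j) Ur).
  apply/eqP/rD; rewrite ?mem_nth //; apply: (primeX _ p.-1); first exact: (oiB kF).
  rewrite prednK ?prime_gt0 //.
  have [w Ow] := @frobenius_mod k p 1 (r`_i - r`_j) r`_j kF pp (oiB kF (rO' i) (rO' j)) (rO' j).
  rewrite expn1 subrK => E.
  have -> : (r`_i - r`_j) ^+ p = (r`_i ^+ p - r`_(f i)) - (r`_j ^+ p - r`_(f j)) - w * p%:R.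
    by rewrite e E; ring.
  by apply: (subB kF sP); [exact: (subB kF sP) | exact: (subM sP)].
have iterP s (i : 'I_(size r)) : P (r`_i ^+ (p ^ s) - r`_(iter s f i)).
  elim: s => [|s IH]; first by rewrite expr1 subrr; exact: sub0 sP.
  rewrite expnSr exprM /= -(subrK (r`_(iter s f i) ^+ p) (_ ^+ p)) -addrA.
  by apply: (subD sP) => //; apply: powm => //; exact: (oiX kF).
(* Every cycle length of the permutation divides this factorial. *)
exists (factorial #|{: 'I_(size r)}|); first exact: fact_gt0.
move=> a Oa; have [y ry Py] := rP a Oa.
have iy : (index y r < size r)%N by rewrite index_mem.
pose i := Ordinal iy; have yE : y = r`_i by rewrite /= nth_index.
have it : iter (factorial #|{: 'I_(size r)}|) f i = i.
  have dv : (fingraph.order f i %| factorial #|{: 'I_(size r)}|)%N.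
    by apply: dvdn_fact; rewrite /fingraph.order max_card andbT; apply/card_gt0P; exists i; exact: connect0.
  case/dvdnP: dv => q ->; elim: q => // q IH.
  by rewrite mulSn iterD IH fingraph.iter_order.
have := iterP (factorial #|{: 'I_(size r)}|) i; rewrite it -yE => H.
set s := (_ ^ _)%N in H *.
have -> : a ^+ s - a = (a ^+ s - y ^+ s) + (y ^+ s - y) - (a - y) by ring.
apply: (subB kF sP) => //; apply: (subD sP) => //; apply: powm => //.
exact: rO.
Qed.

(** With x = u / v, the vanishing of the sum of the x^i gives that [l] is the sum of the 1 - x^i,
    each of which is a multiple of 1 - x. *)
Lemma root_sub_dvd l (zeta u v : algC) : l.-primitive_root zeta -> u ^+ l = 1 -> v ^+ l = 1 ->
  u != v -> exists2 w, w \in Aint & (u - v) * w = l%:R.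
Proof.
move=> zP ul vl uv; have l0 := prim_order_gt0 zP.
have Au : u \in Aint by apply: (Aint_unity_root l0); apply/unity_rootP.
have Av : v \in Aint by apply: (Aint_unity_root l0); apply/unity_rootP.
have v0 : v != 0 by apply: contra_eqN vl => /eqP ->; rewrite expr0n gtn_eqF // eq_sym oner_eq0.
have vV : v^-1 = v ^+ l.-1 by apply: (mulfI v0); rewrite mulfV // -exprS prednK.
pose x := u / v; have xl : x ^+ l = 1 by rewrite exprMn exprVn ul vl invr1 mulr1.
have x1 : x != 1 by apply: contra_neq uv => e; rewrite -[u](divfK v0) -/x e mul1r.
have Ax : x \in Aint by rewrite /x vV rpredM ?rpredX.
have sx : \sum_(i < l) x ^+ i = 0.
  have := subrX1 x l; rewrite xl subrr => /esym/eqP.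
  by rewrite mulf_eq0 subr_eq0 (negPf x1) => /eqP.
exists (- v^-1 * \sum_(i < l) \sum_(j < i) x ^+ j).
  rewrite rpredM ?rpredN ?vV ?rpredX // rpred_sum // => i _.
  by rewrite rpred_sum // => j _; rewrite rpredX.
have -> : u - v = v * (x - 1) by rewrite /x; field.
transitivity (- ((x - 1) * \sum_(i < l) \sum_(j < i) x ^+ j)); first by field.
rewrite mulr_sumr; under eq_bigr do rewrite -subrX1.
by rewrite sumrB sx sub0r opprK sumr_const card_ord.
Qed.

(** * Tamely ramified primes *)

Section Ramification.
Variables (n N : nat) (k : set algC) (l : nat) (zeta : algC).
Hypothesis kN : is_nf n k.
Hypothesis lp : prime l.
Hypothesis zetaP : l.-primitive_root zeta.
Local Notation F := (adjoin k zeta).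
Hypothesis FN : is_nf N F.
Let kF : is_subfield k := kN.1.
Let FF : is_subfield F := is_subfield_adjoin k zeta.

Definition prime_below P : set algC := [set x | P x /\ integers k x].

Lemma integers_adjoin x : integers k x -> integers F x.
Proof. by move=> [kx Ax]; split=> //; apply: sub_adjoin. Qed.

Lemma prime_belowP P : is_prime F P -> is_prime k (prime_below P).
Proof.
move=> pP; have nP := prime_nz pP; have sP := nz_ideal_submodule nP.
have [Q Q0 PQ] := nz_ideal_int FN nP.
split.
- split=> [|x []//]; split=> [|x y [Px Ox] [Py Oy]|a x Oa [Px Ox]].
  + by split; [exact: sub0 sP | exact: (oi0 kF)].
  + by split; [exact: (subD sP) | exact: (oiD kF)].
  + by split; [apply: (subM sP) => //; exact: integers_adjoin | exact: (oiM kF)].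
- move=> e; have : prime_below P Q%:R by split=> //; exact: (oinat kF).
  by rewrite e /= => /eqP; rewrite pnatr_eq0 gtn_eqF.
- move=> e; have : prime_below P 1 by rewrite e; exact: (oi1 kF).
  by case=> /(prime_not1 pP).
move=> x y Ox Oy [Pxy _]; have [_ _ _ pr] := pP.
by case: (pr x y (integers_adjoin Ox) (integers_adjoin Oy) Pxy) => ?; [left | right].
Qed.

(** Up to powers of [l], the integers of k(zeta) are polynomials in zeta over the integers of [k]:
    the common denominator is the Vandermonde determinant of the conjugates of zeta, whose factors
    divide [l]. *)
Lemma integers_adjoin_coord z : integers F z -> exists a d (c : 'I_d -> algC),
  (forall i, integers k (c i)) /\ l%:R ^+ a * z = \sum_i c i * zeta ^+ i.
Proof.
move=> [Fz Az]; have [d [nu conj]] := exists_conjugates zeta kN.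
have [d0 inj _ span] := conj; have [c kc zE] := span z Fz.
have l1 j : nu j zeta ^+ l = 1 by rewrite -rmorphXn (prim_expr_order zetaP) rmorph1.
have prodl (I : Type) (r : seq I) (Q : pred I) (f : I -> algC) :
    (forall i, Q i -> exists2 w, w \in Aint & exists a, f i * w = l%:R ^+ a) ->
    exists2 w, w \in Aint & exists a, (\prod_(i <- r | Q i) f i) * w = l%:R ^+ a.
  move=> fw; apply: (big_ind (fun x => exists2 w, w \in Aint & exists a, x * w = l%:R ^+ a)) => //.
    by exists 1; rewrite ?rpred1 //; exists 0%N; rewrite mulr1.
  move=> x y [w Aw [a xw]] [w' Aw' [a' yw']]; exists (w * w'); first exact: rpredM.
  by exists (a + a')%N; rewrite exprD -xw -yw'; ring.
have [W AW [a Wa]] : exists2 w, w \in Aint & exists a, \det (conj_mx zeta nu) * w = l%:R ^+ a.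
  rewrite -det_tr (_ : (conj_mx zeta nu)^T = Vandermonde d (\row_j nu j zeta)); last first.
    by apply/matrixP => i j; rewrite !mxE.
  rewrite det_Vandermonde; apply: (prodl) => i _; apply: (prodl) => j ij.
  have ne : nu j zeta != nu i zeta by apply: contraTneq ij => /inj ->; rewrite ltnn.
  have [w Aw e] := root_sub_dvd zetaP (l1 j) (l1 i) ne.
  by exists w => //; exists 1%N; rewrite !mxE expr1.
exists a, d, (fun i => l%:R ^+ a * c i); split; last first.
  by rewrite zE mulr_sumr; apply: eq_bigr => i _; rewrite mulrA.
move=> i; split; first by apply: (sfM kF) => //; apply: (sfX kF); exact: (sfnat kF).
rewrite -Wa mulrAC rpredM //; apply: (Aint_conj_coord conj (Aint_prim_root zetaP)) => //.
by rewrite -zE.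
Qed.

(* All [y] in [integers k] adjoined [zeta] satisfy [y ^ q = y] modulo [p], for a
   suitable power [q] of the residue characteristic. *)
Lemma unramified_uniformizer P : is_prime F P -> ~ P l%:R ->
  exists2 x, prime_below P x & ~ ideal_exp F P 2 x.
Proof.
move=> pP nPl; have nP := prime_nz pP; have sP := nz_ideal_submodule nP.
apply: contrapT => H.
have P2 : prime_below P `<=` ideal_exp F P 2.
  by move=> x px; apply: contrapT => nx; apply: H; exists x.
have pk := prime_belowP pP; have [pp Pp] := residue_charP FN pP.
set p := residue_char P in pp Pp.
have pkp : prime_below P p%:R by split=> //; exact: (oinat kF).
have [s s0 frob] := residue_field_frobenius kN pk pp pkp.
have pl : coprime l p.
  rewrite prime_coprime // dvdn_prime2 //; apply/negP => /eqP lp'.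
  by apply: nPl; rewrite lp'.
(* The factor [l.-1] makes q congruent to 1 modulo [l], so that zeta^q = zeta. *)
pose q := (p ^ (s * l.-1))%N.
have l1 := prime_gt1 lp.
have sl : (0 < s * l.-1)%N by rewrite muln_gt0 s0 -ltnS prednK // ltnW.
have zq : zeta ^+ q = zeta.
  rewrite -[RHS]expr1; apply/eqP; rewrite (eq_prim_root_expr zetaP) /q mulnC expnM.
  have : (p ^ l.-1 = 1 %[mod l])%N.
    by rewrite -(totient_prime lp) cyclic.Euler_exp_totient // coprime_sym.
  by move=> e; apply/eqP; rewrite -modnXm e modnXm exp1n.
have sP2 : is_submodule F (ideal_exp F P 2) := ideal_prod_submodule FF _.
have pP2 w : integers F w -> ideal_exp F P 2 (p%:R * w).
  by move=> Ow; rewrite mulrC; apply: (subM sP2) => //; exact: P2.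
pose D := [set y | integers F y /\ ideal_exp F P 2 (y ^+ q - y)].
have DD x y : D x -> D y -> D (x + y).
  move=> [Ox Dx] [Oy Dy]; split; first exact: (oiD FF).
  have [w Ow e] := frobenius_mod (s * l.-1) FF pp Ox Oy.
  have -> : (x + y) ^+ q - (x + y) = (x ^+ q - x) + (y ^+ q - y) + p%:R * w.
    by rewrite [_ ^+ q]e -/q; ring.
  by apply: (subD sP2); [exact: (subD sP2) | exact: pP2].
have DM x y : D x -> D y -> D (x * y).
  move=> [Ox Dx] [Oy Dy]; split; first exact: (oiM FF).
  have -> : (x * y) ^+ q - x * y = y ^+ q * (x ^+ q - x) + x * (y ^+ q - y).
    by rewrite exprMn; ring.
  by apply: (subD sP2); apply: (subM sP2) => //; exact: (oiX FF).
have Dk a : integers k a -> D a.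
  move=> Oa; split; first exact: integers_adjoin.
  apply: P2; have spk := nz_ideal_submodule (prime_nz pk).
  rewrite /q expnM; elim: l.-1 => [|j IH]; first by rewrite expr1 subrr; exact: sub0 spk.
  rewrite expnSr exprM -(subrK (a ^+ ((p ^ s) ^ j)) (_ ^+ (p ^ s))) -addrA.
  by apply: (subD spk) => //; apply: frob; exact: (oiX kF).
have Dz : D zeta.
  split; first by split; [exact: adjoin_gen | exact: Aint_prim_root zetaP].
  by rewrite zq subrr; exact: sub0 sP2.
(* Here y = y^q - (y^q - y), and y^q lies in P^q with q >= 2. As [D] contains all integers up to
   powers of [l], which are prime to [P], this yields P = P^2, contrary to the determinant trick. *)
have PD y : D y -> P y -> ideal_exp F P 2 y.
  move=> [Oy Dy] Py; rewrite -(subKr (y ^+ q) y); apply: (subB FF sP2) => //.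
  have q2 : (1 < q)%N by rewrite -(exp1n (s * l.-1)) ltn_exp2r // prime_gt1.
  by apply: (ideal_exp_sub FF nP.1 q2); apply: mem_expX.
have PP2 : P `<=` ideal_mul F P P.
  have e2 : ideal_exp F P 2 = ideal_mul F P P by rewrite ideal_expS (ideal_exp1 FF).
  move=> z Pz; rewrite -e2; have Oz := nz_ideal_sub nP Pz.
  have [->|z0] := eqVneq z 0; first exact: sub0 sP2.
  have [a [d [c [Oc e]]]] := integers_adjoin_coord Oz.
  have Ol : integers F (l%:R ^+ a) by apply: (oiX FF); exact: (oinat FF).
  have l0 : l%:R ^+ a != 0 :> algC by rewrite expf_neq0 // pnatr_eq0 -lt0n ltnW.
  have : ideal_exp F P 2 (l%:R ^+ a * z).
    apply: PD; last exact: (subM sP).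
    rewrite e; apply: (big_ind D) => [||i _]; [exact/Dk/(oi0 kF) | exact: DD |].
    apply: (DM); first exact: Dk.
    elim: (i : nat) => [|j IH]; first by rewrite expr0; exact/Dk/(oi1 kF).
    by rewrite exprS; apply: DM.
  have Olz : integers F (l%:R ^+ a * z) by apply: (oiM FF).
  have lz0 : l%:R ^+ a * z != 0 by rewrite mulf_neq0.
  move=> /(elt_valP FN 2 pP Olz lz0); rewrite (elt_valM FN) //.
  rewrite (elt_valX FN) //; first last.
  - by rewrite pnatr_eq0 -lt0n ltnW.
  - exact: (oinat FF).
  have -> : elt_val F P l%:R = 0%N.
    by apply/(elt_val_eq0 FN pP) => //; [exact: (oinat FF) | rewrite pnatr_eq0 -lt0n ltnW].
  by rewrite muln0 add0n => /(elt_valP FN 2 pP Oz z0).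
by case: (prime_not1 pP); apply: (nakayama FN nP nP.1).
Qed.

(** Write (x) = p^v J with some [j] in [J] outside p, and let [pi] in p have valuation 1 at [P].
    Then pi^v j is a multiple of [x] and has valuation v at [P], so the valuation of [x] at [P] is
    at most v. *)
Lemma mem_exp_below P m x : is_prime F P -> ~ P l%:R -> integers k x ->
  ideal_exp F P m x -> ideal_exp k (prime_below P) m x.
Proof.
move=> pP nPl Ox Px; have pk := prime_belowP pP; have nP := prime_nz pP.
set p := prime_below P in pk *; have np := prime_nz pk.
have [->|x0] := eqVneq x 0; first exact: sub0 (ideal_prod_submodule kF _).
apply/(elt_valP kN m pk Ox x0); rewrite leqNgt; apply/negP.
set v := elt_val k p x => vm.
have nx := nz_principal kN Ox x0.
have npv := nz_ideal_exp kF v np.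
have sub : scale x (integers k) `<=` ideal_exp k p v by apply/(ideal_valP kN v pk nx).
have [J iJ e] := ideal_sub_dvd kN npv (nz_ideal_submodule nx) sub.
have [j Jj npj] : exists2 j, J j & ~ p j.
  apply: contrapT => H; have Jp : J `<=` p.
    by move=> y Jy; apply: contrapT => ny; apply: H; exists y.
  have : scale x (integers k) `<=` ideal_exp k p v.+1.
    by rewrite e ideal_expS ideal_mulC; apply: ideal_mulS.
  by move=> /(ideal_valP kN v.+1 pk nx); rewrite -/(elt_val k p x) -/v ltnn.
have [pi [Ppi Opi] nP2] := unramified_uniformizer pP nPl.
have Oj : integers k j := iJ.2 _ Jj.
have : scale x (integers k) (pi ^+ v * j).
  by rewrite e; apply: mem_ideal_mul => //; apply: (mem_expX kF).
move=> [w Ow xw].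
have pi0 : pi != 0 by apply: contra_notN nP2 => /eqP ->; exact: sub0 (ideal_prod_submodule FF _).
have j0 : j != 0 by apply: contra_notN npj => /eqP ->; exact: sub0 (nz_ideal_submodule np).
have nPj : ~ P j by move=> Pj; apply: npj.
have OFpi := integers_adjoin Opi; have OFj := integers_adjoin Oj.
have vpi : (elt_val F P pi <= 1)%N.
  by rewrite leqNgt; apply/negP => /(elt_valP FN 2 pP OFpi pi0).
have vj : elt_val F P j = 0%N by apply/(elt_val_eq0 FN pP).
have Ppj : ideal_exp F P m (pi ^+ v * j).
  rewrite -xw mulrC; apply: (subM (ideal_prod_submodule FF _)) => //.
  exact: integers_adjoin.
have Oall : integers F (pi ^+ v * j) by apply: (oiM FF) => //; apply: (oiX FF).
have all0 : pi ^+ v * j != 0 by rewrite mulf_neq0 // expf_neq0.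
move: Ppj => /(elt_valP FN m pP Oall all0).
rewrite (elt_valM FN) //; [|exact: (oiX FF)|exact: expf_neq0].
rewrite (elt_valX FN) // vj addn0; nia.
Qed.

(** The quotients are the ceilings of a v / l and b v / l. These fractions add up to v and are not
    integers, since [l] divides neither a nor v; so their ceilings add up to more than v. *)
Lemma ceil_pair v a b : (a + b = l)%N -> ~~ (l %| v)%N -> (0 < a < l)%N ->
  (v.+1 <= (a * v + l.-1) %/ l + (b * v + l.-1) %/ l)%N.
Proof.
move=> ab lv /andP[a0 al]; have l0 := prime_gt0 lp.
set x := (_ %/ l)%N; set y := (_ %/ l)%N.
have ceilP c : (c <= ((c + l.-1) %/ l) * l)%N.
  by have := divn_eq (c + l.-1) l; have := ltn_pmod (c + l.-1) l0; lia.
have hx := ceilP (a * v)%N; have hy := ceilP (b * v)%N.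
rewrite -/x in hx; rewrite -/y in hy.
have sum : (a * v + b * v = l * v)%N by rewrite -mulnDl ab.
have [//|le] := ltnP v (x + y).
have ex : (a * v = x * l)%N by nia.
have : (l %| a * v)%N by apply/dvdnP; exists x.
by rewrite Euclid_dvdM // (negPf lv) orbF => /(dvdn_leq a0); rewrite leqNgt al.
Qed.

(** The term j = 0 vanishes, and each other j is paired with l - j. *)
Lemma ceil_sum v : ~~ (l %| v)%N ->
  (l.-1 * v.+1 <= 2 * \sum_(j < l) (((l - j) %% l) * v + l.-1) %/ l)%N.
Proof.
move=> lv; have l0 := prime_gt0 lp.
have -> : (\sum_(j < l) (((l - j) %% l) * v + l.-1) %/ l =
    \sum_(i < l.-1) ((i.+1 * v + l.-1) %/ l))%N.
  clear -l0; case: l l0 => // l' _; rewrite big_ord_recl subn0 modnn mul0n add0n.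
  rewrite divn_small // add0n (reindex_inj rev_ord_inj); apply: eq_bigr => i _ /=.
  by rewrite /bump /= add1n subSS subKn ?modn_small ?ltnS //; exact: ltn_ord.
rewrite mul2n -addnn [X in (_ <= _ + X)%N](reindex_inj rev_ord_inj) -big_split /=.
rewrite -[l.-1 in X in (X <= _)%N]card_ord -sum_nat_const; apply: leq_sum => i _.
apply: ceil_pair => //; last by have := ltn_ord i; lia.
by have := ltn_ord i; lia.
Qed.

(** The l-th powers of the entries show that row j has valuation at least [c j] at [P], and the
    determinant collects the sum. In its square, alpha^(l - 1) accounts for (l - 1) v and [f], a
    divisor of a power of [l], for nothing; by [ceil_sum], at least l - 1 is left for [d]. *)
Lemma kummer_disc_val P alpha d : is_prime F P -> ~ P l%:R ->
  integers F alpha -> alpha != 0 -> ~~ (l %| elt_val F P alpha)%N ->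
  integers k d -> d != 0 -> kummer_disc k l zeta alpha d ->
  ideal_exp k (prime_below P) l.-1 d.
Proof.
move=> pP nPl Oa a0 lv Od d0 [M [f [f' [OM Mw [Of Of'] ff' detM]]]].
apply: mem_exp_below => //; have l0 := prime_gt0 lp.
set v := elt_val F P alpha in lv.
have OFd := integers_adjoin Od.
pose c j := ((((l - j) %% l) * v + l.-1) %/ l)%N.
have MP (j i : 'I_l) : ideal_exp F P (c j) (M j i).
  have [->|Mji0] := eqVneq (M j i) 0; first exact: sub0 (ideal_prod_submodule FF _).
  apply/(elt_valP FN _ pP (OM j i) Mji0).
  have [w Ow e] := Mw j i.
  have w0 : w != 0.
    by apply: contra_neq Mji0 => w0; apply/eqP; move/eqP: e; rewrite w0 mul0r expf_eq0 l0.
  have := congr1 (elt_val F P) e.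
  rewrite (elt_valX FN) // (elt_valM FN) //; [|exact: (oiX FF)|exact: expf_neq0].
  rewrite (elt_valX FN) // -/v => E.
  have : (((l - j) %% l) * v <= l * elt_val F P (M j i))%N by rewrite E leq_addl.
  move=> h; rewrite -ltnS /c ltn_divLR // mulSn mulnC; lia.
have detP : ideal_exp F P (\sum_(j < l) c j)%N (\det M).
  apply: (big_ind (ideal_exp F P (\sum_(j < l) c j)%N)) => [|x y|s _].
  - exact: sub0 (ideal_prod_submodule FF _).
  - exact: (subD (ideal_prod_submodule FF _)).
  apply: (subM (ideal_prod_submodule FF _)).
    by apply: (oiX FF); apply: (oiN FF); exact: (oi1 FF).
  apply: (big_ind2 (fun a x => ideal_exp F P a x)) => [|a x b y Px Py|j _]; last exact: MP.
    exact: (oi1 FF).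
  by rewrite (ideal_expD FF); apply: mem_ideal_mul.
have f0 : f != 0.
  apply: contra_eq_neq ff' => ->; rewrite mul0r eq_sym expf_neq0 // pnatr_eq0 -lt0n //.
have f'0 : f' != 0.
  apply: contra_eq_neq ff' => ->; rewrite mulr0 eq_sym expf_neq0 // pnatr_eq0 -lt0n //.
have vl : elt_val F P l%:R = 0%N.
  by apply/(elt_val_eq0 FN pP) => //; [exact: (oinat FF) | rewrite pnatr_eq0 -lt0n].
have vf : elt_val F P f = 0%N.
  have := congr1 (elt_val F P) ff'; rewrite (elt_valM FN) // (elt_valX FN) //.
  - by rewrite vl muln0 => /eqP; rewrite addn_eq0 => /andP[/eqP].
  - exact: (oinat FF).
  - by rewrite pnatr_eq0 -lt0n.
have detM0 : \det M != 0.
  by rewrite -sqrf_eq0 detM !mulf_neq0 ?expf_neq0.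
have OdetM : integers F (\det M).
  split; first by apply: (sfdet FF) => i j; case: (OM i j).
  by apply: Aint_det => i j; case: (OM i j).
have vdet : (\sum_(j < l) c j <= elt_val F P (\det M))%N by apply/(elt_valP FN _ pP OdetM detM0).
have := congr1 (elt_val F P) detM.
have Oal : integers F (alpha ^+ l.-1) by apply: (oiX FF).
have Of2 : integers F (f ^+ 2) by apply: (oiX FF).
have Oaf : integers F (alpha ^+ l.-1 * f ^+ 2) by apply: (oiM FF).
rewrite (elt_valX FN 2 pP OdetM detM0) (elt_valM FN pP Oaf _ OFd d0) ?mulf_neq0 ?expf_neq0 //.
rewrite (elt_valM FN pP Oal _ Of2) ?expf_neq0 // !(elt_valX FN) // vf muln0 addn0 -/v => E.
apply/(elt_valP FN _ pP OFd d0).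
have : (l.-1 * v.+1 <= 2 * elt_val F P (\det M))%N.
  by apply: leq_trans (ceil_sum lv) _; rewrite leq_mul2l vdet orbT.
by rewrite E mulnS addnC leq_add2l.
Qed.

End Ramification.

(** * Norm of the discriminant and its part prime to S *)

Section IdealNorm.
Variables (n : nat) (k : set algC).
Hypothesis kN : is_nf n k.
Let kF : is_subfield k := kN.1.

Lemma prod_norm_dvd I m (s : seq (set algC)) : nz_ideal k I -> (0 < m)%N -> uniq s ->
  {in s, forall p, is_prime k p /\ I `<=` ideal_exp k p m} ->
  (\prod_(p <- s) ideal_norm k p ^ m %| ideal_norm k I)%N.
Proof.
move=> nI m0 Us sP; have [fP e] := factorsP kN nI.
have cnt p : p \in s -> (m <= count_mem p (factors k I))%N.
  by move=> ps; have [pp Ip] := sP p ps; apply/(ideal_valP kN m pp nI).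
have -> : ideal_norm k I = (\prod_(p <- factors k I) ideal_norm k p)%N.
  by rewrite {1}e (ideal_norm_prod kN).
have e2 : perm_eq (seq.filter (mem s) (undup (factors k I))) s.
  apply: uniq_perm => //; first exact/filter_uniq/undup_uniq.
  move=> p; rewrite mem_filter mem_undup; case ps: (p \in s); rewrite /= ?ps //=.
  by rewrite -has_pred1 has_count (leq_trans m0) // cnt.
rewrite -(perm_big _ e2) big_filter -[X in (_ %| X)%N]big_undup_iterop_count.
rewrite [X in (_ %| X)%N](bigID (mem s)) /=; apply: dvdn_mulr.
apply: (big_ind2 (fun a b => a %| b)%N) => // [a b c d ab cd|p /cnt ps]; first exact: dvdn_mul.
exact: (dvdn_exp2l (ideal_norm k p) ps).
Qed.

End IdealNorm.

Lemma leq_prime_to_part k (S : {fset set algC}) b d : (0 < b)%N -> (d %| b)%N ->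
  (forall p, p \in S -> coprime d (ideal_norm k p)) -> (d <= prime_to_part k S b)%N.
Proof.
move=> b0 db co; rewrite /prime_to_part.
apply: (@leq_bigmax_seq nat (divisors b) _ (fun d => d)); first by rewrite -dvdn_divisors.
by apply/allP => p /co.
Qed.

Section TameNorm.
Variables (n N : nat) (k : set algC) (l : nat) (zeta : algC).
Hypothesis kN : is_nf n k.
Hypothesis lp : prime l.
Hypothesis zetaP : l.-primitive_root zeta.
Local Notation F := (adjoin k zeta).
Hypothesis FN : is_nf N F.
Let kF : is_subfield k := kN.1.
Let FF : is_subfield F := is_subfield_adjoin k zeta.

(** The set T(K) of the overview. Several primes of k(zeta) may lie over one prime of [k], whence
    [undup]. *)
Definition kummer_primes alpha : seq (set algC) :=
  undup [seq prime_below k P | P <- factors F (scale alpha (integers F))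
                             & ~~ (l %| elt_val F P alpha)%N].

Lemma kummer_primesP alpha p : integers F alpha -> alpha != 0 -> p \in kummer_primes alpha ->
  exists P, [/\ is_prime F P, p = prime_below k P & ~~ (l %| elt_val F P alpha)%N].
Proof.
move=> Oa a0; rewrite mem_undup => /mapP[P]; rewrite mem_filter => /andP[lv Pf ->].
by exists P; split=> //; have [fP _] := factorsP FN (nz_principal FN Oa a0); apply: fP.
Qed.

Lemma mem_kummer_primes alpha P : is_prime F P -> ~~ (l %| elt_val F P alpha)%N ->
  prime_below k P \in kummer_primes alpha.
Proof.
move=> pP lv; rewrite mem_undup; apply/mapP; exists P => //.
rewrite mem_filter lv /= -has_pred1 has_count lt0n.
by apply: contra lv => /eqP e; rewrite /elt_val /ideal_val e dvdn0.
Qed.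

Definition kummer_gen K alpha := [/\ integers F alpha, kummer_data k K l zeta alpha
    & forall d, disc_gen k K d -> [/\ integers k d, d != 0 & kummer_disc k l zeta alpha d]].

Lemma kummer_gen_neq0 K alpha : kummer_gen K alpha -> alpha != 0.
Proof. by case=> _ [beta []]. Qed.

Lemma nz_discriminant K alpha : is_cyclic_extension k l K -> kummer_gen K alpha ->
  nz_ideal k (discriminant k K).
Proof.
move=> cK [_ _ dP]; have [d dd] := exists_disc_gen kN cK.
have sD : is_submodule k (discriminant k K) by exact: module_span_submodule.
apply/nz_idealP; split.
  split=> //; apply: module_span_min; first exact: (integers_submodule kF).
  by move=> x /dP[].
move=> e; have [_ d0 _] := dP d dd.
have : discriminant k K d by apply: module_span_gen.
by rewrite e /= => /eqP; rewrite (negPf d0).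
Qed.

Lemma discriminant_sub_exp K alpha p : kummer_gen K alpha -> p \in kummer_primes alpha ->
  ~ p l%:R -> discriminant k K `<=` ideal_exp k p l.-1.
Proof.
move=> gK pa npl; have a0 := kummer_gen_neq0 gK; have [Oa _ dP] := gK.
have [P [pP pE lv]] := kummer_primesP Oa a0 pa.
apply: module_span_min; first exact: ideal_prod_submodule.
move=> d /dP[Od d0 kd]; rewrite pE; apply: (kummer_disc_val kN lp zetaP FN pP _ Oa a0 lv Od d0 kd).
by move=> Pl; apply: npl; rewrite pE; split=> //; exact: (oinat kF).
Qed.

(** Residue characteristics, and not primes, are compared with those of [S], because the norms have
    to be coprime. Staying away from [l] is what makes the exponent l - 1 available. *)
Lemma tame_norm_bound K alpha (S : {fset set algC}) (s : seq (set algC)) :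
  is_cyclic_extension k l K -> kummer_gen K alpha -> (forall p, p \in S -> is_prime k p) ->
  uniq s ->
  {in s, forall p, [/\ p \in kummer_primes alpha, residue_char p != l
     & forall p', p' \in S -> residue_char p' != residue_char p]} ->
  (\prod_(p <- s) ideal_norm k p ^ l.-1 <=
     prime_to_part k S (ideal_norm k (discriminant k K)))%N.
Proof.
move=> cK gK SP Us sP; have nD := nz_discriminant cK gK.
have sp p : p \in s -> is_prime k p.
  have a0 := kummer_gen_neq0 gK; have [Oa _ _] := gK.
  move=> /sP[pa _ _]; have [P [pP -> _]] := kummer_primesP Oa a0 pa.
  exact: (prime_belowP kN FN).
apply: leq_prime_to_part; first exact: (ideal_norm_gt0 kN).
  apply: (prod_norm_dvd kN) => //; first by rewrite -ltnS prednK ?prime_gt0 ?prime_gt1.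
  move=> p ps; have [pa rl _] := sP p ps; split; first exact: sp.
  apply: (discriminant_sub_exp gK) => // pl; move/eqP: rl; apply.
  exact: (residue_char_unique kN (sp p ps) lp).
move=> p' p'S; rewrite big_seq.
apply: (big_ind (fun a => coprime a (ideal_norm k p'))) => [|a b ca cb|p ps].
- exact: coprime1n.
- by rewrite coprimeMl ca.
have [_ _ /(_ _ p'S) ne] := sP p ps; apply: coprimeXl.
have [j ->] := ideal_norm_prime kN (sp p ps); have [j' ->] := ideal_norm_prime kN (SP p' p'S).
apply: coprimeXl; apply: coprimeXr; rewrite prime_coprime.
  by rewrite dvdn_prime2 1?eq_sym //; [case: (residue_charP kN (sp p ps))|case: (residue_charP kN (SP _ p'S))].
by case: (residue_charP kN (sp p ps)).
Qed.

End TameNorm.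

(** * Counting *)

Section Counting.
Variable R : realFieldType.

(** Rankin's trick: the fibre over A has at most C0 C^|A| elements and, if it is not empty, may be
    weighted by V times the product of the [w i], which is at least 1. The sum over all subsets A
    then factors. *)
Lemma weighted_count (I : finType) (Z : Type) (X : seq Z) (J : Z -> {set I}) (C0 C V : R)
    (w : I -> R) : 0 <= C0 -> 0 <= C -> 0 <= V -> (forall i, 0 <= w i) ->
  (forall A, (count (fun z => J z == A) X)%:R <= C0 * C ^+ #|A|) ->
  (forall A, has (fun z => J z == A) X -> 1 <= V * \prod_(i in A) w i) ->
  (size X)%:R <= C0 * V * \prod_i (1 + C * w i).
Proof.
move=> C00 C_ge0 V0 w0 cX wX.
have -> : size X = (\sum_A count (fun z => J z == A) X)%N.
  elim: X {cX wX} => [|z X IH] /=; first by rewrite big1.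
  rewrite big_split /= -IH (bigD1 (J z)) //= eqxx big1 // => A.
  by rewrite eq_sym => /negPf ->.
have -> : \prod_i (1 + C * w i) = \sum_(A : {set I}) C ^+ #|A| * \prod_(i in A) w i.
  under eq_bigr do rewrite addrC.
  rewrite bigA_distr; apply: eq_bigr => A _.
  by rewrite -big_mkcond big_split /= prodr_const.
rewrite natr_sum mulr_sumr; apply: ler_sum => A _.
have [XA|] := boolP (has (fun z => J z == A) X); last first.
  rewrite has_count lt0n negbK => /eqP ->.
  by rewrite !mulr_ge0 ?exprn_ge0 // prodr_ge0.
apply: le_trans (cX A) _.
rewrite (_ : C0 * V * _ = (C0 * C ^+ #|A|) * (V * \prod_(i in A) w i)); last by ring.
by rewrite ler_peMr ?wX // mulr_ge0 ?exprn_ge0.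
Qed.

Lemma weighted_count_seq (T Z : eqType) (X : seq Z) (J : Z -> seq T) (C0 C V : R)
    (w : T -> R) : 0 <= C0 -> 0 <= C -> 0 <= V -> (forall p, 0 <= w p) ->
  (forall z, z \in X -> uniq (J z)) ->
  (forall s Y, uniq s -> subseq Y X -> (forall z, z \in Y -> J z =i s) ->
     (size Y)%:R <= C0 * C ^+ size s) ->
  (forall z, z \in X -> 1 <= V * \prod_(p <- J z) w p) ->
  exists U, [/\ uniq U, forall p, p \in U -> exists2 z, z \in X & p \in J z
    & (size X)%:R <= C0 * V * \prod_(p <- U) (1 + C * w p)].
Proof.
move=> C00 C_ge0 V0 w0 UJ cX wX.
pose U := undup (flatten (map J X)).
have UU : uniq U := undup_uniq _.
have JU z : z \in X -> {subset J z <= U}.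
  by move=> Xz p Jp; rewrite mem_undup; apply/flatten_mapP; exists z.
exists U; split=> // [p|].
  by rewrite mem_undup => /flatten_mapP[z Xz Jp]; exists z.
(* If no index occurs, all [J z] are empty and the bound for the empty set applies; otherwise [U]
   supplies the default value of [nth]. *)
case: (posnP (size U)) => [/eqP|U0].
  rewrite size_eq0 => /eqP UE; rewrite UE big_nil mulr1.
  case XE : X => [|z0 X']; first by rewrite mulr_ge0.
  have X0 z : z \in X -> J z = [::].
    move=> Xz; case JE : (J z) => [|p s] //.
    by have := JU z Xz p; rewrite JE UE mem_head => /(_ isT).
  rewrite -XE; have := cX [::] X isT (subseq_refl _); rewrite expr0 mulr1 => c1.
  have Xz0 : z0 \in X by rewrite XE mem_head.
  have := wX z0 Xz0; rewrite X0 // big_nil mulr1 => V1.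
  by apply: le_trans (ler_peMr C00 V1); apply: c1 => z Xz; rewrite X0.
have [p0 _] : exists p, p \in U by case: U U0 {UU JU} => // p ? _; exists p; rewrite mem_head.
pose u (i : 'I_(size U)) := nth p0 U i.
have uinj : injective u.
  by move=> i j /eqP; rewrite nth_uniq // => /eqP/val_inj.
pose J' z := [set i | u i \in J z]%SET.
have memJ' z i : (i \in J' z) = (u i \in J z) by rewrite inE.
pose e (A : {set 'I_(size U)}) := [seq u i | i in A].
have sizee A : size (e A) = #|A| by rewrite size_image.
have Ue A : uniq (e A) by rewrite map_inj_uniq ?enum_uniq.
have eJ z : z \in X -> J z =i e (J' z).
  move=> Xz p; apply/idP/mapP => [Jp|[i]]; last by rewrite mem_enum memJ' => ? ->.
  have pU : (index p U < size U)%N by rewrite index_mem (JU z).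
  exists (Ordinal pU); last by rewrite /u nth_index // (JU z).
  by rewrite mem_enum memJ' /u /= nth_index // (JU z).
rewrite (big_nth p0) big_mkord.
apply: (weighted_count (J := J')) => // A.
  rewrite -size_filter -sizee; apply: cX => //; first exact: filter_subseq.
  by move=> z; rewrite mem_filter => /andP[/eqP <- /eJ].
case/hasP => z Xz /eqP <-.
rewrite (_ : \prod_(i in _) _ = \prod_(p <- J z) w p); first exact: wX.
rewrite [RHS](perm_big (e (J' z))) ?big_image //.
by apply: uniq_perm => //; [exact: UJ | exact: eJ].
Qed.

End Counting.

(** Each factor depends on the value of [f] alone, and each value is taken at most [m] times; since
    G >= 1, missing values and multiplicities can be filled up. *)
Lemma prod_fibers_le (R : realFieldType) (T : eqType) (f : T -> nat) m (U : seq T) (G : nat -> R) :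
  (forall c, count (fun p => f p == c) U <= m)%N -> (forall c, 1 <= G c) ->
  exists M, \prod_(p <- U) G (f p) <= (\prod_(c < M) G c) ^+ m.
Proof.
move=> cU G1; have [M MP] : exists M, {in U, forall p, f p < M}%N.
  exists (\max_(p <- U) f p).+1 => p pU; rewrite ltnS; exact: (@leq_bigmax_seq _ U _ f).
exists M.
have -> : \prod_(p <- U) G (f p) = \prod_(c < M) G c ^+ count (fun p => f p == c) U.
  elim: U MP {cU} => [|p U IH] MP; first by rewrite big_nil big1.
  rewrite big_cons IH => [|q qU]; last by apply: MP; rewrite in_cons qU orbT.
  have pM := MP p (mem_head _ _).
  rewrite (bigD1 (Ordinal pM)) //= [RHS](bigD1 (Ordinal pM)) //= eqxx exprS mulrA; congr (_ * _).
  apply: eq_bigr => c; rewrite -val_eqE /= => /negPf; rewrite eq_sym => -> //.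
rewrite -prodrXl; apply: ler_prod => c _; have G0 : 0 <= G c by apply: le_trans (G1 c).
by rewrite exprn_ge0 //= ler_weXn2l.
Qed.

Lemma prod_subset_le (R : realFieldType) M (t : seq nat) (q : R) : 1 <= q ->
  \prod_(c < M) (if (c : nat) \in t then q else 1) <= q ^+ size t.
Proof.
move=> q1; have q0 : 0 <= q by apply: le_trans q1.
rewrite -big_mkcond prodr_const /= ler_weXn2l //.
rewrite cardE -(size_map val); apply: uniq_leq_size.
  by rewrite (map_inj_uniq val_inj) enum_uniq.
by move=> c /mapP[i]; rewrite mem_enum => it ->.
Qed.

(** * Uniformly bounded sums and products *)

Section RealBounds.
Variable R : realType.

(** Dyadic blocks: the 2^j terms from 2^j on contribute at most q^j, where q = 2^(1 - s) < 1. *)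
Lemma sum_powR_bound (s : R) : 1 < s ->
  exists B, forall M, \sum_(c < M) c%:R `^ (- s) <= B.
Proof.
move=> s1; pose q : R := 2 `^ (1 - s).
have q0 : 0 < q by apply: powR_gt0.
have q1 : q < 1.
  by rewrite -(powRr0 2) /q /powR pnatr_eq0 /= ltr_expR ltr_pM2r ?ln_gt0 ?ltr1n //; lra.
have dyadic j : \sum_(c < 2 ^ j) c%:R `^ (- s) <= (1 - q ^+ j) / (1 - q).
  elim: j => [|j IH].
    (* The term c = 0 vanishes, a power of 0 with nonzero exponent being 0. *)
    by rewrite expr0 subrr mul0r big_ord1 powR0 // oppr_eq0; lra.
  rewrite expnS mul2n -addnn big_split_ord /=.
  have -> : (1 - q ^+ j.+1) / (1 - q) = (1 - q ^+ j) / (1 - q) + q ^+ j.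
    by rewrite exprS; field; rewrite subr_eq0 gt_eqF.
  apply: lerD => //.
  have p0 : (0 : R) < (2 ^ j)%:R by rewrite ltr0n expn_gt0.
  have -> : q ^+ j = \sum_(i < 2 ^ j) (2 ^ j)%:R `^ (- s).
    rewrite sumr_const card_ord -[RHS]mulr_natl; set X := (2 ^ j)%:R in p0 *.
    have -> : X * X `^ (- s) = X `^ (1 - s).
      rewrite (@powRD _ X 1 (- s)) ?powRr1 ?ltW //.
      by rewrite (gt_eqF p0) implybT.
    have -> : X = 2 `^ j%:R by rewrite powR_mulrn // -natrX.
    by rewrite -powRrM mulrC powRrM powR_mulrn // ltW.
  apply: ler_sum => i _; rewrite !powRN lef_pV2 ?posrE ?powR_gt0 // ?ltr0n ?addn_gt0 ?expn_gt0 //.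
  by apply: ge0_ler_powR; rewrite ?nnegrE ?ler0n ?ler_nat ?leq_addr //; lra.
exists (1 - q)^-1 => M.
apply: (@le_trans _ _ ((1 - q ^+ M) / (1 - q))); last first.
  apply: ler_piMl; first by rewrite invr_ge0 subr_ge0 ltW.
  by rewrite gerBl exprn_ge0 // ltW.
apply: le_trans (dyadic M); rewrite -!(big_mkord xpredT (fun c => c%:R `^ (- s))).
rewrite [leRHS](big_cat_nat (n := M)) //=; last exact/ltnW/ltn_expl.
by rewrite lerDl sumr_ge0 // => i _; exact: powR_ge0.
Qed.

Lemma prod_powR_bound (s C : R) : 1 < s -> 0 <= C ->
  exists E, forall M, \prod_(c < M) (1 + C * c%:R `^ (- s)) <= E.
Proof.
move=> /sum_powR_bound[B BP] C0; exists (expR (C * B)) => M.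
apply: (@le_trans _ _ (expR (\sum_(c < M) C * c%:R `^ (- s)))).
  rewrite expR_sum; apply: ler_prod => c _.
  by rewrite expR_ge1Dx addr_ge0 // mulr_ge0 // powR_ge0.
by rewrite ler_expR -mulr_sumr ler_wpM2l.
Qed.

(** Only the c below Q^(1/eps) give a factor above 1, and no factor exceeds [Q]. *)
Lemma prod_max_bound (eps Q : R) : 0 < eps -> 1 <= Q ->
  exists E, forall M, \prod_(c < M) Num.max 1 (Q / c%:R `^ eps) <= E.
Proof.
move=> e0 Q1; pose B := (Num.truncn (Q `^ eps^-1)).+1.
have Q0 : 0 < Q by apply: lt_le_trans Q1.
have BP c : (B <= c)%N -> Q / c%:R `^ eps <= 1.
  move=> Bc; have c0 : (0 : R) < c%:R by rewrite ltr0n; apply: leq_trans Bc.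
  rewrite ler_pdivrMr ?powR_gt0 // mul1r.
  have -> : Q = (Q `^ eps^-1) `^ eps by rewrite -powRrM mulVf ?gt_eqF // powRr1 // ltW.
  apply: ge0_ler_powR; rewrite ?nnegrE ?powR_ge0 ?ltW //.
  by apply: lt_le_trans (truncnS_gt _) _; rewrite ler_nat.
exists (Q ^+ size (iota 0 B)) => M; apply: le_trans (prod_subset_le M (iota 0 B) Q1).
apply: ler_prod => c _; rewrite le_max ler01 mem_iota add0n leq0n !andTb.
case: ltnP => cB; last by rewrite ge_max lexx BP.
rewrite ge_max Q1 /=; have [->|c0] := posnP c.
  by rewrite powR0 ?gt_eqF // invr0 mulr0 ltW.
rewrite ler_pdivrMr ?powR_gt0 ?ltr0n //; apply: ler_peMr; first exact: ltW.
have /ler_powR/(_ 0 eps (ltW e0)) : (1 : R) <= c%:R by rewrite ler1n.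
by rewrite powRr0.
Qed.

(** An infinite set would contain lists longer than [c], so the infinite value of [counting] is
    excluded. *)
Lemma count_le (T : choiceType) (A : set T) (c : R) :
  (forall X : seq T, uniq X -> {in X, forall x, A x} -> (size X)%:R <= c) ->
  (counting A <= c%:E)%E.
Proof.
move=> H; rewrite /counting; case: ifPn => /asboolP fA.
  rewrite lee_fin; apply: H; first exact: fset_uniq.
  by move=> x; rewrite in_fset_set // inE.
have [X [UX XA XE]] : exists X : seq T, [/\ uniq X, {in X, forall x, A x} &
    size X = (Num.truncn c).+1].
  elim: (Num.truncn c).+1 => [|j [X [UX XA XE]]]; first by exists [::].
  have [x Ax xX] : exists2 x, A x & x \notin X.
    apply: contrapT => nx; apply: fA; apply: (sub_finite_set _ (finite_seq X)).
    move=> x Ax /=; apply: contrapT => /negP xX; apply: nx; exists x => //.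
  exists (x :: X); split; rewrite /= ?xX ?XE //.
  by move=> y; rewrite in_cons => /orP[/eqP -> //|/XA].
have := H X UX XA; rewrite XE leNgt.
by rewrite truncnS_gt.
Qed.

End RealBounds.

Lemma size_le_fibers (T T' : eqType) (f : T -> T') N (t : seq T) (s : seq T') :
  uniq s -> {in t, forall x, f x \in s} ->
  (forall y, y \in s -> count (fun x => f x == y) t <= N)%N -> (size t <= N * size s)%N.
Proof.
move=> Us ts cN; suff -> : size t = (\sum_(y <- s) count (fun x => f x == y) t)%N.
  rewrite -(count_predT s) -sum1_count big_distrr /= muln1 big_seq [leqRHS]big_seq.
  exact: leq_sum.
elim: t ts {cN} => [|x t IH] ts /=; first by rewrite big1.
rewrite big_split /= -IH => [|y ty]; last by apply: ts; rewrite in_cons ty orbT.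
rewrite -add1n; congr (_ + _)%N; transitivity (count_mem (f x) s); first by rewrite count_uniq_mem // ts ?mem_head.
rewrite -sum1_count big_mkcond; apply: eq_bigr => y _ /=.
by rewrite eq_sym; case: eqP.
Qed.

(** * Fields with given Kummer primes *)

Section CyclicCount.
Variables (n N : nat) (k : set algC) (l : nat) (zeta : algC).
Hypothesis kN : is_nf n k.
Hypothesis lp : prime l.
Hypothesis zetaP : l.-primitive_root zeta.
Local Notation F := (adjoin k zeta).
Hypothesis FN : is_nf N F.

(** The primes of k(zeta) at which the valuation of some [alpha K] is not divisible by [l] lie over
    [s], and at most N of them over each member of [s], as these share a residue characteristic. The
    bound for elements modulo l-th powers applies, because distinct fields give distinct classes by
    uniqueness in Kummer theory. *)
Lemma same_primes_bound (Y : seq (set algC)) (alpha : set algC -> algC) (s : seq (set algC)) :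
  uniq Y -> (forall K, K \in Y -> is_cyclic_extension k l K /\ kummer_gen k l zeta K (alpha K)) ->
  uniq s -> (forall K, K \in Y -> kummer_primes k l zeta (alpha K) =i s) ->
  (size Y <= l ^ (N * size s) * (class_group_ell_order l F * l ^ N.+1))%N.
Proof.
move=> UY YP Us Ys.
have l0 := prime_gt0 lp.
pose t := undup (flatten [seq [seq P <- factors F (scale (alpha K) (integers F))
   | ~~ (l %| elt_val F P (alpha K))%N] | K <- Y]).
have aP K : K \in Y -> integers F (alpha K) /\ alpha K != 0.
  by move=> /YP[_ gK]; split; [case: gK | exact: kummer_gen_neq0 gK].
have tP P : P \in t -> is_prime F P /\ prime_below k P \in s.
  rewrite mem_undup => /flatten_mapP[K YK]; rewrite mem_filter => /andP[lv Pf].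
  have [Oa a0] := aP K YK.
  have pP : is_prime F P.
    by have [fP _] := factorsP FN (nz_principal FN Oa a0); apply: fP.
  by split=> //; rewrite -(Ys K YK); apply: mem_kummer_primes.
have tmem K P : K \in Y -> is_prime F P -> P \notin t -> (l %| elt_val F P (alpha K))%N.
  move=> YK pP; apply: contraR => lv; rewrite mem_undup; apply/flatten_mapP; exists K => //.
  rewrite mem_filter lv /= -has_pred1 has_count lt0n.
  by apply: contra lv => /eqP e; rewrite /elt_val /ideal_val e dvdn0.
have size_t : (size t <= N * size s)%N.
  apply: (size_le_fibers (f := prime_below k)) => // [P /tP[] //|p ps].
  rewrite -size_filter.
  have [e|] := posnP (size (seq.filter (fun x => prime_below k x == p) t)); first by rewrite e.
  rewrite -has_predT => /hasP[P]; rewrite mem_filter => /andP[/eqP Pp Pt] _.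
  have [pP _] := tP P Pt.
  have pk := prime_belowP kN FN pP.
  have [pc cP] := residue_charP kN pk.
  apply: (primes_over_count FN pc); first by apply: filter_uniq; apply: undup_uniq.
  move=> Q; rewrite mem_filter => /andP[/eqP Qp Qt]; split; first by case: (tP Q Qt).
  by move: cP; rewrite Pp -Qp => -[].
have tprime : {in t, forall P, is_prime F P} by move=> P /tP[].
have [d dN bound] := selmer_bound FN lp (undup_uniq _) tprime.
pose a (i : 'I_(size Y)) := alpha (nth set0 Y i).
have Yi (i : 'I_(size Y)) : nth set0 Y i \in Y by apply: mem_nth.
apply: leq_trans (bound _ a _ _ _) _.
- by move=> i; apply: aP.
- by move=> i P pP Pt; apply: tmem.
- move=> i j [g [Fg g0 e]].
  have [ci gi] := YP _ (Yi i); have [cj gj] := YP _ (Yi j).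
  have [_ di _] := gi; have [_ dj _] := gj.
  have := kummer_unique kN lp zetaP cj ci dj di Fg g0 e.
  by move/eqP; rewrite nth_uniq // => /eqP/val_inj.
by rewrite leq_mul // ?leq_mul // leq_exp2l ?prime_gt1.
Qed.

End CyclicCount.

Section CountBound.
Variables (R : realType) (n N : nat) (k : set algC) (l : nat) (zeta : algC).
Hypothesis kN : is_nf n k.
Hypothesis lp : prime l.
Hypothesis zetaP : l.-primitive_root zeta.
Local Notation F := (adjoin k zeta).
Hypothesis FN : is_nf N F.

Lemma count_residue_char (U : seq (set algC)) c : uniq U -> {in U, forall p, is_prime k p} ->
  (count (fun p => residue_char p == c) U <= n)%N.
Proof.
move=> UU Up; rewrite -size_filter.
have [->//|] := posnP (size (seq.filter (fun p => residue_char p == c) U)).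
rewrite -has_predT => /hasP[P]; rewrite mem_filter => /andP[/eqP Pc PU] _.
have [pc _] := residue_charP kN (Up P PU); rewrite Pc in pc.
apply: (primes_over_count kN pc); first exact: filter_uniq.
move=> Q; rewrite mem_filter => /andP[/eqP Qc QU]; split; first exact: Up.
by have [_] := residue_charP kN (Up Q QU); rewrite Qc.
Qed.

Lemma residue_char_gt0 p : is_prime k p -> (0 < residue_char p)%N.
Proof. by move=> /(residue_charP kN)[/prime_gt0]. Qed.

Lemma residue_char_le_norm p : is_prime k p -> (residue_char p <= ideal_norm k p)%N.
Proof.
move=> pP; have [j ->] := ideal_norm_prime kN pP.
by rewrite -{1}(expn1 (residue_char p)) leq_pexp2l // residue_char_gt0.
Qed.

Lemma prod_powR (T : Type) (s : seq T) (f : T -> R) (r : R) : (forall i, 0 <= f i) ->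
  \prod_(i <- s) f i `^ r = (\prod_(i <- s) f i) `^ r.
Proof.
move=> f0; elim: s => [|i s IH]; first by rewrite !big_nil powR1.
by rewrite !big_cons IH powRM // prodr_ge0.
Qed.

(** The exponent 1 + (l - 1) eps is (l - 1) e with e = 1/(l - 1) + eps. So the weights multiply to
    b^-e, where b, the product of the N(p)^(l - 1) over the good primes, is at most x. *)
Lemma kummer_weight K alpha (S : {fset set algC}) (B : seq nat) (x eps : R) :
  is_cyclic_extension k l K -> kummer_gen k l zeta K alpha ->
  (forall p, p \in S -> is_prime k p) -> l \in B ->
  (forall p, p \in S -> residue_char p \in B) -> 0 < eps ->
  (prime_to_part k S (ideal_norm k (discriminant k K)))%:R <= x ->
  1 <= x `^ ((l%:R - 1)^-1 + eps) * \prod_(p <- kummer_primes k l zeta alpha)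
    (if residue_char p \in B then 1 else (ideal_norm k p)%:R `^ (- (1 + (l%:R - 1) * eps))).
Proof.
move=> cK gK SP lB SB e0 xP; set T := kummer_primes _ _ _ _.
have l1 : (0 : R) < l%:R - 1 by rewrite subr_gt0 ltr1n prime_gt1.
set e := _ + eps.
have ee : - (1 + (l%:R - 1) * eps) = l.-1%:R * - e.
  rewrite -subn1 natrB ?prime_gt0 // /e; field; rewrite gt_eqF //.
have e_ge0 : 0 <= e by rewrite addr_ge0 ?ltW // invr_gt0.
pose T' := seq.filter (fun p => residue_char p \notin B) T.
pose b := (\prod_(p <- T') ideal_norm k p ^ l.-1)%N.
have T'P p : p \in T' -> is_prime k p.
  rewrite mem_filter => /andP[_ pT].
  have [Oa _ _] := gK.
  have [P [pP -> _]] := kummer_primesP FN Oa (kummer_gen_neq0 gK) pT.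
  exact: (prime_belowP kN FN).
have b_gt0 : (0 < b)%N.
  rewrite /b big_seq; apply: prodn_cond_gt0 => p /T'P pP.
  by rewrite expn_gt0 (ideal_norm_gt0 kN) //; exact: prime_nz.
have bx : b%:R <= x.
  apply: le_trans xP; rewrite ler_nat.
  apply: (tame_norm_bound kN lp zetaP FN cK gK SP); first exact/filter_uniq/undup_uniq.
  move=> p; rewrite mem_filter => /andP[pB pT]; split=> //.
    by apply: contraNneq pB => ->.
  by move=> p' /SB p'B; apply: contraNneq pB => <-.
have -> : \prod_(p <- T) (if residue_char p \in B then 1 else
    (ideal_norm k p)%:R `^ (- (1 + (l%:R - 1) * eps))) = b%:R `^ (- e).
  rewrite (eq_bigr (fun p => if residue_char p \notin B then
    (ideal_norm k p)%:R `^ (- (1 + (l%:R - 1) * eps)) else 1)); last by move=> p _; case: ifP.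
  rewrite -big_mkcond -big_filter /b natr_prod -/T'.
  rewrite -prod_powR //; apply: eq_bigr => p _.
  by rewrite ee powRrM powR_mulrn // natrX.
have b0 : (0 : R) < b%:R by rewrite ltr0n.
rewrite powRN ler_pdivlMr ?powR_gt0 // mul1r.
by apply: ge0_ler_powR; rewrite ?nnegrE ?ler0n //; apply: le_trans bx; exact: ltW.
Qed.

(** As N(p) is at least the residue characteristic c, the factor of p is bounded in terms of c: by 1
    + C for c in [B], by 1 + C c^-s otherwise. [G] takes both factors for c in [B], so that the two
    products separate. *)
Lemma kummer_prod_le (U : seq (set algC)) (B : seq nat) (C s E : R) :
  uniq U -> {in U, forall p, is_prime k p} -> 0 <= C -> 0 <= s ->
  (forall M, \prod_(c < M) (1 + C * c%:R `^ (- s)) <= E) ->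
  \prod_(p <- U) (1 + C * (if residue_char p \in B then 1 else (ideal_norm k p)%:R `^ (- s)))
    <= ((1 + C) ^+ size B * E) ^+ n.
Proof.
move=> UU Up C0 s0 EP.
pose G c : R := (if c \in B then 1 + C else 1) * (1 + C * c%:R `^ (- s)).
have C1 : 1 <= 1 + C by rewrite lerDl.
have h1 c : 1 <= 1 + C * c%:R `^ (- s) by rewrite lerDl mulr_ge0 ?powR_ge0.
have G1 c : 1 <= G c.
  by rewrite -[1]mulr1 ler_pM //; case: ifP.
have [M MP] := prod_fibers_le (fun c => count_residue_char c UU Up) G1.
apply: (@le_trans _ _ (\prod_(p <- U) G (residue_char p))).
  rewrite big_seq [leRHS]big_seq; apply: ler_prod => p pU.
  have w0 : 0 <= (if residue_char p \in B then 1 else (ideal_norm k p)%:R `^ (- s)).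
    by case: ifP => // _; exact: powR_ge0.
  rewrite addr_ge0 ?mulr_ge0 //= /G; case: ifP => _.
    by rewrite mulr1 ler_peMr // (le_trans _ C1).
  rewrite mul1r lerD2l ler_wpM2l //.
  have r0 : (0 : R) < (residue_char p)%:R by rewrite ltr0n; apply/residue_char_gt0/Up.
  have rn : (residue_char p)%:R <= (ideal_norm k p)%:R :> R.
    by rewrite ler_nat; apply/residue_char_le_norm/Up.
  rewrite !powRN lef_pV2 ?posrE ?powR_gt0 // ?(lt_le_trans r0 rn) //.
  by apply: ge0_ler_powR; rewrite ?nnegrE ?ler0n.
apply: le_trans MP _; apply: lerXn2r; rewrite ?nnegrE.
- by apply: prodr_ge0 => c _; apply: le_trans (G1 c).
- by rewrite mulr_ge0 ?exprn_ge0 ?(le_trans _ C1) //; have := EP 0%N; rewrite big_ord0; apply: le_trans.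
rewrite big_split /=; apply: ler_pM => //.
- by apply: prodr_ge0 => c _; case: ifP => // _; apply: le_trans C1.
- by apply: prodr_ge0 => c _; apply: le_trans (h1 c).
- exact: prod_subset_le.
exact: EP.
Qed.

(** One factor [Q] is at most c^eps max(1, Q / c^eps), with c the residue characteristic; the norm
    absorbs c^eps, and the maxima have a bounded product. *)
Lemma exprn_size_le (S0 : seq (set algC)) (Q E eps : R) :
  uniq S0 -> {in S0, forall p, is_prime k p} -> 1 <= Q -> 0 < eps ->
  (forall M, \prod_(c < M) Num.max 1 (Q / c%:R `^ eps) <= E) ->
  Q ^+ size S0 <= (\prod_(p <- S0) ideal_norm k p)%N%:R `^ eps * E ^+ n.
Proof.
move=> US Sp Q1 e0 EP; have Q0 : 0 <= Q by apply: le_trans Q1.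
pose G c := Num.max 1 (Q / c%:R `^ eps).
have G1 c : 1 <= G c by rewrite le_max lexx.
have [M MP] := prod_fibers_le (fun c => count_residue_char c US Sp) G1.
rewrite natr_prod -prod_powR //.
apply: (@le_trans _ _ (\prod_(p <- S0) ((ideal_norm k p)%:R `^ eps) *
    \prod_(p <- S0) G (residue_char p))).
  have -> : Q ^+ size S0 = \prod_(p <- S0) Q.
    by elim: (S0) => [|p t IH]; rewrite ?big_nil // big_cons -IH -exprS.
  rewrite -big_split /= big_seq [leRHS]big_seq; apply: ler_prod => p /Sp pP.
  have r0 : (0 : R) < (residue_char p)%:R by rewrite ltr0n residue_char_gt0.
  have rn : (residue_char p)%:R <= (ideal_norm k p)%:R :> R.
    by rewrite ler_nat residue_char_le_norm.
  have rpos : 0 < (residue_char p)%:R `^ eps by exact: powR_gt0.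
  rewrite Q0 /=; apply: (@le_trans _ _ ((residue_char p)%:R `^ eps * G (residue_char p))).
    rewrite -[leLHS](divfK (lt0r_neq0 rpos)) mulrC ler_pM2l //.
    by rewrite le_max lexx orbT.
  apply: ler_wpM2r; first by apply: le_trans (G1 _).
  by apply: ge0_ler_powR; rewrite ?nnegrE ?ler0n // ltW.
apply: ler_wpM2l; first by apply: prodr_ge0 => p _; exact: powR_ge0.
apply: le_trans MP _; apply: lerXn2r; rewrite ?nnegrE.
- by apply: prodr_ge0 => c _; apply: le_trans (G1 c).
- by have := EP 0%N; rewrite big_ord0; apply: le_trans.
exact: EP.
Qed.

End CountBound.

Lemma cyclic_count_bound (R : realType) (l n : nat) (eps : R) : prime l -> 0 < eps ->
  exists2 c : R, 0 <= c & forall k zeta, is_nf n k -> l.-primitive_root zeta ->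
  forall (S : {fset set algC}) (q : set algC), (forall p, p \in S -> is_prime k p) ->
  forall (x : R) (X : seq (set algC)), uniq X ->
  {in X, forall K, is_cyclic_extension k l K /\
    (prime_to_part k S (ideal_norm k (discriminant k K)))%:R <= x} ->
  (size X)%:R <= c * (class_group_ell_order l (adjoin k zeta))%:R
     * (tame_product k l S q)%:R `^ eps * x `^ ((l%:R - 1)^-1 + eps).
Proof.
move=> lp eps0.
have l1 : (0 : R) < l%:R - 1 by rewrite subr_gt0 ltr1n prime_gt1.
pose s : R := 1 + (l%:R - 1) * eps.
have s1 : 1 < s by rewrite ltrDl mulr_gt0.
have s0 : 0 <= s by rewrite ltW // (lt_trans ltr01).
(* Over one prime of [k] lie at most [F:Q] <= n l primes of F = k(zeta), each costing a factor [l];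
   [C0] accounts for at most n l independent units and for the roots of unity. *)
pose C : R := (l ^ (n * l))%:R; pose C0 : R := (l ^ (n * l).+1)%:R.
have C_ge0 : 0 <= C by exact: ler0n.
pose Q : R := (1 + C) ^+ n.
have Q1 : 1 <= Q by rewrite exprn_ege1 // lerDl.
have Q0 : 0 <= Q by apply: le_trans Q1.
have [E1 E1P] := prod_powR_bound s1 C_ge0; have [E2 E2P] := prod_max_bound eps0 Q1.
have E10 : 0 <= E1 by have := E1P 0%N; rewrite big_ord0; apply: le_trans.
have E20 : 0 <= E2 by have := E2P 0%N; rewrite big_ord0; apply: le_trans.
exists (C0 * (Q ^+ 2 * E1 ^+ n * E2 ^+ n)).
  apply: mulr_ge0; first exact: ler0n.
  by apply: mulr_ge0; [apply: mulr_ge0 |]; exact: exprn_ge0.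
move=> k zeta kN zetaP S q SP x X UX XP.
have [N Nle FN] := is_nf_adjoin_root kN zetaP.
set cl := class_group_ell_order _ _; set e := _ + eps.
have /choice[alpha alphaP] : forall K, exists a, is_cyclic_extension k l K ->
    kummer_gen k l zeta K a.
  move=> K; have [cK|nc] := pselect (is_cyclic_extension k l K); last by exists 0.
  by have [a aP] := exists_kummer kN lp zetaP cK; exists a => _.
pose tame p := (p != q) && ~~ `[< ideal_dvd k p (module_span k [set l%:R]) >].
pose S0 : seq (set algC) := [seq p <- S | tame p].
have S0P : {in S0, forall p, is_prime k p}.
  by move=> p; rewrite mem_filter => /andP[_]; apply: SP.
(* A member of [S] outside [S0] is [q] or divides [l]; so this list covers all residue
   characteristics of [S]. Its two entries besides [S0] are the origin of [Q ^+ 2]. *)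
pose B := [:: l, residue_char q & [seq residue_char p | p <- S0]].
have SB p : p \in S -> residue_char p \in B.
  move=> pS; rewrite !inE; have [tp|] := boolP (tame p).
    by rewrite map_f ?orbT // mem_filter tp.
  rewrite negb_and !negbK => /orP[/eqP -> |/asboolP[M iM e']]; first by rewrite eqxx orbT.
  have pP := SP p pS; have sp := nz_ideal_submodule (prime_nz pP).
  rewrite (residue_char_unique kN pP lp) ?eqxx //.
  have : module_span k [set l%:R] l%:R by apply: module_span_gen.
  rewrite e'; apply: ideal_mul_min => // a b pa Mb; rewrite mulrC.
  by apply: (subM sp) => //; apply: iM.2.
have CC : C0 * cl%:R = (l ^ (n * l).+1 * cl)%:R by rewrite natrM.
have l0 := prime_gt0 lp.
have [U [UU UX' bound]] : exists U, [/\ uniq U,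
    forall p, p \in U -> exists2 K, K \in X & p \in kummer_primes k l zeta (alpha K)
    & (size X)%:R <= C0 * cl%:R * x `^ e * \prod_(p <- U) (1 + C *
        (if residue_char p \in B then 1 else (ideal_norm k p)%:R `^ (- s)))].
  apply: weighted_count_seq => //.
  - by rewrite CC.
  - exact: powR_ge0.
  - by move=> p; case: ifP => // _; exact: powR_ge0.
  - by move=> K _; exact: undup_uniq.
  - move=> t Y Ut YX Yt; rewrite CC -natrX -natrM ler_nat.
    apply: leq_trans (same_primes_bound kN lp zetaP FN (alpha := alpha) _ _ Ut Yt) _.
    + exact: subseq_uniq YX UX.
    + by move=> K /(mem_subseq YX) /XP[cK _]; split=> //; apply: alphaP.
    rewrite -expnM [leqRHS]mulnC leq_mul //.
      by rewrite leq_pexp2l // leq_mul2r Nle orbT.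
    by rewrite mulnC leq_mul2r leq_pexp2l ?orbT.
  move=> K /XP[cK xK]; apply: (kummer_weight kN lp zetaP FN cK _ SP) => //.
  - exact: alphaP.
  - by rewrite mem_head.
have Up : {in U, forall p, is_prime k p}.
  move=> p /UX'[K /XP[cK _] pK]; have gK := alphaP K cK; have [Oa _ _] := gK.
  have [P [pP -> _]] := kummer_primesP FN Oa (kummer_gen_neq0 gK) pK.
  exact: (prime_belowP kN FN).
apply: le_trans bound _.
have US0 : uniq S0 by apply: filter_uniq; apply: fset_uniq.
have b1 := kummer_prod_le kN B UU Up C_ge0 s0 E1P.
have b2 := exprn_size_le kN US0 S0P Q1 eps0 E2P.
have tpE : (\prod_(p <- S0) ideal_norm k p)%N = tame_product k l S q by rewrite big_filter.
rewrite tpE in b2.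
have b3 : ((1 + C) ^+ size B * E1) ^+ n <=
    Q ^+ 2 * E1 ^+ n * E2 ^+ n * (tame_product k l S q)%:R `^ eps.
  rewrite exprMn -exprM mulnC exprM -/Q /= size_map !exprS mulrA -expr2.
  rewrite [leRHS](_ : _ = Q ^+ 2 * ((tame_product k l S q)%:R `^ eps * E2 ^+ n) * E1 ^+ n); last by ring.
  by rewrite ler_wpM2r ?exprn_ge0 // ler_wpM2l // exprn_ge0.
apply: (@le_trans _ _ (C0 * cl%:R * x `^ e * (Q ^+ 2 * E1 ^+ n * E2 ^+ n *
    (tame_product k l S q)%:R `^ eps))).
  apply: ler_wpM2l; last exact: le_trans b1 b3.
  by rewrite CC mulr_ge0 ?powR_ge0.
by rewrite le_eqVlt; apply/orP; left; apply/eqP; ring.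
Qed.

Theorem theorem2p5 (R : realType) (l m : nat) (hl : prime l) (hm : (1 <= m)%N) :
  exists r : R, 1 <= r /\
  forall eps : R, 0 < eps ->
  exists c : R,
  forall (k : set algC) (zeta : algC),
    is_number_field m k -> l.-primitive_root zeta ->
    (forall (S : {fset set algC}) (q : set algC),
       (forall p, p \in S -> is_prime k p) -> is_prime k q ->
       forall x : R, 0 < x ->
       (count_Y k S l x <=
          (c * (class_group_ell_order l (adjoin k zeta))%:R
             * (tame_product k l S q)%:R `^ (r * eps)
             * x `^ ((l%:R - 1)^-1 + eps))%:E)%E) /\
    (forall x : R, 0 < x ->
       (count_Z k l x <=
          (c * (class_group_ell_order l (adjoin k zeta))%:R
             * x `^ ((l%:R - 1)^-1 + eps))%:E)%E).
Proof.
exists 1; split=> // eps eps0.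
have [c c0 cP] := cyclic_count_bound m hl eps0.
exists c => k zeta /is_nf_number_field kN zetaP; split=> [S q SP _|] x _.
  rewrite mul1r; apply: count_le => X UX XA.
  exact: (cP k zeta kN zetaP S q SP x X UX XA).
apply: count_le => X UX XA.
(* For empty S the tame product is an empty product, and the part prime to S divides the norm of the
   discriminant, so that it is at most this norm. *)
have := cP k zeta kN zetaP fset0 set0 _ x X UX _.
rewrite /tame_product big_nil powR1 mulr1; apply=> // K /XA[cK Kx]; split=> //.
apply: le_trans Kx; rewrite ler_nat; apply/bigmax_leqP_seq => d.
have [a aP] := exists_kummer kN hl zetaP cK; have [N _ FN] := is_nf_adjoin_root kN zetaP.
have D0 := ideal_norm_gt0 kN (nz_discriminant kN cK (aP : kummer_gen _ _ _ _ _)).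
by rewrite -dvdn_divisors // => /(dvdn_leq D0).
Qed.
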